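(* Let $\tilde D$ be a $d\times d$ dilation matrix, consider the associated standard multiresolution structure $(\mathbb{Z}^d,D)$ on $L^2(\mathbb{R}^d)$, and let $(Y_n)_{n\in\mathbb{Z}}$ be the associated wavelet chain of Hilbert $L^\infty(\mathbb{T}^d)$-modules. Suppose that $\psi^1,\dots,\psi^M$ are elements of $L^2(\mathbb{R}^d)$. Then $\{\psi^1,\dots,\psi^M\}$ is an orthonormal multiwavelet if and only if 1. for $i,j=1,\dots,M$ and all integers $k,n$, $$[\![\hat D^n\hat\psi^i,\hat D^k\hat\psi^j]\!]_n=\delta_{i,j}\,\delta_{k,n}\,\mathbf{1},$$ where $\delta$ is the Kronecker delta and $\mathbf{1}$ is the function on $\mathbb{T}^d$ taking the value $1$ everywhere; and 2. for all $f\in L^2(\mathbb{R}^d)$, $$\hat f=\sum_{i=1}^M\sum_{n\in\mathbb{Z}}\hat D^n\hat\psi^i\ \widehat{\circ_n}\ [\![\hat D^n\hat\psi^i,\hat f]\!]_n,$$ and this sum converges in $L^2(\mathbb{R}^d)$. Furthermore, if $\{\psi^1,\dots,\psi^M\}$ is a multiwavelet, then $\hat\psi^i\in Y_0$ for all $i$. If $\{\varphi^1,\dots,\varphi^r\}$ is a set of scaling functions, then $\hat\varphi^i\in Y_0$ for all $i$.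
   Context: Conventions. $\mathbb{T}^d=\mathbb{R}^d/\mathbb{Z}^d$ with normalised Haar measure; $\widehat{\mathbb{R}^d}$ is identified with $\mathbb{R}^d$ through $(x,\xi)=e^{2\pi i x\cdot\xi}$. The Fourier transform $\mathcal{F}$ on $\mathbb{R}^d$ is $\hat f(\xi)=\int f(x)(x,\xi)\,dx$ (extended to $L^2$). A dilation matrix is an integer $d\times d$ matrix $\tilde D$ all of whose eigenvalues are greater than $1$ in absolute value; $m=|\det\tilde D|$. The standard multiresolution structure consists of $\Gamma=\mathbb{Z}^d$ acting on $L^2(\mathbb{R}^d)$ by $(\gamma f)(x)=f(x-\gamma)$ and the dilation $(Df)(x)=\sqrt m\,f(\tilde Dx)$. Put $\hat D=\mathcal{F}D\mathcal{F}^*$, i.e. $(\hat Dp)(\xi)=\frac{1}{\sqrt m}p((\tilde D^* )^{-1}\xi)$. A finite set $\{\psi^1,\dots,\psi^M\}$ is an orthonormal multiwavelet (abbreviated multiwavelet) if $\{D^n(\gamma(\psi^i))\}_{\gamma\in\mathbb{Z}^d,\,n\in\mathbb{Z},\,i=1,\dots,M}$ is an orthonormal basis of $L^2(\mathbb{R}^d)$. A generalised multiresolution analysis is a sequence $(V_n)_{n\in\mathbb{Z}}$ of closed subspaces of $L^2(\mathbb{R}^d)$ with $V_n\subset V_{n+1}$, $\bigcup V_n$ dense, $\bigcap V_n=\{0\}$, $D(V_n)=V_{n+1}$ and $V_0$ invariant under $\Gamma$; it is a multiresolution analysis of multiplicity $r$ if there are functions $\varphi^1,\dots,\varphi^r$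 such that $\{\gamma(\varphi^i)\}_{\gamma\in\Gamma,\,i=1,\dots,r}$ is an orthonormal basis of $V_0$, and then $\{\varphi^1,\dots,\varphi^r\}$ is called a set of scaling functions. Let $\hat\iota_n(\xi)=\hat\iota(\tilde D^{*-n}\xi)$, where $\hat\iota:\widehat{\mathbb{R}^d}\to\mathbb{T}^d$ is the quotient map. Then $[\![p,q]\!]_n(\zeta)=m^n\sum_{\hat\iota_n(\xi)=\zeta}\overline{p(\xi)}q(\xi)$ for a.e. $\zeta\in\mathbb{T}^d$ ($p,q\in L^2(\widehat{\mathbb{R}^d})$), and $(p\,\widehat{\circ_n}\,b)(\xi)=p(\xi)b(\hat\iota_n(\xi))$ for a function $b$ on $\mathbb{T}^d$. $Y_n$ is the set of measurable functions $p$ on $\widehat{\mathbb{R}^d}$ (modulo a.e. equality) for which $\|p\|_{Y_n}=\sqrt{\operatorname{ess\,sup}_{\zeta\in\mathbb{T}^d}[\![p,p]\!]_n(\zeta)}$ is finite; with $[\![\cdot,\cdot]\!]_n$ (the series converging weak* in $L^\infty(\mathbb{T}^d)$) and $\widehat{\circ_n}$ it is a Hilbert $L^\infty(\mathbb{T}^d)$-module. The sequence $(Y_n)_{n\in\mathbb{Z}}$ is called a wavelet chain of Hilbert $L^\infty(\mathbb{T}^d)$-modules. *)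

(* Defs.v *)
From HB Require Import structures.
From mathcomp Require Import all_boot all_order all_algebra.
From mathcomp Require Import finmap complex.
From mathcomp Require Import all_classical all_reals all_analysis.
From mathcomp Require Import ess_sup_inf.

Set Implicit Arguments.
Unset Strict Implicit.
Unset Printing Implicit Defensive.

Import Order.TTheory GRing.Theory Num.Theory.
Import numFieldNormedType.Exports.

Local Open Scope classical_set_scope.
Local Open Scope ring_scope.
Local Open Scope complex_scope.

Definition measure_matrix_display : measure_display -> measure_display.
Proof. exact. Qed.

Section measurable_matrix.
Context {disp : measure_display} {T : measurableType disp}.
Variables m n : nat.

(* The product sigma-algebra; for ['cV[R]_d] these are the Borel sets. *)
Definition matrix_cylinder : set (set 'M[T]_(m, n)) :=
  [set C | exists ij : 'I_m * 'I_n, exists2 B : set T, measurable B &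
    C = (fun X : 'M[T]_(m, n) => X ij.1 ij.2) @^-1` B].

HB.instance Definition _ := @isMeasurable.Build (measure_matrix_display disp)
  'M[T]_(m, n) <<s matrix_cylinder >>
  (@sigma_algebra0 _ setT matrix_cylinder)
  (@sigma_algebraC _ matrix_cylinder)
  (@sigma_algebra_bigcup _ setT matrix_cylinder).

Lemma measurable_matrix_coord (i : 'I_m) (j : 'I_n) :
  measurable_fun [set: 'M[T]_(m, n)] (fun X : 'M[T]_(m, n) => X i j).
Proof.
move=> _ B mB; rewrite setTI; apply: sub_sigma_algebra.
by exists (i, j); exists B.
Qed.

Lemma measurable_matrixP (disp' : measure_display) (S : measurableType disp')
    (f : S -> 'M[T]_(m, n)) :
  (forall i j, measurable_fun [set: S] (fun x => f x i j)) ->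
  measurable_fun [set: S] f.
Proof.
move=> mf; apply: (@measurability _ _ _ _ setT f matrix_cylinder) => //.
by move=> _ [_ [[i j] [B mB ->]] <-]; exact: mf.
Qed.

End measurable_matrix.

Section lebesgue_step.
Context {R : realType} (d : nat).
Variable mu : {sigma_finite_measure set 'cV[R]_d -> \bar R}.
Let leb : {sigma_finite_measure set (measurableTypeR R) -> \bar R} :=
  @lebesgue_measure R.
Local Open Scope ereal_scope.

Let stack (z : measurableTypeR R * 'cV[R]_d) : 'cV[R]_(1 + d) := col_mx z.1%:M z.2.

Let measurable_stack : measurable_fun setT stack.
Proof.
apply: measurable_matrixP => i j; rewrite ord1.
have [k ->|k ->] := split_ordP i.
  rewrite (_ : (fun _ => _) = fst) //; apply/funext => z.
  by rewrite /stack col_mxEu !ord1 mxE eqxx mulr1n.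
rewrite (_ : (fun _ => _) = (fun X : 'cV[R]_d => X k ord0) \o snd).
  exact: (measurableT_comp (measurable_matrix_coord k ord0) measurable_snd).
by apply/funext => z; rewrite /stack col_mxEd.
Qed.

Definition lebesgue_cV_step : set 'cV[R]_(1 + d) -> \bar R :=
  pushforward (leb \x mu) stack.

Let step0 : lebesgue_cV_step set0 = 0.
Proof. by rewrite /lebesgue_cV_step /pushforward preimage_set0 measure0. Qed.

Let step_ge0 A : 0 <= lebesgue_cV_step A.
Proof. exact: measure_ge0. Qed.

Let step_sigma_additive : semi_sigma_additive lebesgue_cV_step.
Proof. exact: measure_semi_sigma_additive. Qed.

HB.instance Definition _ := isMeasure.Build _ _ _ lebesgue_cV_step
  step0 step_ge0 step_sigma_additive.

Let step_sigma_finite : sigma_finite setT lebesgue_cV_step.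
Proof.
have /sigma_finiteP[F [TF ndF Foo]] := sigma_finiteT leb.
have /sigma_finiteP[G [TG ndG Goo]] := sigma_finiteT mu.
pose unstack (x : 'cV[R]_(1 + d)) : measurableTypeR R * 'cV[R]_d :=
  (usubmx x ord0 ord0, dsubmx x).
have munstack : measurable_fun setT unstack.
  apply/measurable_fun_pair.
    rewrite [X in measurable_fun _ X](_ : _ = (fun X : 'cV[R]_(1 + d) => X (lshift d ord0) ord0)).
      exact: measurable_matrix_coord.
    by apply/funext => x /=; rewrite mxE.
  apply: measurable_matrixP => i j /=.
  rewrite [X in measurable_fun _ X](_ : _ = (fun X : 'cV[R]_(1 + d) => X (rshift 1 i) j)).
    exact: measurable_matrix_coord.
  by apply/funext => x /=; rewrite mxE.
have stackK : cancel stack unstack.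
  by move=> [a v]; rewrite /unstack /stack col_mxKu col_mxKd mxE eqxx mulr1n.
exists (fun n => unstack @^-1` (F n `*` G n)).
  rewrite -preimage_bigcup (_ : \bigcup_n _ = setT) ?preimage_setT//.
  rewrite -setXTT TF TG predeqE => -[x y]; split.
    by move=> [n _ []/= ? ?]; split; exists n.
  move=> [/= [n _ Fnx] [k _ Gky]]; exists (maxn n k) => //; split.
  - by move: x Fnx; exact/subsetPset/ndF/leq_maxl.
  - by move: y Gky; exact/subsetPset/ndG/leq_maxr.
move=> n; have [mF Fn] := Foo n; have [mG Gn] := Goo n; split.
  by rewrite -[X in measurable X]setTI; apply: munstack => //; exact: measurableX.
rewrite /lebesgue_cV_step /pushforward -comp_preimage.
rewrite (_ : unstack \o stack = id); last by apply/funext => z /=; rewrite stackK.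
by rewrite preimage_id product_measure1E// lte_mul_pinfty// ge0_fin_numE.
Qed.

HB.instance Definition _ := @Measure_isSigmaFinite.Build _ _ _ lebesgue_cV_step
  step_sigma_finite.

End lebesgue_step.

Fixpoint lebesgue_cV (R : realType) (d : nat) :
    {sigma_finite_measure set 'cV[R]_d -> \bar R} :=
  if d is d'.+1 return {sigma_finite_measure set 'cV[R]_d -> \bar R}
  then lebesgue_cV_step (lebesgue_cV R d') else \d_(0 : 'cV[R]_0).

Section torus.
Context (R : realType) (d : nat).
Local Open Scope quotient_scope.

Definition int_congr (x y : 'cV[R]_d) : bool := x - y \is a mxOver Num.int.

Fact int_congr_refl : reflexive int_congr.
Proof. by move=> x; rewrite /int_congr subrr mxOver0// rpred0. Qed.

Fact int_congr_sym : symmetric int_congr.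
Proof.
move=> x y; rewrite /int_congr; apply/mxOverP/mxOverP => xy i j.
  by rewrite -opprB mxE rpredN xy.
by rewrite -opprB mxE rpredN xy.
Qed.

Fact int_congr_trans : transitive int_congr.
Proof.
move=> y x z /mxOverP xy /mxOverP yz; apply/mxOverP => i j.
by rewrite -(subrKA y) mxE rpredD.
Qed.

Canonical int_congr_equiv :=
  EquivRel int_congr int_congr_refl int_congr_sym int_congr_trans.

(* [T^d = R^d / Z^d]. *)
Definition torus : Type := {eq_quot int_congr}.

HB.instance Definition _ := Choice.on torus.

Definition torus_pi (x : 'cV[R]_d) : torus := \pi_{eq_quot int_congr} x.

HB.instance Definition _ := isPointed.Build torus (torus_pi 0).

(* The quotient sigma-algebra, i.e. the Borel sets of [T^d]. *)
Definition torus_measurable : set (set torus) :=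
  [set E | measurable (torus_pi @^-1` E)].

Let torus_measurable0 : torus_measurable set0.
Proof. by rewrite /torus_measurable /= preimage_set0. Qed.

Let torus_measurableC E : torus_measurable E -> torus_measurable (~` E).
Proof.
by rewrite /torus_measurable /= preimage_setC; exact: measurableC.
Qed.

Let torus_measurable_bigcup (F : (set torus)^nat) :
  (forall i, torus_measurable (F i)) -> torus_measurable (\bigcup_i F i).
Proof.
by move=> mF; rewrite /torus_measurable /= preimage_bigcup; exact: bigcupT_measurable.
Qed.

HB.instance Definition _ := @isMeasurable.Build default_measure_display
  torus torus_measurable torus_measurable0 torus_measurableC
  torus_measurable_bigcup.

Lemma measurable_torus_pi : measurable_fun setT torus_pi.
Proof. by move=> _ E mE; rewrite setTI. Qed.

Definition unit_cube : set 'cV[R]_d := [set x | forall i, 0 <= x i ord0 < 1].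

Lemma measurable_unit_cube : measurable unit_cube.
Proof.
rewrite (_ : unit_cube = \bigcap_(i in [set: 'I_d])
    ((fun X : 'cV[R]_d => X i ord0) @^-1` `[0, 1[)); last first.
  apply/seteqP; split=> x /=; first by move=> H i _ /=; rewrite in_itv /= H.
  by move=> H i; have := H i Logic.I; rewrite /= in_itv.
apply: fin_bigcap_measurable => [|i _]; first exact: finite_finset.
rewrite -[X in measurable X]setTI; apply: measurable_matrix_coord => //.
Qed.

(* Haar measure: Lebesgue measure on a fundamental domain, pushed forward. *)
Definition haar : set torus -> \bar R :=
  pushforward (mrestr (lebesgue_cV R d) measurable_unit_cube) torus_pi.

Let haar0 : haar set0 = 0%E.
Proof. by rewrite /haar /pushforward preimage_set0 measure0. Qed.

Let haar_ge0 A : (0 <= haar A)%E.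
Proof. by rewrite /haar /pushforward /mrestr measure_ge0. Qed.

Let haar_sigma_additive : semi_sigma_additive haar.
Proof. by apply: measure_semi_sigma_additive; exact: measurable_torus_pi. Qed.

HB.instance Definition _ := isMeasure.Build _ _ _ haar
  haar0 haar_ge0 haar_sigma_additive.

End torus.

Section complex_integration.
Context {R : realType}.
Local Notation normc := Normc.normc.

Definition cmeasurable (disp : measure_display) (T : measurableType disp)
    (f : T -> R[i]) : Prop :=
  measurable_fun setT (fun x => complex.Re (f x)) /\
  measurable_fun setT (fun x => complex.Im (f x)).

Definition cintegral (disp : measure_display) (T : measurableType disp)
    (mu : {measure set T -> \bar R}) (f : T -> R[i]) : R[i] :=
  (\int[mu]_x complex.Re (f x)) +i* (\int[mu]_x complex.Im (f x)).

(* The sum of an absolutely summable family; no meaning otherwise, because of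
   [fine]. *)
Definition rsum (T : choiceType) (S : set T) (f : T -> R) : R :=
  fine (\esum_(x in S) (f^\+ x)%:E) -
  fine (\esum_(x in S) (f^\- x)%:E).

Definition csum (T : choiceType) (S : set T) (f : T -> R[i]) : R[i] :=
  rsum S (fun x => complex.Re (f x)) +i* rsum S (fun x => complex.Im (f x)).

(* [||f||_p] for complex-valued f. *)
Definition cLnorm (disp : measure_display) (T : measurableType disp)
    (mu : {measure set T -> \bar R}) (p : \bar R) (f : T -> R[i]) : \bar R :=
  Lnorm mu p (fun x => (normc (f x))%:E).

End complex_integration.

Section euclidean.
Context {R : realType} {d : nat}.
Local Notation Rd := 'cV[R]_d.
Local Notation fn := (Rd -> R[i]).
Local Notation normc := Normc.normc.
Local Notation leb := (lebesgue_cV R d).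

(* Elements of L^p(R^d) are represented by functions; all the notions below
   are invariant under a.e. equality. *)
Definition Lp (p : \bar R) : set fn :=
  [set f | cmeasurable f /\ (cLnorm leb p f < +oo)%E].

Definition L2dist (f g : fn) : \bar R := cLnorm leb 2%:E (fun x => f x - g x).

Definition inner (f g : fn) : R[i] :=
  cintegral leb (fun x => (f x)^* * g x).

Definition expi (t : R) : R[i] := cos t +i* sin t.

(* The duality pairing [(x, xi) = e^(2 i pi x.xi)]. *)
Definition pairing (x xi : Rd) : R[i] :=
  expi (2 * pi * \sum_(i < d) x i ord0 * xi i ord0).

Definition fourier1 (f : fn) : fn :=
  fun xi => cintegral leb (fun x => f x * pairing x xi).

(* [g] is the value at [f] of the L^2-continuous extension of [fourier1] from
   the dense subspace [L^1 \cap L^2] (Plancherel). *)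
Definition is_fourier (f g : fn) : Prop :=
  Lp 2%:E g /\
  exists u : nat -> fn,
    [/\ forall k, Lp 1%:E (u k) /\ Lp 2%:E (u k),
        L2dist (u k) f @[k --> \oo] --> 0%E &
        L2dist (fourier1 (u k)) g @[k --> \oo] --> 0%E].

(* A representative of the Fourier transform of [f \in L^2(R^d)]. *)
Definition fourier (f : fn) : fn := xget (fun=> 0) [set g | is_fourier f g].

(* [V] is an L^2-closed (in particular a.e.-saturated) linear subspace. *)
Definition closed_subspace (V : set fn) : Prop :=
  [/\ V `<=` Lp 2%:E,
      V (fun=> 0),
      forall (a : R[i]) f g, V f -> V g -> V (fun x => a * f x + g x) &
      forall f, Lp 2%:E f ->
        (forall eps : R, 0 < eps -> exists2 g, V g & (L2dist f g < eps%:E)%E) ->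
        V f].

(* The family [e] (and not merely its set of values) is orthonormal and has
   dense linear span in the closed subspace [V]. *)
Definition orthonormal_basis (I : eqType) (V : set fn) (e : I -> fn) : Prop :=
  [/\ forall a, V (e a),
      forall a b, inner (e a) (e b) = (a == b)%:R &
      forall f, V f -> forall eps : R, 0 < eps ->
        exists (s : seq I) (c : I -> R[i]),
          (L2dist f (fun x => (\sum_(a <- s) c a * e a x)%R) < eps%:E)%E].

(* [g] is the sum of the family [u], the convergence being that of the net of
   finite partial sums in L^2. *)
Definition L2_sum (I : choiceType) (u : I -> fn) (g : fn) : Prop :=
  (forall k, Lp 2%:E (u k)) /\
  forall eps : R, 0 < eps -> exists A : {fset I}, forall B : {fset I},
    (A `<=` B)%fset ->
    (L2dist g (fun x => (\sum_(k <- B) u k x)%R) < eps%:E)%E.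

End euclidean.

(* Integer powers of an invertible operator [f] with inverse [finv]. *)
Definition iterz (T : Type) (f finv : T -> T) (n : int) : T -> T :=
  match n with Posz k => iter k f | Negz k => iter k.+1 finv end.

Definition dilation_matrix (R : realType) (d : nat) (D : 'M[int]_d) : Prop :=
  forall a : R[i], eigenvalue (map_mx intr D) a -> 1 < `|a|.

Section wavelets.
Context {R : realType} {d : nat}.
Variable D : 'M[int]_d.
Local Notation Rd := 'cV[R]_d.
Local Notation fn := (Rd -> R[i]).
Local Notation normc := Normc.normc.

Definition absdet : R := `|\det D|%:~R.

Definition DR : 'M[R]_d := map_mx intr D.

(* [dilV] is the inverse of [dil] when [D] is invertible. *)
Definition dil (f : fn) : fn :=
  fun x => (Num.sqrt absdet)%:C * f (DR *m x).
Definition dilV (f : fn) : fn :=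
  fun x => ((Num.sqrt absdet)^-1)%:C * f (invmx DR *m x).
Definition dilz : int -> fn -> fn := iterz dil dilV.

(* [hdil] is the conjugate of [dil] by the Fourier transform, in closed form:
   the transform of [f (DR x)] is [absdet^-1 * \hat f (DR^T^-1 xi)]. *)
Definition hdil (p : fn) : fn :=
  fun xi => ((Num.sqrt absdet)^-1)%:C * p (invmx DR^T *m xi).
Definition hdilV (p : fn) : fn :=
  fun xi => (Num.sqrt absdet)%:C * p (DR^T *m xi).
Definition hdilz : int -> fn -> fn := iterz hdil hdilV.

Definition translate (gamma : 'cV[int]_d) (f : fn) : fn :=
  fun x => f (x - map_mx intr gamma).

Definition multiwavelet (M : nat) (psi : 'I_M -> fn) : Prop :=
  orthonormal_basis (Lp 2%:E)
    (fun a : 'I_M * int * 'cV[int]_d => dilz a.1.2 (translate a.2 (psi a.1.1))).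

Record gmra (V : int -> set fn) : Prop := {
  gmra_closed : forall n, closed_subspace (V n);
  gmra_incr : forall n, V n `<=` V (n + 1);
  gmra_dense : forall f, Lp 2%:E f -> forall eps : R, 0 < eps ->
    exists n, exists2 g, V n g & (L2dist f g < eps%:E)%E;
  gmra_trivial : forall f, (forall n, V n f) ->
    {ae lebesgue_cV R d, forall x, f x = 0};
  gmra_dil : forall n, dil @` V n = V (n + 1);
  gmra_invariant : forall gamma f, V 0 f -> V 0 (translate gamma f) }.

Definition scaling_functions (r : nat) (phi : 'I_r -> fn) : Prop :=
  exists2 V : int -> set fn, gmra V &
    orthonormal_basis (V 0)
      (fun a : 'I_r * 'cV[int]_d => translate a.2 (phi a.1)).

Definition iota_n (n : int) (xi : Rd) : torus R d :=
  torus_pi (iterz (mulmx DR^T) (mulmx (invmx DR^T)) (- n) xi).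

Definition fiber (n : int) (zeta : torus R d) : set Rd :=
  [set xi | iota_n n xi = zeta].

(* The pairing [[p, q]]_n, meaningful wherever the series is summable; this
   is the case at almost every [zeta] if p and q are square integrable. *)
Definition bracket (n : int) (p q : fn) : torus R d -> R[i] :=
  fun zeta => (absdet ^ n)%:C * csum (fiber n zeta) (fun xi => (p xi)^* * q xi).

(* [[p, p]]_n, as a function with values in [0, +oo]. *)
Definition bracket_sq (n : int) (p : fn) : torus R d -> \bar R :=
  fun zeta => ((absdet ^ n)%:E *
    \esum_(xi in fiber n zeta) (normc (p xi) ^+ 2)%:E)%E.

Definition Ynorm (n : int) (p : fn) : \bar R :=
  poweR (ess_sup (@haar R d) (bracket_sq n p)) 2^-1.

Definition Y (n : int) : set fn :=
  [set p | cmeasurable p /\ (Ynorm n p < +oo)%E].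

Definition circ (n : int) (p : fn) (b : torus R d -> R[i]) : fn :=
  fun xi => p xi * b (iota_n n xi).

End wavelets.

(* Main.v *)
(* Under the Fourier transform, [dilz n (translate gamma psi_i)] becomes the product of
   p_(i,n) = [hdilz n (fourier psi_i)] with the character chi_gamma of the torus composed with iota_n,
   and its inner product with q is the gamma-th Fourier coefficient of the bracket [[p_(i,n), q]]_n.
   Since an integrable function on the torus is determined by its Fourier coefficients, and since the
   characters of scale k <= n factor through iota_n, orthonormality is equivalent to the bracket
   relations.  When these hold, u |-> p_(i,n) o_n u is an isometry of L^2(T^d) into L^2(R^d), with
   orthogonal ranges for distinct (i,n), and p_(i,n) o_n [[p_(i,n), f]]_n is the orthogonal projection
   of f on the range; as the characters are dense in L^2(T^d), the wavelets span a dense subspace iff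
   these projections sum to f for every f.  Only the isometry of the Fourier transform is needed, not its
   surjectivity; it is proved first for functions supported in the unit cube, by Parseval's identity,
   and then transported to boxes by affine maps. *)
Require Import Defs.
From HB Require Import structures.
From mathcomp Require Import all_boot all_order all_algebra.
From mathcomp Require Import finmap complex.
From mathcomp Require Import all_classical all_reals all_analysis.
From mathcomp Require Import ess_sup_inf measurable_realfun.
From mathcomp Require Import ring lra.

Set Implicit Arguments.
Unset Strict Implicit.
Unset Printing Implicit Defensive.

Import Order.TTheory GRing.Theory Num.Theory.
Import numFieldNormedType.Exports.

Local Open Scope classical_set_scope.
Local Open Scope ring_scope.

Local Notation Re := complex.Re.
Local Notation Im := complex.Im.
Local Notation normc := Normc.normc.

(** * Complex-valued functions *)

Section complex_scalars.
Context {R : realType}.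
Implicit Types x y : R[i].

(** A bracket of two square-integrable functions is a priori only integrable on the torus, so
    uniqueness of Fourier coefficients has to be proved for L^1. The density of the characters in
    L^2 is then deduced from it through the projection theorem, and Parseval's identity from
    density. Uniqueness itself uses no summability kernel: sines and cosines of one coordinate cut
    out the half-spaces of the cube, and multiplication by these functions preserves the vanishing
    of all Fourier coefficients. The two directions treat the levels differently. From
    orthonormality, all translates of one wavelet are tested against a single untranslated one of
    any level, which gives all Fourier coefficients of their bracket. Conversely, an inner product
    of two wavelets is computed from the bracket at the larger level, and conjugate symmetry covers
    the other order. The transform [fourier] is a chosen representative of a limit; its properties
    are therefore proved for the relation [is_fourier], which holds of any representative. *)

Lemma complexP x y : Re x = Re y -> Im x = Im y -> x = y.
Proof. by case: x y => [a b] [c e] /= -> ->. Qed.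

Lemma cReD x y : Re (x + y) = Re x + Re y. Proof. by case: x y => [a b] [c e]. Qed.
Lemma cImD x y : Im (x + y) = Im x + Im y. Proof. by case: x y => [a b] [c e]. Qed.
Lemma cReN x : Re (- x) = - Re x. Proof. by case: x. Qed.
Lemma cImN x : Im (- x) = - Im x. Proof. by case: x. Qed.
Lemma cReM x y : Re (x * y) = Re x * Re y - Im x * Im y.
Proof. by case: x y => [a b] [c e]. Qed.
Lemma cImM x y : Im (x * y) = Re x * Im y + Im x * Re y.
Proof. by case: x y => [a b] [c e]. Qed.
Lemma cRe_conj x : Re (x^*) = Re x. Proof. by case: x. Qed.
Lemma cIm_conj x : Im (x^*) = - Im x. Proof. by case: x. Qed.

Definition ReImE := (cReD, cImD, cReN, cImN, cReM, cImM, cRe_conj, cIm_conj).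

Lemma sqr_normc x : normc x ^+ 2 = Re x ^+ 2 + Im x ^+ 2.
Proof. by case: x => a b /=; rewrite sqr_sqrtr// addr_ge0// sqr_ge0. Qed.

Lemma normc_ge0 x : 0 <= normc x.
Proof. by case: x => a b /=; rewrite sqrtr_ge0. Qed.

Lemma normc_Re_le x : `|Re x| <= normc x.
Proof.
by rewrite -(@ler_pXn2r _ 2)// ?nnegrE ?normc_ge0// sqr_normc real_normK ?num_real// lerDl sqr_ge0.
Qed.

Lemma normc_Im_le x : `|Im x| <= normc x.
Proof.
by rewrite -(@ler_pXn2r _ 2)// ?nnegrE ?normc_ge0// sqr_normc real_normK ?num_real// lerDr sqr_ge0.
Qed.

Lemma normc_le_ReIm x : normc x <= `|Re x| + `|Im x|.
Proof.
rewrite -(@ler_pXn2r _ 2)// ?nnegrE ?normc_ge0// ?addr_ge0// sqr_normc.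
by rewrite sqrrD !real_normK ?num_real// lerD2r lerDl mulrn_wge0// mulr_ge0.
Qed.

Lemma normc_conj x : normc (x^*) = normc x.
Proof. by case: x => a b /=; rewrite sqrrN. Qed.

Lemma conj_mul_self x : x^* * x = (normc x ^+ 2)%:C%C.
Proof. by apply: complexP; rewrite !ReImE /= ?sqr_normc; ring. Qed.

(** The two sides differ by [t^-1] times the squared modulus of [t x - y]. The free weight [t] is
    what later yields the triangle inequality for the L^2 norm. *)
Lemma sqr_normcD_le x y (t : R) : 0 < t ->
  normc (x + y) ^+ 2 <= (1 + t) * normc x ^+ 2 + (1 + t^-1) * normc y ^+ 2.
Proof.
move=> t0; rewrite !sqr_normc !ReImE; set a := Re x; set b := Im x; set c := Re y; set e := Im y.
rewrite -subr_ge0 (_ : _ - _ = t^-1 * ((t * a - c) ^+ 2 + (t * b - e) ^+ 2)); last by field; rewrite gt_eqF.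
by apply: mulr_ge0; [rewrite invr_ge0 ltW|rewrite addr_ge0 ?sqr_ge0].
Qed.

Lemma normcM_le x y : 2 * (normc x * normc y) <= normc x ^+ 2 + normc y ^+ 2.
Proof. by rewrite -subr_ge0 (_ : _ - _ = (normc x - normc y) ^+ 2) ?sqr_ge0//; ring. Qed.

End complex_scalars.

Section cmeasurable.
Context {R : realType} {d : measure_display} {T : measurableType d}.
Implicit Types f g : T -> R[i].

Lemma cmeasurable_cst (c : R[i]) : cmeasurable (fun _ : T => c).
Proof. by split; exact: measurable_cst. Qed.

Lemma cmeasurableD f g : cmeasurable f -> cmeasurable g -> cmeasurable (fun x => f x + g x).
Proof.
move=> [f1 f2] [g1 g2]; split; under eq_fun do rewrite ReImE; exact: measurable_funD.
Qed.

Lemma cmeasurableN f : cmeasurable f -> cmeasurable (fun x => - f x).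
Proof.
by move=> [f1 f2]; split; under eq_fun do rewrite ReImE; exact: measurableT_comp.
Qed.

Lemma cmeasurableB f g : cmeasurable f -> cmeasurable g -> cmeasurable (fun x => f x - g x).
Proof. by move=> mf mg; apply: cmeasurableD => //; exact: cmeasurableN. Qed.

Lemma cmeasurableM f g : cmeasurable f -> cmeasurable g -> cmeasurable (fun x => f x * g x).
Proof.
move=> [f1 f2] [g1 g2]; split; under eq_fun do rewrite ReImE.
  by apply: measurable_funB; exact: measurable_funM.
by apply: measurable_funD; exact: measurable_funM.
Qed.

Lemma cmeasurable_conj f : cmeasurable f -> cmeasurable (fun x => (f x)^*).
Proof.
move=> [f1 f2]; split; under eq_fun do rewrite ReImE; first exact: f1.
exact: measurableT_comp.
Qed.

Lemma cmeasurable_comp d' (S : measurableType d') (f : T -> R[i]) (h : S -> T) :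
  cmeasurable f -> measurable_fun setT h -> cmeasurable (f \o h).
Proof. by move=> [f1 f2] mh; split; [exact: (measurableT_comp f1)|exact: (measurableT_comp f2)]. Qed.

Lemma cmeasurable_real (f : T -> R) : measurable_fun setT f -> cmeasurable (fun x => (f x)%:C%C).
Proof. by move=> mf; split => //=; exact: measurable_cst. Qed.

Lemma measurable_sqr_normc f : cmeasurable f -> measurable_fun setT (fun x => normc (f x) ^+ 2).
Proof.
move=> [f1 f2]; under eq_fun do rewrite sqr_normc.
by apply: measurable_funD; exact: measurable_funX.
Qed.

Lemma measurable_normc f : cmeasurable f -> measurable_fun setT (fun x => normc (f x)).
Proof.
move=> mf; rewrite (_ : (fun _ => _) = (fun x => Num.sqrt (normc (f x) ^+ 2))).
  have ms : measurable_fun setT (@Num.sqrt R).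
    by apply: continuous_measurable_fun; exact: sqrt_continuous.
  exact: (measurableT_comp ms (measurable_sqr_normc mf)).
by apply/funext => x; rewrite sqrtr_sqr ger0_norm// normc_ge0.
Qed.

End cmeasurable.

(** * Integration of complex-valued functions *)

Section cintegral.
Context {R : realType} {d : measure_display} {T : measurableType d}.
Variable mu : {measure set T -> \bar R}.
Implicit Types f g : T -> R[i].

Definition cintegrable f : Prop :=
  mu.-integrable setT (fun x => (Re (f x))%:E) /\ mu.-integrable setT (fun x => (Im (f x))%:E).

Lemma cintegrable_cmeasurable f : cintegrable f -> cmeasurable f.
Proof. by move=> [/measurable_int/measurable_EFinP f1 /measurable_int/measurable_EFinP f2]. Qed.

Lemma le_cintegrable f (g : T -> R) : cmeasurable f ->
  mu.-integrable setT (EFin \o g) -> (forall x, normc (f x) <= g x) -> cintegrable f.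
Proof.
move=> [f1 f2] ig fg; split; apply: le_integrable ig => //; try exact/measurable_EFinP.
- move=> x _ /=; rewrite lee_fin (le_trans (normc_Re_le _))// (le_trans (fg x))// ler_norm//.
- move=> x _ /=; rewrite lee_fin (le_trans (normc_Im_le _))// (le_trans (fg x))// ler_norm//.
Qed.

Lemma cintegrable_normc f : cintegrable f -> mu.-integrable setT (fun x => (normc (f x))%:E).
Proof.
move=> If; have mf := cintegrable_cmeasurable If; case: If => f1 f2.
apply: (@le_integrable _ _ _ _ _ _ _ (fun x => `|(Re (f x))%:E| + `|(Im (f x))%:E|)%E) => //.
- exact/measurable_EFinP/measurable_normc.
- move=> x _ /=; rewrite lee_fin ger0_norm ?normc_ge0// (le_trans (normc_le_ReIm _))// ler_norm//.
- by apply: integrableD => //; exact: integrable_abse.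
Qed.

Lemma cintegrableP f : cintegrable f <->
  cmeasurable f /\ (\int[mu]_x (normc (f x))%:E < +oo)%E.
Proof.
split=> [If|[mf foo]].
  split; first exact: cintegrable_cmeasurable.
  have /integrableP[_] := cintegrable_normc If.
  by under eq_integral do rewrite /= ger0_norm ?normc_ge0//.
apply: (@le_cintegrable _ (fun x => normc (f x))) => //.
apply/integrableP; split; first exact/measurable_EFinP/measurable_normc.
by under eq_integral do rewrite /= ger0_norm ?normc_ge0//.
Qed.

Lemma cintegrableD f g : cintegrable f -> cintegrable g -> cintegrable (fun x => f x + g x).
Proof.
move=> [f1 f2] [g1 g2]; split; under eq_fun do rewrite ReImE EFinD; exact: integrableD.
Qed.

Lemma cintegrableZ (a : R[i]) f : cintegrable f -> cintegrable (fun x => a * f x).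
Proof.
move=> [f1 f2]; split; under eq_fun do rewrite ReImE ?EFinD ?EFinN !EFinM.
  by apply: integrableB => //; exact: integrableZl.
by apply: integrableD => //; exact: integrableZl.
Qed.

Lemma eq_cintegrable f g : f =1 g -> cintegrable f -> cintegrable g.
Proof. by move=> /funext ->. Qed.

Lemma cintegrableB f g : cintegrable f -> cintegrable g -> cintegrable (fun x => f x - g x).
Proof.
move=> If Ig; apply: cintegrableD => //; apply: eq_cintegrable (cintegrableZ (-1) Ig) => x.
exact: mulN1r.
Qed.

Lemma cintegralD f g : cintegrable f -> cintegrable g ->
  cintegral mu (fun x => f x + g x) = cintegral mu f + cintegral mu g.
Proof.
move=> [f1 f2] [g1 g2]; apply: complexP; rewrite !ReImE /=.
  by under eq_Rintegral do rewrite ReImE; rewrite RintegralD.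
by under eq_Rintegral do rewrite ReImE; rewrite RintegralD.
Qed.

Lemma cintegralZ (a : R[i]) f : cintegrable f ->
  cintegral mu (fun x => a * f x) = a * cintegral mu f.
Proof.
move=> [f1 f2]; have Z (r : R) (h : T -> R) : mu.-integrable setT (fun x => (h x)%:E) ->
    mu.-integrable setT (fun x => (r * h x)%:E).
  by move=> ih; under eq_fun do rewrite EFinM; exact: integrableZl.
apply: complexP; rewrite !ReImE /=.
  by under eq_Rintegral do rewrite ReImE; rewrite RintegralB ?RintegralZl//; exact: Z.
by under eq_Rintegral do rewrite ReImE; rewrite RintegralD ?RintegralZl//; exact: Z.
Qed.

Lemma cintegral_conj f : cintegrable f ->
  cintegral mu (fun x => (f x)^*) = (cintegral mu f)^*.
Proof.
move=> [f1 f2]; apply: complexP; rewrite !ReImE /=.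
  by under eq_Rintegral do rewrite ReImE.
under eq_Rintegral do rewrite ReImE -mulN1r.
by rewrite RintegralZl// mulN1r.
Qed.

Lemma ae_eq_cintegral f g : cmeasurable f -> cmeasurable g ->
  {ae mu, forall x, f x = g x} -> cintegral mu f = cintegral mu g.
Proof.
move=> [f1 f2] [g1 g2] fg; rewrite /cintegral /Rintegral.
congr (fine _ +i* fine _)%C; apply: ae_eq_integral => //; try exact/measurable_EFinP;
  by apply: filterS fg => x /= ->.
Qed.

Lemma ae_eq_cintegrable f g : cmeasurable g ->
  {ae mu, forall x, f x = g x} -> cintegrable f -> cintegrable g.
Proof.
move=> mg fg /cintegrableP[mf foo]; apply/cintegrableP; split => //.
rewrite (@ge0_ae_eq_integral _ _ _ mu setT _ (fun x => (normc (f x))%:E))//.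
- exact/measurable_EFinP/measurable_normc.
- exact/measurable_EFinP/measurable_normc.
- by move=> *; rewrite lee_fin normc_ge0.
- by move=> *; rewrite lee_fin normc_ge0.
- by apply: filterS fg => x /= ->.
Qed.

End cintegral.

(** * The space L^2 *)

Section L2.
Context {R : realType} {d : measure_display} {T : measurableType d}.
Variable mu : {measure set T -> \bar R}.
Local Notation fn := (T -> R[i]).
Local Notation add f g := (fun x => f x + g x).
Local Notation sub f g := (fun x => f x - g x).
Local Notation scl a f := (fun x => a * f x).
Implicit Types f g h : fn.

Definition N2 f : \bar R := (\int[mu]_x (normc (f x) ^+ 2)%:E)%E.
Definition L2 f : Prop := cmeasurable f /\ (N2 f < +oo)%E.
(** The L^2 norm only when [N2 f] is finite: otherwise [fine] makes it 0. Hence the [L2] assumptions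
    that accompany it. *)
Definition nr f : R := Num.sqrt (fine (N2 f)).
Definition ip f g : R[i] := cintegral mu (fun x => (f x)^* * g x).

Lemma N2_ge0 f : (0 <= N2 f)%E.
Proof. by apply: integral_ge0 => x _; rewrite lee_fin sqr_ge0. Qed.

Lemma nr_ge0 f : 0 <= nr f. Proof. exact: sqrtr_ge0. Qed.

Lemma N2E f : L2 f -> N2 f = (nr f ^+ 2)%:E.
Proof.
move=> [_ foo]; rewrite /nr sqr_sqrtr ?fine_ge0 ?N2_ge0// fineK//.
by rewrite ge0_fin_numE ?N2_ge0.
Qed.

Lemma cLnorm2_N2 f : cLnorm mu 2%:E f = (N2 f `^ 2^-1)%E.
Proof.
rewrite /cLnorm unlock /N2; congr poweR; apply: eq_integral => x _.
by rewrite /= ger0_norm ?normc_ge0// powR_mulrn ?normc_ge0.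
Qed.

Lemma cLnorm2E f : L2 f -> cLnorm mu 2%:E f = (nr f)%:E.
Proof.
move=> Lf; rewrite cLnorm2_N2 N2E// poweR_EFin powR12_sqrt ?sqr_ge0//.
by rewrite sqrtr_sqr ger0_norm// nr_ge0.
Qed.

Lemma L2P f : L2 f <-> cmeasurable f /\ (cLnorm mu 2%:E f < +oo)%E.
Proof.
split=> [Lf|[mf]]; first by rewrite cLnorm2E// ltry; case: Lf.
rewrite cLnorm2_N2; have := N2_ge0 f; case E : (N2 f) => [r| |]// _.
  by move=> _; split => //; rewrite E ltry.
by rewrite poweRyr// gt_eqF// invr_gt0.
Qed.

Lemma L2_cst0 : L2 (fun=> 0).
Proof.
split; first exact: cmeasurable_cst.
rewrite /N2; under eq_integral do rewrite Normc.normc0 expr0n /=.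
by rewrite integral0 ltry.
Qed.

Lemma N2Z a f : cmeasurable f -> N2 (scl a f) = ((normc a ^+ 2)%:E * N2 f)%E.
Proof.
move=> mf; rewrite /N2 -ge0_integralZl_EFin//.
- by apply: eq_integral => x _; rewrite Normc.normcM exprMn EFinM.
- by move=> *; rewrite lee_fin sqr_ge0.
- exact/measurable_EFinP/measurable_sqr_normc.
- by rewrite sqr_ge0.
Qed.

Lemma N2D_le f g (t : R) : cmeasurable f -> cmeasurable g -> 0 < t ->
  (N2 (add f g) <= (1 + t)%:E * N2 f + (1 + t^-1)%:E * N2 g)%E.
Proof.
move=> mf mg t0; have t1 : 0 <= 1 + t by rewrite addr_ge0// ltW.
have t2 : 0 <= 1 + t^-1 by rewrite addr_ge0// invr_ge0 ltW.
have m1 h : cmeasurable h -> measurable_fun setT (fun x => (normc (h x) ^+ 2)%:E).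
  by move=> mh; exact/measurable_EFinP/measurable_sqr_normc.
rewrite /N2 -!ge0_integralZl_EFin//; try by [move=> *; rewrite lee_fin sqr_ge0|exact: m1].
rewrite -ge0_integralD//; last first.
- by apply: emeasurable_funM; [exact: measurable_cst|exact: m1].
- by move=> *; rewrite -EFinM lee_fin mulr_ge0// sqr_ge0.
- by apply: emeasurable_funM; [exact: measurable_cst|exact: m1].
- by move=> *; rewrite -EFinM lee_fin mulr_ge0// sqr_ge0.
apply: ge0_le_integral => //.
- by move=> *; rewrite lee_fin sqr_ge0.
- by apply: m1; exact: cmeasurableD.
- by apply: emeasurable_funD; apply: emeasurable_funM; try exact: measurable_cst; exact: m1.
- by move=> x _; rewrite -!EFinM -EFinD lee_fin sqr_normcD_le.
Qed.

Lemma L2D f g : L2 f -> L2 g -> L2 (add f g).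
Proof.
move=> [mf foo] [mg goo]; split; first exact: cmeasurableD.
rewrite (le_lt_trans (N2D_le mf mg ltr01))// lte_add_pinfty//.
  by rewrite lte_mul_pinfty// lee_fin addr_ge0.
by rewrite lte_mul_pinfty// lee_fin addr_ge0// invr_ge0.
Qed.

Lemma L2Z a f : L2 f -> L2 (scl a f).
Proof.
move=> [mf foo]; split; first by apply: cmeasurableM => //; exact: cmeasurable_cst.
by rewrite N2Z// lte_mul_pinfty// lee_fin sqr_ge0.
Qed.

Lemma L2N f : L2 f -> L2 (fun x => - f x).
Proof. by move=> /(L2Z (-1)); under eq_fun do rewrite mulN1r. Qed.

Lemma L2B f g : L2 f -> L2 g -> L2 (sub f g).
Proof. by move=> Lf Lg; apply: L2D => //; exact: L2N. Qed.

Lemma L2_lincomb (I : Type) (s : seq I) (c : I -> R[i]) (e : I -> fn) :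
  (forall i, L2 (e i)) -> L2 (fun x => \sum_(i <- s) c i * e i x).
Proof.
move=> Le; elim: s => [|i s IH]; first by under [X in L2 X]eq_fun do rewrite big_nil; exact: L2_cst0.
by under [X in L2 X]eq_fun do rewrite big_cons; apply: L2D => //; exact: L2Z.
Qed.

Lemma L2_fsum (I : Type) (s : seq I) (e : I -> fn) :
  (forall i, L2 (e i)) -> L2 (fun x => \sum_(i <- s) e i x).
Proof.
by move=> /(@L2_lincomb _ s (fun=> 1)); under eq_fun do under eq_bigr do rewrite mul1r.
Qed.

Lemma cintegrable_ip f g : L2 f -> L2 g -> cintegrable mu (fun x => (f x)^* * g x).
Proof.
move=> [mf foo] [mg goo].
apply: (@le_cintegrable _ _ _ _ _ (fun x => normc (f x) ^+ 2 + normc (g x) ^+ 2)).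
- by apply: cmeasurableM => //; exact: cmeasurable_conj.
- rewrite (_ : EFin \o _ = ((fun x => (normc (f x) ^+ 2)%:E) \+ (fun x => (normc (g x) ^+ 2)%:E))%E)//.
  apply: integrableD => //; apply/integrableP; split.
  + exact/measurable_EFinP/measurable_sqr_normc.
  + by under eq_integral do rewrite gee0_abs ?lee_fin ?sqr_ge0//.
  + exact/measurable_EFinP/measurable_sqr_normc.
  + by under eq_integral do rewrite gee0_abs ?lee_fin ?sqr_ge0//.
- move=> x; rewrite Normc.normcM normc_conj (le_trans _ (normcM_le _ _))//.
  by rewrite ler_peMl ?mulr_ge0 ?normc_ge0// ler1n.
Qed.

Lemma ipDr f g h : L2 f -> L2 g -> L2 h -> ip f (add g h) = ip f g + ip f h.
Proof.
move=> Lf Lg Lh; rewrite /ip -cintegralD; try exact: cintegrable_ip.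
by congr cintegral; apply/funext => x; rewrite mulrDr.
Qed.

Lemma ipZr a f g : L2 f -> L2 g -> ip f (scl a g) = a * ip f g.
Proof.
move=> Lf Lg; rewrite /ip -cintegralZ; last exact: cintegrable_ip.
by congr cintegral; apply/funext => x; rewrite mulrCA.
Qed.

Lemma ipC f g : L2 f -> L2 g -> ip g f = (ip f g)^*.
Proof.
move=> Lf Lg; rewrite /ip -cintegral_conj; last exact: cintegrable_ip.
by congr cintegral; apply/funext => x; apply: complexP; rewrite !ReImE; ring.
Qed.

Lemma ip0r f : ip f (fun=> 0) = 0.
Proof.
rewrite /ip (_ : (fun x => _) = (fun=> 0)); last by apply/funext => x; rewrite mulr0.
by rewrite /cintegral /Rintegral /= integral0.
Qed.

Lemma ipNr f g : L2 f -> L2 g -> ip f (fun x => - g x) = - ip f g.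
Proof.
by move=> Lf Lg; rewrite -mulN1r -ipZr//; congr ip; apply/funext => x; rewrite mulN1r.
Qed.

Lemma ipBr f g h : L2 f -> L2 g -> L2 h -> ip f (sub g h) = ip f g - ip f h.
Proof. by move=> Lf Lg Lh; rewrite ipDr ?ipNr//; exact: L2N. Qed.

Lemma ipDl f g h : L2 f -> L2 g -> L2 h -> ip (add g h) f = ip g f + ip h f.
Proof.
move=> Lf Lg Lh; rewrite ipC//; last exact: L2D.
by rewrite ipDr// rmorphD /= -!ipC.
Qed.

Lemma ipZl a f g : L2 f -> L2 g -> ip (scl a g) f = a^* * ip g f.
Proof.
move=> Lf Lg; rewrite ipC//; last exact: L2Z.
by rewrite ipZr// rmorphM /= -!ipC.
Qed.

Lemma ip_sumr (I : Type) (s : seq I) (c : I -> R[i]) (e : I -> fn) f : L2 f ->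
  (forall i, L2 (e i)) ->
  ip f (fun x => \sum_(i <- s) c i * e i x) = \sum_(i <- s) c i * ip f (e i).
Proof.
move=> Lf Le; elim: s => [|i s IH].
  by rewrite big_nil -[RHS](ip0r f); congr ip; apply/funext => x; rewrite big_nil.
rewrite big_cons -IH -ipZr// -ipDr//; [|exact: L2Z|exact: L2_lincomb].
by congr ip; apply/funext => x; rewrite big_cons.
Qed.

Lemma ip_self f : L2 f -> ip f f = (nr f ^+ 2)%:C%C.
Proof.
move=> Lf; have := N2E Lf; rewrite /N2 /ip => E; apply: complexP => /=.
  rewrite /Rintegral; transitivity (fine (\int[mu]_x (normc (f x) ^+ 2)%:E)%E); last by rewrite E.
  by congr fine; apply: eq_integral => x _; rewrite conj_mul_self.
rewrite /Rintegral (eq_integral (fun=> 0%E)) ?integral0// => x _.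
by rewrite conj_mul_self.
Qed.

Lemma eq_nr f g : N2 f = N2 g -> nr f = nr g.
Proof. by rewrite /nr => ->. Qed.

Lemma nr_cst0 : nr (fun=> 0) = 0.
Proof.
have := ip_self L2_cst0; rewrite ip0r => /(congr1 (@Re R))/esym/eqP.
by rewrite /= sqrf_eq0 => /eqP.
Qed.

Lemma nrZ a f : L2 f -> nr (scl a f) = normc a * nr f.
Proof.
move=> Lf; rewrite {1}/nr N2Z; last by case: Lf.
by rewrite N2E// -EFinM /= -exprMn sqrtr_sqr ger0_norm// mulr_ge0 ?normc_ge0// nr_ge0.
Qed.

Lemma nrN f : nr (fun x => - f x) = nr f.
Proof. by apply: eq_nr; apply: eq_integral => x _; rewrite normcN. Qed.

Lemma nrBC f g : nr (sub f g) = nr (sub g f).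
Proof. by rewrite -nrN; congr nr; apply/funext => x; rewrite opprB. Qed.

(** Minkowski's inequality without Cauchy-Schwarz: for [a] and [b] slightly above the two norms, the
    weight [b / a] turns the bound of [N2D_le] into [(a + b) ^+ 2]. The margin [e / 2] keeps both
    positive, so that the quotient makes sense even for functions of norm 0. *)
Lemma nrD f g : L2 f -> L2 g -> nr (add f g) <= nr f + nr g.
Proof.
move=> Lf Lg; apply/ler_addgt0Pr => e e0.
pose a := nr f + e / 2; pose b := nr g + e / 2.
have a0 : 0 < a by rewrite ltr_wpDl ?nr_ge0// divr_gt0.
have b0 : 0 < b by rewrite ltr_wpDl ?nr_ge0// divr_gt0.
rewrite (_ : _ + e = a + b); last by rewrite /a /b; field.
rewrite -(@ler_pXn2r _ 2)// ?nnegrE ?nr_ge0// ?(ltW (addr_gt0 a0 b0))//.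
have := @N2D_le f g (b / a) Lf.1 Lg.1 (divr_gt0 b0 a0).
rewrite !N2E//; last exact: L2D.
rewrite -!EFinM -EFinD lee_fin => /le_trans; apply.
rewrite (_ : (a + b) ^+ 2 = (1 + b / a) * a ^+ 2 + (1 + (b / a)^-1) * b ^+ 2); last first.
  by field; rewrite !gt_eqF.
apply: lerD; apply: ler_wpM2l.
- by rewrite addr_ge0// divr_ge0 ?ltW.
- by rewrite ler_pXn2r ?nnegrE ?nr_ge0 ?(ltW a0)// /a lerDl divr_ge0// ltW.
- by rewrite addr_ge0// invr_ge0 divr_ge0 ?ltW.
- by rewrite ler_pXn2r ?nnegrE ?nr_ge0 ?(ltW b0)// /b lerDl divr_ge0// ltW.
Qed.

Lemma nr_sub_le h f g : L2 f -> L2 g -> L2 h -> nr (sub f g) <= nr (sub f h) + nr (sub h g).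
Proof.
move=> Lf Lg Lh; rewrite (_ : sub f g = add (sub f h) (sub h g)).
  by apply: nrD; exact: L2B.
by apply/funext => x; rewrite addrA subrK.
Qed.

Lemma nr_dist f g : L2 f -> L2 g -> `|nr f - nr g| <= nr (sub f g).
Proof.
have H h k : L2 h -> L2 k -> nr h - nr k <= nr (sub h k).
  move=> Lh Lk; rewrite lerBlDr {1}(_ : h = add (sub h k) k); first by rewrite nrD//; exact: L2B.
  by apply/funext => x; rewrite subrK.
by move=> Lf Lg; rewrite ler_norml lerNl opprB [X in _ - _ <= X]nrBC !H.
Qed.

Lemma sqr_nrD f g : L2 f -> L2 g ->
  nr (add f g) ^+ 2 = nr f ^+ 2 + 2 * Re (ip f g) + nr g ^+ 2.
Proof.
move=> Lf Lg; have LD := L2D Lf Lg.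
have E h : L2 h -> nr h ^+ 2 = Re (ip h h) by move=> Lh; rewrite ip_self.
rewrite (E _ LD) (E _ Lf) (E _ Lg).
rewrite ipDr// !ipDl// !cReD (ipC Lf Lg).
by rewrite cRe_conj; ring.
Qed.

(** Reduces an identity between inner products to one between their real parts, which polarisation
    supplies. *)
Lemma Im_ip f g : L2 f -> L2 g -> Im (ip f g) = Re (ip (scl (0 +i* 1)%C f) g).
Proof. by move=> Lf Lg; rewrite ipZl// !ReImE /=; ring. Qed.

Lemma pythagoras f g : L2 f -> L2 g -> ip f g = 0 ->
  nr (add f g) ^+ 2 = nr f ^+ 2 + nr g ^+ 2.
Proof. by move=> Lf Lg fg; rewrite sqr_nrD// fg mulr0 addr0. Qed.

Lemma ae_eq_N2 f g : cmeasurable f -> cmeasurable g -> {ae mu, forall x, f x = g x} -> N2 f = N2 g.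
Proof.
move=> mf mg fg; apply: ge0_ae_eq_integral => //.
- exact/measurable_EFinP/measurable_sqr_normc.
- exact/measurable_EFinP/measurable_sqr_normc.
- by move=> *; rewrite lee_fin sqr_ge0.
- by move=> *; rewrite lee_fin sqr_ge0.
- by apply: filterS fg => x /= ->.
Qed.

Lemma le_L2 f g : cmeasurable f -> (forall x, normc (f x) <= normc (g x)) -> L2 g -> L2 f.
Proof.
move=> mf fg [mg goo]; split => //; apply: le_lt_trans goo; apply: ge0_le_integral => //.
- by move=> *; rewrite lee_fin sqr_ge0.
- exact/measurable_EFinP/measurable_sqr_normc.
- exact/measurable_EFinP/measurable_sqr_normc.
- by move=> x _; rewrite lee_fin ler_pXn2r ?nnegrE ?normc_ge0.
Qed.

End L2.

(** * Pointwise limits, Fatou bounds and the completeness of L^2 *)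

Lemma cvgn_geometric_steps {R : realType} (w : R ^nat) (C : R) :
  (forall k, `|w k.+1 - w k| <= C / 2 ^+ k) -> cvgn w.
Proof.
move=> wC; have h : cvgn (series (telescope w)).
  apply: normed_cvg; apply: (@series_le_cvg _ _ (geometric C 2^-1)); first by move=> n; exact: normr_ge0.
  - move=> n; rewrite /geometric /= mulr_ge0 ?exprn_ge0 ?invr_ge0//.
    by rewrite (le_trans (normr_ge0 _) (le_trans (wC 0%N) _))// expr0 divr1.
  - by move=> n; rewrite /telescope /= exprVn; exact: wC.
  - by apply: is_cvg_geometric_series; rewrite ger0_norm// invf_lt1// ltr1n.
rewrite telescopeK in h.
rewrite (_ : w = (fun n => w n - w 0%N) \+ cst (w 0%N)); last by apply/funext => n /=; rewrite subrK.
by apply: is_cvgD => //; exact: is_cvg_cst.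
Qed.

Lemma cvg_sqr_normcB {R : realType} (z : nat -> R[i]) (l w : R[i]) :
  Re (z k) @[k --> \oo] --> Re l -> Im (z k) @[k --> \oo] --> Im l ->
  normc (z k - w) ^+ 2 @[k --> \oo] --> normc (l - w) ^+ 2.
Proof.
move=> cR cI; have E (u v : R[i]) : normc (u - v) ^+ 2 = (Re u - Re v) ^+ 2 + (Im u - Im v) ^+ 2.
  by rewrite sqr_normc cReD cReN cImD cImN.
rewrite E (_ : (fun k => _) = (fun k => (Re (z k) - Re w) ^+ 2 + (Im (z k) - Im w) ^+ 2)); last first.
  by apply/funext => k; rewrite E.
have sq (r : R ^nat) (a c : R) : r k @[k --> \oo] --> a -> (r k - c) ^+ 2 @[k --> \oo] --> (a - c) ^+ 2.
  move=> ra; rewrite expr2; under eq_fun do rewrite expr2.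
  by apply: cvgM; apply: cvgB => //; exact: cvg_cst.
by apply: cvgD; [exact: (sq (fun k => Re (z k)))|exact: (sq (fun k => Im (z k)))].
Qed.

Section fatou_bound.
Context {R : realType} {d : measure_display} {T : measurableType d}.
Variable mu : {measure set T -> \bar R}.

(** Fatou's lemma applied to the sequence shifted by [N], since the bound on the integrals is only
    available from that rank on. *)
Lemma fatou_le (u : nat -> T -> R) (v : T -> R) (c : \bar R) (N : nat) :
  (forall n, measurable_fun setT (u n)) -> (forall n x, 0 <= u n x) ->
  (forall x, u n x @[n --> \oo] --> v x) ->
  (forall n, (N <= n)%N -> (\int[mu]_x (u n x)%:E <= c)%E) ->
  (\int[mu]_x (v x)%:E <= c)%E.
Proof.
move=> mu_ u0 uv uc.
have := @fatou _ _ _ mu setT measurableT (fun n x => (u (n + N)%N x)%:E).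
have -> : (fun x => limn_einf (fun n => (u (n + N)%N x)%:E)) = (fun x => (v x)%:E).
  apply/funext => x; apply: (cvg_limn_einf_sup _).1.
  by apply: cvg_EFin; [exact: nearW|rewrite (cvg_shiftn N (fun n => u n x)); exact: uv].
move=> /(_ _ _)/le_trans; apply.
- by move=> n; exact/measurable_EFinP.
- by move=> n x _; rewrite lee_fin.
rewrite limn_einf_lim; apply: lime_le; first exact: is_cvg_einfs.
apply: nearW => n; apply: le_trans (uc (n + N)%N (leq_addl _ _)).
by apply: ereal_inf_lbound; exists n => //=.
Qed.

End fatou_bound.

Lemma nneseries_ge_term {R : realType} (u : nat -> \bar R) k :
  (forall n, 0 <= u n)%E -> (u k <= \sum_(n <oo) u n)%E.
Proof.
move=> u0; apply: le_trans (@nneseries_lim_ge _ u xpredT 0%N k.+1 _); last by [].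
by rewrite big_mkord big_ord_recr /= leeDr// sume_ge0.
Qed.

Section riesz_fischer.
Context {R : realType} {d : measure_display} {T : measurableType d}.
Variable mu : {measure set T -> \bar R}.
Local Notation sub f g := (fun x => f x - g x).

Lemma riesz_fischer (f : nat -> T -> R[i]) : (forall n, L2 mu (f n)) ->
  (forall eps : R, 0 < eps -> exists N, forall m n, (N <= m)%N -> (N <= n)%N ->
    nr mu (sub (f m) (f n)) < eps) ->
  exists2 g, L2 mu g & forall eps : R, 0 < eps -> exists N, forall n, (N <= n)%N ->
    nr mu (sub (f n) g) < eps.
Proof.
move=> Lf cf.
have /choice[N0 N0P] : forall k, exists N, forall m n, (N <= m)%N -> (N <= n)%N ->
    nr mu (sub (f m) (f n)) < (4 ^+ k.+1)^-1.
  by move=> k; apply: cf; rewrite invr_gt0 exprn_gt0.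
(* Summing the [N0 j] makes [M] nondecreasing and at least [N0 k]; the summand [k] makes it tend to
   infinity. *)
pose M k := (k + \sum_(j < k.+1) N0 j)%N.
have MN k : (N0 k <= M k)%N by rewrite /M big_ord_recr /= addnA leq_addl.
have MS k : (M k <= M k.+1)%N by rewrite /M [X in (_ <= _ + X)%N]big_ord_recr /= leq_add// leq_addr.
pose u k := f (M k).
have Lu k : L2 mu (u k) by exact: Lf.
(* The weight [4 ^+ k] plays two roles: increments of norm at most 4^-(k+1) keep the sum [S]
   integrable, and finiteness of [S x] bounds the k-th increment at [x] by a multiple of 2^-k. *)
pose a k x := (4 ^+ k * normc (u k.+1 x - u k x) ^+ 2) : R.
have a0 k x : 0 <= a k x by apply: mulr_ge0; [exact: exprn_ge0|exact: sqr_ge0].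
have ma k : measurable_fun setT (a k).
  apply: measurable_funM; first exact: measurable_cst.
  apply: (@measurable_sqr_normc _ _ _ (sub (u k.+1) (u k))).
  by apply: cmeasurableB; [exact: (Lu k.+1).1|exact: (Lu k).1].
pose S x := (\sum_(k <oo) (a k x)%:E)%E.
have S0 x : (0 <= S x)%E.
  by rewrite /S; apply: (@nneseries_ge0 _ _ xpredT 0) => k _ _; rewrite lee_fin.
have mS : measurable_fun setT S.
  apply: (@ge0_emeasurable_sum _ _ _ setT (fun k x => (a k x)%:E) xpredT).
    by move=> *; rewrite lee_fin.
  by move=> *; exact/measurable_EFinP.
have Sfin : (\int[mu]_x S x < +oo)%E.
  rewrite integral_nneseries//; last 2 first.
  - by move=> n; exact/measurable_EFinP.
  - by move=> *; rewrite lee_fin.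
  apply: (@le_lt_trans _ _ 1%:E); last exact: ltry.
  apply: le_trans (@epsilon_trick0 R 1 xpredT ler01); apply: lee_nneseries => k _.
    by move=> _; apply: integral_ge0 => x _; rewrite lee_fin.
  under eq_integral do rewrite EFinM.
  rewrite ge0_integralZl_EFin//; last 2 first.
  - by move=> *; rewrite lee_fin sqr_ge0.
  - apply/measurable_EFinP/measurable_sqr_normc.
    by apply: cmeasurableB; [exact: (Lu k.+1).1|exact: (Lu k).1].
  rewrite -[X in (_ * X)%E]/(N2 mu (sub (u k.+1) (u k))) N2E; last exact: L2B.
  rewrite -EFinM lee_fin.
  have h : nr mu (sub (u k.+1) (u k)) <= (4 ^+ k.+1)^-1.
    by apply/ltW/N0P; rewrite ?MN// (leq_trans (MN k)) ?MS.
  apply: (@le_trans _ _ (4 ^+ k * ((4 ^+ k.+1)^-1) ^+ 2)).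
    by rewrite ler_wpM2l ?exprn_ge0// ler_pXn2r ?nnegrE ?nr_ge0 ?invr_ge0 ?exprn_ge0.
  rewrite natrX div1r !exprS.
  have : 2 ^+ k <= 4 ^+ k :> R by rewrite lerXn2r ?nnegrE// ler_nat.
  have p0 : 0 < 2 ^+ k :> R by rewrite exprn_gt0.
  have q0 : 0 < 4 ^+ k :> R by rewrite exprn_gt0.
  move: (2 ^+ k) (4 ^+ k) p0 q0 => p q p0 q0 pq.
  rewrite (_ : q * _ = (16 * q)^-1); last by field; rewrite gt_eqF.
  by rewrite lef_pV2 ?posrE ?mulr_gt0//; lra.
have Sae : {ae mu, forall x, (S x < +oo)%E}.
  have iS : mu.-integrable setT S.
    by apply/integrableP; split => //; under eq_integral do rewrite gee0_abs//.
  have := integrable_ae measurableT iS; apply: filterS => x /(_ I).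
  by rewrite ge0_fin_numE.
pose D := [set x | (S x < +oo)%E].
have mD : measurable D.
  by rewrite -[D]setTI; apply: emeasurable_fun_infty_o.
(* Cutting off the null set where [S] is infinite makes the sequence converge at every point, so
   that its limit is measurable. *)
pose v k x := ((\1_D x)%:C%C : R[i]) * u k x.
have mv k : cmeasurable (v k).
  by apply: cmeasurableM; [exact/cmeasurable_real/measurable_indic|exact: (Lu k).1].
have vstep x : exists C : R, forall k, normc (v k.+1 x - v k x) <= C / 2 ^+ k.
  have [xD|xD] := pselect (D x); last first.
    exists 0 => k; rewrite /v indicE memNset// !mul0r subrr.
    by rewrite Normc.normc0.
  exists (Num.sqrt (fine (S x))) => k; rewrite /v indicE mem_set// !mul1r.
  rewrite ler_pdivlMr ?exprn_gt0// -(@ler_pXn2r _ 2)// ?nnegrE ?sqrtr_ge0// ?mulr_ge0 ?normc_ge0 ?exprn_ge0//.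
  rewrite sqr_sqrtr ?fine_ge0// exprMn -exprM mulnC exprM mulrC.
  rewrite (_ : 2 ^+ 2 = 4); last by rewrite -natrX.
  rewrite -lee_fin fineK ?ge0_fin_numE//.
  by apply: (@nneseries_ge_term _ (fun k => (a k x)%:E)) => n; rewrite lee_fin.
have vR x : cvgn (fun k => Re (v k x)).
  have [C HC] := vstep x; apply: (@cvgn_geometric_steps _ _ C) => k.
  by rewrite -cReN -cReD (le_trans (normc_Re_le _)).
have vI x : cvgn (fun k => Im (v k x)).
  have [C HC] := vstep x; apply: (@cvgn_geometric_steps _ _ C) => k.
  by rewrite -cImN -cImD (le_trans (normc_Im_le _)).
pose g x := (limn (fun k => Re (v k x)) +i* limn (fun k => Im (v k x)))%C.
have mg : cmeasurable g.
  split.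
    by apply: (@measurable_fun_cvg _ _ _ setT (fun k x => Re (v k x))) => [m|x _]; [exact: (mv m).1|exact: vR].
  by apply: (@measurable_fun_cvg _ _ _ setT (fun k x => Im (v k x))) => [m|x _]; [exact: (mv m).2|exact: vI].
have uv k : {ae mu, forall x, u k x = v k x}.
  by apply: filterS Sae => x Sx; rewrite /v indicE mem_set// mul1r.
(* The Cauchy bound passes to the limit by Fatou with [n] fixed; [v k] may be exchanged with [u k],
   which is a term of the given sequence, as they agree almost everywhere. *)
have key (eps : R) N : 0 < eps -> (forall m n, (N <= m)%N -> (N <= n)%N ->
    nr mu (sub (f m) (f n)) < eps) ->
    forall n, (N <= n)%N -> (N2 mu (sub g (f n)) <= (eps ^+ 2)%:E)%E.
  move=> eps0 HN n Nn; rewrite /N2.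
  have [K NK] : exists K, forall k, (K <= k)%N -> (N <= M k)%N.
    by exists N => k /leq_trans; apply; rewrite leq_addr.
  apply: (@fatou_le _ _ _ mu (fun k x => normc (v k x - f n x) ^+ 2) _ _ K).
  - by move=> k; apply: measurable_sqr_normc; apply: cmeasurableB => //; exact: (Lf n).1.
  - by move=> *; exact: sqr_ge0.
  - by move=> x; exact: (@cvg_sqr_normcB _ (v^~ x) (g x) (f n x) (vR x) (vI x)).
  - move=> k Kk; rewrite -[leLHS]/(N2 mu (sub (v k) (f n))).
    rewrite -(@ae_eq_N2 _ _ _ mu (sub (u k) (f n))); last 3 first.
    + by apply: cmeasurableB; [exact: (Lu k).1|exact: (Lf n).1].
    + by apply: cmeasurableB => //; exact: (Lf n).1.
    + by apply: filterS (uv k) => x ->.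
    rewrite N2E; last exact: L2B.
    by rewrite lee_fin ler_pXn2r ?nnegrE ?nr_ge0 ?(ltW eps0)// ltW// HN// NK.
have Lg n (eps : R) N : 0 < eps -> (forall m n, (N <= m)%N -> (N <= n)%N ->
    nr mu (sub (f m) (f n)) < eps) -> (N <= n)%N -> L2 mu (sub g (f n)).
  move=> e0 HN Nn; split; first by apply: cmeasurableB => //; exact: (Lf n).1.
  by rewrite (le_lt_trans (key _ _ e0 HN _ Nn)) ?ltry.
exists g.
  have [N HN] := cf _ (@ltr01 R).
  rewrite (_ : g = (fun x => (g x - f N x) + f N x)); last by apply/funext => x; rewrite subrK.
  by apply: L2D => //; exact: Lg HN _.
move=> eps e0; have e2 : 0 < eps / 2 by rewrite divr_gt0.
have [N HN] := cf _ e2; exists N => n Nn.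
apply: (@le_lt_trans _ _ (eps / 2)); last by rewrite ltr_pdivrMr// ltr_pMr// ltr1n.
rewrite nrBC -(@ler_pXn2r _ 2)// ?nnegrE ?nr_ge0 ?(ltW e2)//.
by have := key _ _ e2 HN _ Nn; rewrite N2E ?lee_fin//; exact: Lg HN _.
Qed.

End riesz_fischer.

(** * Projections and orthonormal families in L^2 *)

Section hilbert.
Context {R : realType} {d : measure_display} {T : measurableType d}.
Variable mu : {measure set T -> \bar R}.
Local Notation fn := (T -> R[i]).
Local Notation add f g := (fun x => f x + g x).
Local Notation sub f g := (fun x => f x - g x).
Local Notation scl a f := (fun x => a * f x).
Local Notation L2 := (L2 mu).
Local Notation nr := (nr mu).
Local Notation ip := (ip mu).
Implicit Types f g h w : fn.

Lemma sqr_nrB f g : L2 f -> L2 g ->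
  nr (sub f g) ^+ 2 = nr f ^+ 2 - 2 * Re (ip f g) + nr g ^+ 2.
Proof.
by move=> Lf Lg; rewrite sqr_nrD ?nrN ?ipNr ?cReN ?mulrN//; exact: L2N.
Qed.

(** With [c] the inner product of [w] and [h], subtracting [s c w] changes the squared norm of [h]
    by [s |c|^2 (s |w|^2 - 2)], which is negative for [s = 1 / (|w|^2 + 1)] unless [c = 0]. The
    added 1 also covers [w] of norm 0. *)
Lemma nearest_orthogonal h w : L2 h -> L2 w ->
  (forall t : R[i], nr h <= nr (sub h (scl t w))) -> ip w h = 0.
Proof.
move=> Lh Lw hw; apply: contrapT => /eqP c0.
pose c := ip w h; have n0 : 0 < normc c ^+ 2.
  by rewrite exprn_gt0// lt_neqAle normc_ge0 eq_sym andbT; apply: contra c0 => /eqP/Normc.eq0_normc/eqP.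
pose s := (nr w ^+ 2 + 1)^-1.
have s0 : 0 < s by rewrite invr_gt0 ltr_pwDr// sqr_ge0.
have := hw (s%:C%C * c); rewrite -(@ler_pXn2r _ 2)// ?nnegrE ?nr_ge0//.
rewrite sqr_nrB//; last exact: L2Z.
rewrite nrZ// ipZr// (ipC Lw Lh) -/c exprMn Normc.normcM exprMn.
rewrite [Re _](_ : _ = s * normc c ^+ 2); last by rewrite sqr_normc !ReImE /=; ring.
have -> : normc s%:C%C = s by rewrite /= expr0n addr0 sqrtr_sqr ger0_norm// ltW.
rewrite -subr_ge0 (_ : _ - _ = s * normc c ^+ 2 * (s * nr w ^+ 2 - 2)); last by ring.
rewrite pmulr_rge0; last exact: mulr_gt0.
rewrite subr_ge0 leNgt => /negP; apply.
rewrite /s mulrC ltr_pdivrMr ?ltr_pwDr ?sqr_ge0//.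
by have := sqr_ge0 (nr w); lra.
Qed.

Lemma parallelogram f g : L2 f -> L2 g ->
  nr (sub f g) ^+ 2 = 2 * nr f ^+ 2 + 2 * nr g ^+ 2 - nr (add f g) ^+ 2.
Proof. by move=> Lf Lg; rewrite sqr_nrB// sqr_nrD//; ring. Qed.

(* Projection theorem: the minimising sequence is Cauchy by the parallelogram law. *)
Lemma total_dense (W : set fn) : W `<=` L2 -> W (fun=> 0) ->
  (forall a f g, W f -> W g -> W (fun x => a * f x + g x)) ->
  (forall f, L2 f -> (forall w, W w -> ip w f = 0) -> nr f = 0) ->
  forall f, L2 f -> forall eps : R, 0 < eps -> exists2 w, W w & nr (sub f w) < eps.
Proof.
move=> WL W0 Wlin Wt f Lf eps eps0.
have WD g h : W g -> W h -> W (add g h).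
  by move=> Wg Wh; have := Wlin 1 _ _ Wg Wh; under eq_fun do rewrite mul1r.
have WZ a g : W g -> W (scl a g).
  by move=> Wg; have := Wlin a _ _ Wg W0; under eq_fun do rewrite addr0.
pose E := [set nr (sub f w) | w in W].
have iE : has_inf E.
  split; first by exists (nr (sub f (fun=> 0))); exists (fun=> 0).
  by exists 0 => _ [w _ <-]; exact: nr_ge0.
pose D := inf E.
have D0 : 0 <= D by apply: lb_le_inf; [case: iE|move=> _ [w _ <-]; exact: nr_ge0].
have DE w : W w -> D <= nr (sub f w).
  by move=> Ww; apply: ge_inf; [case: iE|exists w].
have /choice[g gP] : forall n : nat, exists w, W w /\ nr (sub f w) < D + n.+1%:R^-1.
  move=> n; have [_ [w Ww <-] wD] := @inf_adherent _ E n.+1%:R^-1 (ltac:(by rewrite invr_gt0)) iE.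
  by exists w.
have Wg n : W (g n) by have [] := gP n.
have Lg n : L2 (g n) by exact/WL/Wg.
(* The midpoint of [g n] and [g m] lies in [W], hence at distance at least [D] from [f]; the
   parallelogram law gives at most [4 (D + e)^2 - 4 D^2]. *)
have cauchy n m (e : R) : n.+1%:R^-1 <= e -> m.+1%:R^-1 <= e ->
    nr (sub (g m) (g n)) ^+ 2 <= 8 * D * e + 4 * e ^+ 2.
  move=> ne me.
  rewrite (_ : sub (g m) (g n) = sub (sub f (g n)) (sub f (g m))); last first.
    by apply/funext => x; ring.
  rewrite parallelogram; [|exact: L2B..].
  rewrite (_ : (fun x => f x - g n x + (f x - g m x)) =
    scl 2 (sub f (scl 2^-1 (add (g n) (g m))))); last first.
    by apply/funext => x; field.
  rewrite nrZ; last by apply/L2B => //; exact/L2Z/L2D.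
  rewrite (_ : normc 2 = 2 :> R); last by rewrite normcMn Normc.normc1.
  have b k : k.+1%:R^-1 <= e -> nr (sub f (g k)) ^+ 2 <= (D + e) ^+ 2.
    move=> ke; have De : 0 <= D + e by apply: addr_ge0 => //; apply: le_trans ke; rewrite invr_ge0.
    rewrite ler_pXn2r ?nnegrE ?nr_ge0//.
    by have [_ /ltW/le_trans] := gP k; apply; rewrite lerD2l.
  have := b _ ne; have := b _ me.
  have : D ^+ 2 <= nr (sub f (scl 2^-1 (add (g n) (g m)))) ^+ 2.
    rewrite ler_pXn2r ?nnegrE ?nr_ge0//; apply: DE.
    by apply: WZ; exact: WD.
  rewrite exprMn !sqrrD; lra.
have [|h0 Lh0 gh0] := @riesz_fischer _ _ _ mu g Lg.
  (* For this [r], which is at most 1, [8 D r + 4 r^2 <= (8 D + 4) r < (8 D + 5) r <= e^2]. *)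
  move=> e e0; pose r := Num.min 1 (e ^+ 2 / (8 * D + 5)).
  have D5 : 0 < 8 * D + 5 by lra.
  have r0 : 0 < r by rewrite lt_min ltr01 divr_gt0// exprn_gt0.
  have [N HN] : exists N : nat, forall n, (N <= n)%N -> n.+1%:R^-1 <= r.
    exists (Num.truncn r^-1) => n Nn; rewrite -[leRHS]invrK lef_pV2 ?posrE ?invr_gt0//.
    rewrite (le_trans (ltW (truncnS_gt _)))// ler_nat ltnS//.
  exists N => m n Nm Nn; rewrite -(@ltr_pXn2r _ 2)// ?nnegrE ?nr_ge0 ?(ltW e0)//.
  apply: le_lt_trans (cauchy _ _ _ (HN _ Nn) (HN _ Nm)) _.
  have r1 : r <= 1 by rewrite ge_min lexx.
  have : r * (8 * D + 5) <= e ^+ 2 by rewrite -ler_pdivlMr// ge_min lexx orbT.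
  have : r ^+ 2 <= r by rewrite expr2 ger_pMr.
  by move: r0; lra.
have Lh : L2 (sub f h0) by exact: L2B.
have app (e : R) : 0 < e -> exists n, nr (sub (g n) h0) < e /\ n.+1%:R^-1 < e.
  move=> e0; have [N HN] := gh0 _ e0; exists (maxn N (Num.truncn e^-1).+1); split.
    by apply: HN; rewrite leq_maxl.
  rewrite -[ltRHS]invrK ltf_pV2 ?posrE ?invr_gt0//.
  by rewrite (lt_le_trans (truncnS_gt _))// ler_nat leqW// leq_maxr.
(* The residual [sub f h0] realises the distance to [W], so it is orthogonal to [W], and totality
   makes it vanish. *)
have h00 : nr (sub f h0) = 0.
  apply: Wt => // w Ww; apply: nearest_orthogonal => //; first exact: WL.
  move=> t; have Lw := WL _ Ww; apply/ler_addgt0Pr => e e0.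
  (* Three errors share [e]: the distance from [g n] to [h0], counted twice, and the excess of [g n]
     over the infimum. *)
  have [n [ne ne']] := app (e / 3) (ltac:(by rewrite divr_gt0)).
  have h1 : nr (sub f h0) <= nr (sub f (g n)) + nr (sub (g n) h0) by exact: nr_sub_le.
  have [_ h2] := gP n.
  have h3 : D <= nr (sub f (add (g n) (scl t w))) by apply/DE/WD => //; exact: WZ.
  have h4 : nr (sub f (add (g n) (scl t w))) <=
      nr (sub (sub f h0) (scl t w)) + nr (sub h0 (g n)).
    rewrite [X in nr X <= _](_ : _ = add (sub (sub f h0) (scl t w)) (sub h0 (g n))); last first.
      by apply/funext => x; ring.
    by apply: nrD; apply: L2B => //; exact: L2Z.
  rewrite (nrBC mu h0 (g n)) in h4.
  have fin (a b c x y r : R) : a <= b + c -> b < D + r -> D <= x -> x <= y + c ->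
    c < e / 3 -> r < e / 3 -> a <= y + e by lra.
  exact: fin h1 h2 h3 h4 ne ne'.
have [n [ne _]] := app _ eps0; exists (g n) => //.
by rewrite (le_lt_trans (nr_sub_le Lf (Lg n) Lh0))// h00 add0r nrBC.
Qed.

Section orthonormal.
Context {I : choiceType}.
Variable e : I -> fn.
Hypothesis Le : forall i, L2 (e i).
Hypothesis eON : forall i j, ip (e i) (e j) = (i == j)%:R.

Let P (s : seq I) f : fn := fun x => \sum_(i <- s) ip (e i) f * e i x.

Let LP s f : L2 (P s f). Proof. exact: L2_lincomb. Qed.

Let ip_proj s f i : uniq s -> i \in s -> L2 f -> ip (e i) (sub f (P s f)) = 0.
Proof.
move=> us si Lf; rewrite ipBr// ip_sumr// (bigD1_seq i)//= eON eqxx mulr1.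
by rewrite big1 ?addr0 ?subrr// => j ji; rewrite eON eq_sym (negbTE ji) mulr0.
Qed.

Lemma orthogonal_sum h (s : seq I) (c : I -> R[i]) : L2 h -> (forall i, i \in s -> ip (e i) h = 0) ->
  ip h (fun x => \sum_(i <- s) c i * e i x) = 0.
Proof.
move=> Lh hs; rewrite ip_sumr// big_seq big1// => i si.
by rewrite (ipC (Le i) Lh) hs// rmorph0 mulr0.
Qed.

Let nr_proj s f : uniq s -> L2 f ->
  nr f ^+ 2 = nr (sub f (P s f)) ^+ 2 + \sum_(i <- s) normc (ip (e i) f) ^+ 2.
Proof.
move=> us Lf; have LB : L2 (sub f (P s f)) by exact: L2B.
rewrite {1}(_ : f = add (sub f (P s f)) (P s f)); last by apply/funext => x; rewrite subrK.
rewrite pythagoras//; last by apply: orthogonal_sum => // i si; exact: ip_proj.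
congr (_ + _); apply: (@complexI R); rewrite -ip_self// ip_sumr// rmorph_sum /=.
apply: eq_big_seq => i si; rewrite (ipC (Le i))// ip_sumr//.
rewrite (bigD1_seq i)//= eON eqxx mulr1 big1 ?addr0; last first.
  by move=> j ji; rewrite eON eq_sym (negbTE ji) mulr0.
by rewrite mulrC conj_mul_self.
Qed.

(** Bessel's inequality bounds every finite partial sum. Conversely, the orthogonal projection on
    the span of a finite subfamily approximates [f] at least as well as any given combination, and
    its squared error is the defect of the partial sum. *)
Lemma parseval f : L2 f ->
  (forall eps : R, 0 < eps -> exists (s : seq I) (c : I -> R[i]),
     nr (sub f (fun x => \sum_(i <- s) c i * e i x)) < eps) ->
  (\esum_(i in [set: I]) (normc (ip (e i) f) ^+ 2)%:E)%E = N2 mu f.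
Proof.
move=> Lf dens; rewrite N2E//; apply/eqP; rewrite eq_le; apply/andP; split.
  apply: ge_ereal_sup => _ [X [finX _] <-].
  rewrite fsbig_finite//= sumEFin lee_fin.
  by rewrite (@nr_proj (fset_set X)) ?fset_uniq// lerDr sqr_ge0.
(* The cap at 1 gives [q ^+ 2 <= q <= r], so an error below [q] in norm is below [r] once
   squared. *)
apply/lee_addgt0Pr => r r0; pose q := Num.min 1 r.
have q0 : 0 < q by rewrite lt_min ltr01.
have [s [c sc]] := dens _ q0.
have us := undup_uniq s.
set S := (X in (_ <= X + _)%E); have : ((\sum_(i <- undup s) normc (ip (e i) f) ^+ 2)%:E <= S)%E.
  apply: esum_ge; exists [set` undup s]; last by rewrite -fsbig_seq// sumEFin.
  by split => //; exact: finite_seq.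
move=> h; apply: le_trans (leeD2r _ h); rewrite -EFinD lee_fin (nr_proj us Lf) addrC lerD2l.
have LB : L2 (sub f (P (undup s) f)) by exact: L2B.
have h1 : nr (sub f (P (undup s) f)) ^+ 2 <= nr (sub f (fun x => \sum_(i <- s) c i * e i x)) ^+ 2.
  have LS : L2 (fun x => \sum_(i <- s) c i * e i x) by exact: L2_lincomb.
  rewrite [X in _ <= nr X ^+ 2](_ : _ = add (sub f (P (undup s) f))
     (sub (P (undup s) f) (fun x => \sum_(i <- s) c i * e i x))); last first.
    by apply/funext => x; ring.
  have LC : L2 (sub (P (undup s) f) (fun x => \sum_(i <- s) c i * e i x)) by exact: L2B.
  have O : ip (sub f (P (undup s) f))
      (sub (P (undup s) f) (fun x => \sum_(i <- s) c i * e i x)) = 0.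
    by rewrite ipBr// !orthogonal_sum ?subrr// => i si; apply: ip_proj; rewrite ?mem_undup// -mem_undup.
  by rewrite (pythagoras LB LC O) lerDl sqr_ge0.
apply: (le_trans h1); apply: (@le_trans _ _ (q ^+ 2)).
  by rewrite ler_pXn2r ?nnegrE ?nr_ge0 ?(ltW q0)// ltW.
have qr : q <= r by rewrite ge_min lexx orbT.
have q1 : q <= 1 by rewrite ge_min lexx.
by apply: le_trans qr; rewrite expr2 ger_pMr.
Qed.

End orthonormal.
End hilbert.

(** * Linear changes of variables for the Lebesgue measure *)

Section lebesgue_line.
Context {R : realType}.
Local Notation mR := (measurableTypeR R).
Local Notation leb1 := (@lebesgue_measure R).
Local Open Scope ereal_scope.

Lemma measurable_affine (c a : R) : measurable_fun [set: mR] (fun x : mR => (c * x + a)%R : mR).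
Proof. by apply: measurable_funD => //; apply: measurable_funM. Qed.

(** By uniqueness of the measure that gives half-open intervals their length. For [c < 0] the
    preimage is closed at its other end, which does not change its length. *)
Lemma lebesgue_measure_affine (c a : R) (X : set mR) : c != 0%R -> measurable X ->
  leb1 X = (`|c|)%:E * leb1 ((fun x => (c * x + a)%R) @^-1` X).
Proof.
move=> c0 mX; have mA := measurable_affine c a.
have kc : (0 <= `|c|)%R by [].
pose nu : {measure set mR -> \bar R} :=
  mscale (NngNum kc) (pushforward leb1 (fun x : mR => (c * x + a)%R : mR)).
suff h A : ocitv A -> leb1 A = nu mA A by exact: (@lebesgue_measure_unique R (nu mA)).
move=> [[x y] _ <-].
rewrite [RHS]/= /mscale /= /pushforward.
have -> : (fun x : mR => (c * x + a)%R) @^-1` `]x, y]%classic = if (0 < c)%R then `]((x - a) / c)%R, ((y - a) / c)%R]%classic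
      else `[((y - a) / c)%R, ((x - a) / c)%R[%classic.
  apply/seteqP; split => z; rewrite /=; case: ifPn => cp; rewrite /= !in_itv /=.
  - by rewrite ltr_pdivrMr// ler_pdivlMr// ltrBlDr lerBrDr (mulrC z).
  - have cn : (c < 0)%R by rewrite lt_neqAle c0 leNgt.
    by rewrite ler_ndivrMr// ltr_ndivlMr// lerBrDr ltrBlDr (mulrC z) andbC.
  - by rewrite ltr_pdivrMr// ler_pdivlMr// ltrBlDr lerBrDr (mulrC z).
  - have cn : (c < 0)%R by rewrite lt_neqAle c0 leNgt.
    by rewrite ler_ndivrMr// ltr_ndivlMr// lerBrDr ltrBlDr (mulrC z) andbC.
rewrite lebesgue_measure_itv /=.
have [cp|cp] := boolP (0 < c)%R.
  rewrite lebesgue_measure_itv /= !lte_fin.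
  rewrite ltr_pM2r ?invr_gt0// ltrD2r; case: ifPn => _; last by rewrite mule0.
  by rewrite -!EFinB -EFinM gtr0_norm//; congr EFin; field.
have cn : (c < 0)%R by rewrite lt_neqAle c0 leNgt.
rewrite lebesgue_measure_itv /= !lte_fin.
rewrite ltr_nM2r ?invr_lt0// ltrD2r; case: ifPn => _; last by rewrite mule0.
by rewrite -!EFinB -EFinM ltr0_norm//; congr EFin; field.
Qed.

Lemma ge0_integral_affine (c a : R) (f : mR -> \bar R) : c != 0%R ->
  measurable_fun setT f -> (forall x, 0 <= f x) ->
  \int[leb1]_x f (c * x + a)%R = (`|c|^-1)%:E * \int[leb1]_x f x.
Proof.
move=> c0 mf f0; have mA := measurable_affine c a.
have kc : (0 <= `|c|)%R by [].
pose nu : {measure set mR -> \bar R} := pushforward leb1 (fun x : mR => (c * x + a)%R : mR).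
pose nu' : {measure set mR -> \bar R} := mscale (NngNum kc) (nu mA).
rewrite (_ : \int[leb1]_x f x = \int[nu']_x f x); last first.
  by apply: eq_measure_integral => A mA' _; exact: lebesgue_measure_affine.
rewrite ge0_integral_mscale//= ge0_integral_pushforward// preimage_setT.
by rewrite muleA -EFinM mulVf ?mul1e// normr_eq0.
Qed.
End lebesgue_line.

Section lebesgue_space.
Context {R : realType}.
Local Notation mR := (measurableTypeR R).
Local Notation leb1 := (@lebesgue_measure R).
Local Notation leb d := (lebesgue_cV R d).
Local Open Scope ereal_scope.

Lemma measurable_col_mx d :
  measurable_fun [set: mR * 'cV[R]_d] (fun z => (col_mx z.1%:M z.2 : 'cV[R]_(1 + d))).
Proof.
apply: measurable_matrixP => i j; rewrite ord1.
have [k ->|k ->] := split_ordP i.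
  rewrite (_ : (fun _ => _) = fst) //; apply/funext => z.
  by rewrite col_mxEu !ord1 mxE eqxx mulr1n.
rewrite (_ : (fun _ => _) = (fun X : 'cV[R]_d => X k ord0) \o snd).
  exact: (measurableT_comp (measurable_matrix_coord k ord0) measurable_snd).
by apply/funext => z; rewrite /= col_mxEd.
Qed.

Lemma integral_cVS d (f : 'cV[R]_(1 + d) -> \bar R) : measurable_fun setT f -> (forall x, 0 <= f x) ->
  \int[leb d.+1]_z f z = \int[leb1]_x \int[leb d]_y f (col_mx (x : R)%:M y).
Proof.
move=> mf f0; have ms := @measurable_col_mx d.
rewrite [LHS](ge0_integral_pushforward ms _ measurableT mf)//.
rewrite preimage_setT fubini_tonelli1//; first exact: (measurableT_comp mf ms).
by move=> x; exact: f0.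
Qed.

Lemma integral_cVS' d (f : 'cV[R]_(1 + d) -> \bar R) : measurable_fun setT f -> (forall x, 0 <= f x) ->
  \int[leb d.+1]_z f z = \int[leb d]_y \int[leb1]_x f (col_mx (x : R)%:M y).
Proof.
move=> mf f0; have ms := @measurable_col_mx d.
rewrite [LHS](ge0_integral_pushforward ms _ measurableT mf)//.
rewrite preimage_setT fubini_tonelli2//; first exact: (measurableT_comp mf ms).
by move=> x; exact: f0.
Qed.

Lemma measurable_fun_col_mx1 d (f : 'cV[R]_(1 + d) -> \bar R) (x : R) : measurable_fun setT f ->
  measurable_fun setT (fun y : 'cV[R]_d => f (col_mx x%:M y)).
Proof.
move=> mf; have ms := @measurable_col_mx d.
by have := measurableT_comp mf ms => /(measurable_fun_pair2 x).
Qed.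

Lemma measurable_fun_col_mx2 d (f : 'cV[R]_(1 + d) -> \bar R) (y : 'cV[R]_d) : measurable_fun setT f ->
  measurable_fun setT (fun x : mR => f (col_mx (x : R)%:M y)).
Proof.
move=> mf; have ms := @measurable_col_mx d.
by have := measurableT_comp mf ms => /(measurable_fun_pair1 y).
Qed.

Lemma measurable_integral_col_mx d (f : 'cV[R]_(1 + d) -> \bar R) : measurable_fun setT f ->
  (forall x, 0 <= f x) ->
  measurable_fun setT (fun x : mR => \int[leb d]_y f (col_mx (x : R)%:M y)).
Proof.
move=> mf f0; pose F (z : mR * 'cV[R]_d) := f (col_mx (z.1 : R)%:M z.2).
have mF : measurable_fun setT F by exact: (measurableT_comp mf (@measurable_col_mx d)).
apply: (@measurable_fun_fubini_tonelli_F _ _ mR _ R (leb d) F mF).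
by move=> x; exact: f0.
Qed.

Lemma measurable_mxD d (a : 'cV[R]_d) : measurable_fun setT (fun x : 'cV[R]_d => (x + a)%R).
Proof.
apply: measurable_matrixP => i j; under eq_fun do rewrite mxE.
by apply: measurable_funD; [exact: measurable_matrix_coord|exact: measurable_cst].
Qed.

Lemma measurable_mulmx d d' (A : 'M[R]_(d', d)) : measurable_fun setT (fun x : 'cV[R]_d => A *m x : 'cV[R]_d').
Proof.
apply: measurable_matrixP => i j; under eq_fun do rewrite mxE.
apply: measurable_sum => k; apply: measurable_funM; first exact: measurable_cst.
exact: measurable_matrix_coord.
Qed.

Lemma ge0_integral_cVD d (a : 'cV[R]_d) (f : 'cV[R]_d -> \bar R) :
  measurable_fun setT f -> (forall x, 0 <= f x) ->
  \int[leb d]_x f (x + a)%R = \int[leb d]_x f x.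
Proof.
elim: d => [|d IH] in a f *; move=> mf f0.
  by apply: eq_integral => x _; congr f; rewrite !flatmx0.
have mfa : measurable_fun setT (fun x : 'cV[R]_(1 + d) => f (x + a)%R).
  exact: (measurableT_comp mf (measurable_mxD _)).
rewrite (integral_cVS mfa (fun x => f0 _)) (integral_cVS mf f0).
pose a0 := (a : 'cV_(1 + d)) ord0 ord0; pose g x := \int[leb d]_y f (col_mx (x : R)%:M y).
have mg : measurable_fun setT (g : mR -> \bar R) by exact: measurable_integral_col_mx.
have g0 x : 0 <= g x by exact: integral_ge0.
transitivity (\int[leb1]_x g (1 * x + a0)%R); last first.
  by rewrite ge0_integral_affine// ?oner_neq0// normr1 invr1 mul1e.
apply: eq_integral => x _; rewrite /g -[RHS](IH (dsubmx (a : 'cV_(1 + d)))) //; last first.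
  exact: measurable_fun_col_mx1.
apply: eq_integral => y _; congr f.
have aE : (a : 'cV_(1 + d)) = col_mx (a0%:M) (dsubmx (a : 'cV_(1 + d))).
  apply: (etrans (esym (@vsubmxK _ 1 d 1 a))); congr col_mx; rewrite [LHS]mx11_scalar mxE.
  by congr (a _ _)%:M; exact/val_inj.
transitivity ((col_mx x%:M y : 'cV_(1 + d)) + col_mx (a0%:M) (dsubmx (a : 'cV_(1 + d))))%R.
  by congr (_ + _)%R.
by rewrite add_col_mx mul1r raddfD.
Qed.

(** Stated through nonnegative functions rather than sets, so that the factors of a matrix product
    can be substituted one after the other. *)
Definition scales_lebesgue d (A : 'M[R]_d) := forall f : 'cV[R]_d -> \bar R,
  measurable_fun setT f -> (forall x, 0 <= f x) ->
  \int[leb d]_x f (A *m x) = (`|\det A|^-1)%:E * \int[leb d]_x f x.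

Lemma scales_lebesgueM d (A B : 'M[R]_d) : scales_lebesgue A -> scales_lebesgue B ->
  scales_lebesgue (A *m B).
Proof.
move=> HA HB f mf f0; under eq_integral do rewrite -mulmxA.
rewrite (HB (fun x => f (A *m x)))//; last exact: (measurableT_comp mf (measurable_mulmx A)).
by rewrite HA// det_mulmx normrM invfM muleA -EFinM mulrC.
Qed.

(** For a fixed first coordinate this shear translates the remaining ones. *)
Lemma scales_lebesgue_lblock d (v : 'cV[R]_d) : scales_lebesgue (block_mx (1%:M : 'M[R]_1) 0%R v (1%:M : 'M[R]_d)).
Proof.
move=> f mf f0; rewrite det_lblock !det1 mulr1 normr1 invr1 mul1e.
rewrite integral_cVS//; last exact: (measurableT_comp mf (measurable_mulmx _)).
rewrite (integral_cVS mf f0); apply: eq_integral => x _.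
rewrite -[RHS](ge0_integral_cVD (v *m x%:M)) //; last exact: measurable_fun_col_mx1.
by apply: eq_integral => y _; rewrite mul_block_col !mul1mx mul0mx addr0 addrC.
Qed.

(** Integrating over the first coordinate innermost makes this shear a translation of the line. *)
Lemma scales_lebesgue_ublock d (w : 'rV[R]_d) : scales_lebesgue (block_mx (1%:M : 'M[R]_1) w 0%R (1%:M : 'M[R]_d)).
Proof.
move=> f mf f0; rewrite det_ublock !det1 mulr1 normr1 invr1 mul1e.
rewrite integral_cVS'//; last exact: (measurableT_comp mf (measurable_mulmx _)).
rewrite (integral_cVS' mf f0); apply: eq_integral => y _.
have := @ge0_integral_affine R 1 ((w *m y) ord0 ord0) (fun x : mR => f (col_mx (x : R)%:M y)) (oner_neq0 _).
rewrite normr1 invr1 mul1e => <- //; last exact: measurable_fun_col_mx2.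
apply: eq_integral => x _; rewrite mul_block_col !mul1mx mul0mx add0r mul1r raddfD /=.
by congr (f (col_mx (_ + _) _)); rewrite [LHS]mx11_scalar.
Qed.

Lemma scales_lebesgue_diag d (a : R) (B : 'M[R]_d) : a != 0%R -> scales_lebesgue B ->
  scales_lebesgue (block_mx (a%:M : 'M[R]_1) 0%R 0%R B).
Proof.
move=> a0 HB f mf f0; rewrite det_lblock det_scalar1 normrM invfM.
rewrite integral_cVS//; last exact: (measurableT_comp mf (measurable_mulmx _)).
rewrite (integral_cVS mf f0); pose g x := \int[leb d]_y f (col_mx (x : R)%:M y).
have mg : measurable_fun setT (g : mR -> \bar R) by exact: measurable_integral_col_mx.
have g0 x : 0 <= g x by exact: integral_ge0.
transitivity (\int[leb1]_x (`|\det B|^-1%:E * g (a * x + 0)%R)).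
  apply: eq_integral => x _; rewrite -HB//; last exact: measurable_fun_col_mx1.
  apply: eq_integral => y _; rewrite mul_block_col !mul0mx add0r !addr0.
  by rewrite -scalar_mxM.
have mga : measurable_fun setT (fun x : mR => g (a * x + 0)%R).
  by apply: (measurableT_comp mg); exact: measurable_affine.
have B0 : (0 <= `|\det B|^-1)%R by rewrite invr_ge0.
rewrite mulrC EFinM -muleA -[X in _ = _ * X](@ge0_integral_affine _ a 0 g a0 mg g0).
move: (`|\det B|^-1)%R B0 => k k0.
have ga0 (x : mR) : setT x -> 0 <= g (a * x + 0)%R by move=> _; exact: g0.
exact: (@ge0_integralZl_EFin _ mR R leb1 setT measurableT (fun x : mR => g (a * x + 0)%R) ga0 mga _ k0).
Qed.

Local Close Scope ereal_scope.

(* A nonzero corner entry is a pivot for a block LDU factorisation; if the corner entry is zero, a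
   transvection makes it nonzero. *)
Lemma unitmx_scales_lebesgue d (A : 'M[R]_d) : A \in unitmx -> scales_lebesgue A.
Proof.
elim: d => [|d IH] in A *.
  move=> _ f mf f0; rewrite det_mx00 normr1 invr1 mul1e.
  by apply: eq_integral => x _; congr f; rewrite !flatmx0.
have pivot (B : 'M[R]_(1 + d)) : B ord0 ord0 != 0%R -> B \in unitmx -> scales_lebesgue B.
  move=> b0 uB; set b := B ord0 ord0 in b0.
  have ub : ulsubmx B = b%:M.
    by rewrite [LHS]mx11_scalar !mxE; congr (B _ _)%:M; exact/val_inj.
  (* The Schur complement of the pivot; it inherits invertibility from [B] through the
     factorisation. *)
  pose C := drsubmx B - b^-1 *: (dlsubmx B *m ursubmx B).
  have BE : B = block_mx 1%:M 0 (b^-1 *: dlsubmx B) 1%:M *m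
      (block_mx (b%:M : 'M[R]_1) 0 0 C *m block_mx 1%:M (b^-1 *: ursubmx B) 0 1%:M).
    rewrite !mulmx_block !mul1mx !mul0mx !mulmx0 !mulmx1 !addr0 !add0r.
    rewrite -{1}(submxK B) ub; congr block_mx.
    - by rewrite mul_scalar_mx scalerA mulfV// scale1r.
    - by rewrite mul_mx_scalar scalerA mulfV// scale1r.
    - by rewrite mul_scalar_mx scalerA mulfV// scale1r -scalemxAl /C addrC subrK.
  rewrite BE; apply: scales_lebesgueM; first exact: scales_lebesgue_lblock.
  apply: scales_lebesgueM; last exact: scales_lebesgue_ublock.
  apply: scales_lebesgue_diag => //; apply: IH.
  move: uB; rewrite BE !unitmx_mul => /and3P[_ + _].
  by rewrite !unitmxE det_lblock unitrM => /andP[].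
move=> uA; have [A0|A0] := eqVneq ((A : 'M[R]_(1 + d)) ord0 ord0) 0%R; last exact: pivot.
have [k Ak] : exists k, (A : 'M[R]_(1 + d)) (rshift 1 k) ord0 != 0%R.
  apply: contrapT => /forallNP nA; move: uA; rewrite unitmxE unitfE => /negP; apply.
  rewrite (expand_det_col _ (ord0 : 'I_(1 + d))) big1// => i _.
  have [j ->|j ->] := split_ordP (i : 'I_(1 + d)).
    by rewrite (_ : lshift d j = (ord0 : 'I_(1 + d))) ?A0 ?mul0r//; apply/val_inj; rewrite /= ord1.
  by have /negP := nA j; rewrite negbK => /eqP ->; rewrite mul0r.
(* Left multiplication by [E] adds to the first row the row whose first entry is nonzero; [E'] is
   its inverse. *)
pose E := block_mx (1%:M : 'M[R]_1) (delta_mx ord0 k : 'rV[R]_d) 0 1%:M.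
pose E' := block_mx (1%:M : 'M[R]_1) (- delta_mx ord0 k : 'rV[R]_d) 0 1%:M.
have E'E : E' *m E = 1%:M.
  rewrite mulmx_block !mul1mx !mul0mx !mulmx0 !mulmx1 !addr0 add0r subrr.
  by rewrite -scalar_mx_block.
rewrite -[A]mul1mx -E'E -mulmxA; apply: scales_lebesgueM; first exact: scales_lebesgue_ublock.
apply: pivot; last first.
  rewrite unitmx_mul uA andbT unitmxE unitfE det_ublock !det1 mulr1 oner_neq0//.
have o0 : (ord0 : 'I_(1 + d)) = lshift d ord0 by exact/val_inj.
have oS j : lift ord0 j = rshift 1 j :> 'I_(1 + d) by exact/val_inj.
have e0 : E ord0 ord0 = 1 by rewrite [X in E X _]o0 [X in E _ X]o0 block_mxEul mxE eqxx.
have ej j : E ord0 (lift ord0 j) = (j == k)%:R by rewrite oS {1}o0 block_mxEur mxE eqxx.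
rewrite mxE big_ord_recl e0 mul1r A0 add0r (bigD1 k)//= ej eqxx mul1r big1.
  by rewrite oS addr0.
by move=> j /negbTE jk; rewrite ej jk mul0r.
Qed.

End lebesgue_space.

(** * Sums over countable index sets and their integrals *)

Section countable_sums.
Context {R : realType} {K : countType}.
Local Open Scope ereal_scope.

(** Enumeration by codes: a natural number that codes no element contributes the default 0. This
    opens sums over Z^d to the theorems on series. *)
Lemma esum_nneseries (a : K -> \bar R) : (forall k, 0 <= a k) ->
  \esum_(k in [set: K]) a k = \sum_(n <oo) oapp a 0 (pickle_inv n).
Proof.
move=> a0; have b0 n : 0 <= oapp a 0 (pickle_inv n) by case: pickle_inv.
rewrite nneseries_esumT//.
have bij : set_bij [set: K]%classic (range (@choice.pickle K)) choice.pickle.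
  split; [by move=> k _; exists k|by move=> k l _ _ /(pcan_inj choice.pickleK)|by move=> _ [k _ <-]; exists k].
transitivity (\esum_(n in range (@choice.pickle K)) oapp a 0 (pickle_inv n)).
  by rewrite (reindex_esum _ _ _ _ bij); apply: eq_esum => k _; rewrite pickleK_inv.
rewrite esum_mkcond; apply: eq_esum => n _; case: ifPn => // /negP nK.
case E : (pickle_inv n) => [k|]//=; case: nK; rewrite inE; exists k => //.
by have := @pickle_invK K n; rewrite E.
Qed.

Context {d : measure_display} {T : measurableType d} (mu : {measure set T -> \bar R}).
Variable G : K -> T -> \bar R.
Hypothesis mG : forall k, measurable_fun setT (G k).
Hypothesis G0 : forall k x, 0 <= G k x.

Lemma measurable_esum : measurable_fun setT (fun x => \esum_(k in [set: K]) G k x).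
Proof.
under eq_fun do rewrite esum_nneseries//.
apply: (@ge0_emeasurable_sum _ _ _ setT (fun n x => oapp (G^~ x) 0 (pickle_inv n)) xpredT).
  by move=> n x _ _; case: pickle_inv => [k|] /=.
by move=> n _; case: pickle_inv => [k|] /=; [exact: mG|exact: measurable_cst].
Qed.

Lemma integral_esum :
  \int[mu]_x (\esum_(k in [set: K]) G k x) = \esum_(k in [set: K]) \int[mu]_x G k x.
Proof.
under eq_integral do rewrite esum_nneseries//.
rewrite integral_nneseries//; last 2 first.
- by move=> n; case: pickle_inv => [k|] /=; [exact: mG|exact: measurable_cst].
- by move=> n x _; case: pickle_inv => [k|] /=.
rewrite esum_nneseries; last by move=> k; exact: integral_ge0.
by apply: eq_eseriesr => n _; case: pickle_inv => [k|] //=; rewrite integral0.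
Qed.

End countable_sums.

(** * The unit cube as a fundamental domain *)

Section torus_fibers.
Context {R : realType} {d : nat}.
Local Notation Rd := 'cV[R]_d.
Local Notation leb := (lebesgue_cV R d).
Local Notation Zd := 'cV[int]_d.
Local Notation cube := (@unit_cube R d).

Definition zvec (k : Zd) : Rd := map_mx intr k.

Lemma zvecD k l : zvec (k + l) = zvec k + zvec l. Proof. by rewrite /zvec map_mxD. Qed.
Lemma zvecN k : zvec (- k) = - zvec k. Proof. by rewrite /zvec map_mxN. Qed.
Lemma zvec0 : zvec 0 = 0. Proof. by rewrite /zvec map_mx0. Qed.

Lemma zvec_inj : injective zvec.
Proof. by move=> k l /matrixP kl; apply/matrixP => i j; have := kl i j; rewrite !mxE => /intr_inj. Qed.

Definition floorv (x : Rd) : Zd := \col_i Num.floor (x i ord0).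

Lemma cube_floorv x : cube (x - zvec (floorv x)).
Proof.
by move=> i; rewrite !mxE subr_ge0 ltrBlDl -intrD1 floor_itv// num_real.
Qed.

Lemma cube_zvec_uniq x (k l : Zd) : cube (x - zvec k) -> cube (x - zvec l) -> k = l.
Proof.
move=> ck cl; apply/matrixP => i j; rewrite ord1; have := ck i; have := cl i; rewrite !mxE.
move=> /andP[l0 l1] /andP[k0 k1]; apply/eqP; rewrite eq_le -!ltzD1 -!(ltr_int R) !intrD.
by apply/andP; split; rewrite mulr1z; lra.
Qed.

Lemma torus_piP x y : torus_pi x = torus_pi y <-> exists k, x = y + zvec k.
Proof.
split=> [/eqmodP/mxOverP xy|[k ->]]; last first.
  apply/eqmodP/mxOverP => i j; rewrite !mxE addrAC subrr add0r.
  by apply/intrP; eexists.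
exists (\matrix_(i, j) Num.floor ((x - y) i j)).
rewrite -[LHS](subrK y) addrC; congr (_ + _); apply/matrixP => i j; rewrite !mxE.
by have /floorK := xy i j; rewrite !mxE.
Qed.

Local Open Scope ereal_scope.

Lemma measurable_cube_shift k : measurable [set x : Rd | cube (x - zvec k)%R].
Proof.
rewrite -[X in measurable X]setTI; apply: (measurable_mxD (- zvec k)%R) => //.
exact: measurable_unit_cube.
Qed.

(** The integer translates of the cube tile the space: [G] is the sum of its restrictions [H k] to
    the tiles, and each is translated back to the cube. *)
Lemma integral_unfold (G : Rd -> \bar R) : measurable_fun setT G -> (forall x, 0 <= G x) ->
  \int[leb]_x G x = \int[leb]_(x in cube) \esum_(k in [set: Zd]) G (x + zvec k)%R.
Proof.
move=> mG G0; have mc := @measurable_unit_cube R d.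
pose H k := G \_ [set x : Rd | cube (x - zvec k)%R].
have mH k : measurable_fun setT (H k).
  by apply/(measurable_restrictT _ (measurable_cube_shift k)); exact: measurable_funS mG.
have H0 k x : 0 <= H k x by rewrite /H patchE; case: ifP.
have -> : \int[leb]_x G x = \int[leb]_x \esum_(k in [set: Zd]) H k x.
  apply: eq_integral => x _; have cx := cube_floorv x.
  rewrite (_ : G x = \esum_(k in [set floorv x]) H k x); last first.
    by rewrite esum_set1 ?H0// /H patchE mem_set.
  rewrite esum_mkcond; apply: eq_esum => k _; case: ifPn => // /negP kx.
  rewrite /H patchE memNset// => ck; apply: kx; rewrite inE.
  exact: cube_zvec_uniq ck cx.
rewrite integral_esum//.
transitivity (\esum_(k in [set: Zd]) \int[leb]_x ((fun y : Rd => G (y + zvec k)%R) \_ cube) x).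
  apply: eq_esum => k _; rewrite -(ge0_integral_cVD (zvec k) (mH k))//.
  by apply: eq_integral => x _; rewrite /H !patchE; congr (if _ then _ else _); apply/idP/idP;
    rewrite !inE /= addrK.
have mGk k : measurable_fun setT (fun y : Rd => G (y + zvec k)%R).
  exact: (measurableT_comp mG (measurable_mxD _)).
rewrite -integral_esum//; last 2 first.
- by move=> k; apply/(measurable_restrictT _ mc); exact: measurable_funS (mGk k).
- by move=> k x; rewrite patchE; case: ifP.
rewrite [RHS]integral_mkcond; apply: eq_integral => x _; rewrite patchE.
case: ifPn => xc; first by apply: eq_esum => k _; rewrite patchE xc.
by rewrite esum1// => k _; rewrite patchE (negbTE xc).
Qed.

Lemma measurable_periodise (G : Rd -> \bar R) : measurable_fun setT G -> (forall x, 0 <= G x) ->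
  measurable_fun setT (fun x : Rd => \esum_(k in [set: Zd]) G (x + zvec k)%R).
Proof.
move=> mG G0; apply: measurable_esum => // k.
exact: (measurableT_comp mG (measurable_mxD _)).
Qed.

Local Close Scope ereal_scope.

(** A measure on the whole space rather than on the cube: Haar measure is then its image under
    [torus_pi], and integrals over it range over all of R^d. *)
Definition cube_measure : {measure set Rd -> \bar R} := mrestr leb (@measurable_unit_cube R d).
Local Notation mu := cube_measure.

Lemma ge0_integral_haar (h : torus R d -> \bar R) : measurable_fun setT h -> (forall z, (0 <= h z)%E) ->
  (\int[@haar R d]_z h z = \int[mu]_x h (torus_pi x))%E.
Proof.
move=> mh h0; have mpi := @measurable_torus_pi R d.
by rewrite [LHS](ge0_integral_pushforward mpi _ measurableT mh)// preimage_setT.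
Qed.

Lemma ge0_integral_cube (f : Rd -> \bar R) : measurable_fun setT f -> (forall x, (0 <= f x)%E) ->
  (\int[mu]_x f x = \int[leb]_(x in cube) f x)%E.
Proof.
move=> mf f0; have mc := @measurable_unit_cube R d.
have mC : measurable (~` cube) by exact: measurableC.
rewrite (@ge0_negligible_integral _ _ _ mu setT (~` cube)) //; last first.
  by rewrite /mu /= /mrestr setICl measure0.
rewrite setDE setCK setTI; apply: eq_measure_integral => A mA Ac.
by rewrite /mu /= /mrestr setIidl.
Qed.

Lemma haar_integral (h : torus R d -> \bar R) : measurable_fun setT h -> (forall z, (0 <= h z)%E) ->
  (\int[@haar R d]_z h z = \int[leb]_(x in cube) h (torus_pi x))%E.
Proof.
by move=> mh h0; rewrite ge0_integral_haar// ge0_integral_cube.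
Qed.

End torus_fibers.

(** * The maps iota_n and the brackets *)

Section iterz_theory.
Context {T : Type} (f g : T -> T).
Hypotheses (fK : cancel f g) (gK : cancel g f).

Lemma iterzS n x : iterz f g (n + 1) x = f (iterz f g n x).
Proof.
case: n => [k|[|k]]; first by rewrite (_ : Posz k + 1 = Posz k.+1)// -addn1.
  by rewrite NegzE addNr /= gK.
rewrite (_ : Negz k.+1 + 1 = Negz k) /= ?gK//.
by rewrite !NegzE -[in LHS]addn1 PoszD opprD subrK.
Qed.

Lemma iterzD m n x : iterz f g (m + n) x = iterz f g m (iterz f g n x).
Proof.
elim/int_ind: m => [|m IH|m IH]; first by rewrite add0r.
  by rewrite -addn1 PoszD addrAC iterzS IH iterzS.
have E : - m.+1%:Z + 1 = - m%:Z by rewrite -addn1 PoszD opprD addrNK.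
by apply: (can_inj fK); rewrite -!iterzS addrAC E IH.
Qed.

End iterz_theory.

Section matrix_powers.
Context {R : realType} {d : nat} (E : 'M[R]_d).
Hypothesis uE : E \in unitmx.

Definition mxpow (n : int) : 'M[R]_d := iterz (mulmx E) (mulmx (invmx E)) n 1%:M.

Lemma iterz_mulmx n p (x : 'M[R]_(d, p)) : iterz (mulmx E) (mulmx (invmx E)) n x = mxpow n *m x.
Proof.
rewrite /mxpow; case: n => k /=; first by elim: k => [|k /= ->]; rewrite ?mul1mx// mulmxA.
rewrite -mulmxA; congr mulmx.
by elim: k => [|k /= ->]; rewrite ?mul1mx// mulmxA.
Qed.

Lemma mxpowD m n : mxpow (m + n) = mxpow m *m mxpow n.
Proof. by rewrite -iterz_mulmx /mxpow -iterzD//; [exact: mulKmx|exact: mulKVmx]. Qed.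

Lemma mxpow1 : mxpow 1 = E. Proof. exact: mulmx1. Qed.

Lemma mxpowVK n : mxpow n *m mxpow (- n) = 1%:M.
Proof. by rewrite -mxpowD subrr. Qed.

Lemma mxpowNK n : mxpow (- n) *m mxpow n = 1%:M.
Proof. by rewrite -mxpowD addNr. Qed.

Lemma det_mxpow n : \det (mxpow n) = \det E ^ n.
Proof.
have u : \det E \is a GRing.unit by rewrite -unitmxE.
elim/int_ind: n => [|n IH|n IH]; first by rewrite [LHS]det1.
  by rewrite -addn1 PoszD mxpowD det_mulmx IH mxpow1 exprzDr.
apply: (mulIr u); rewrite -{1}mxpow1 -det_mulmx -mxpowD -{2}[\det E]expr1z -exprzDr//.
by rewrite -addn1 PoszD opprD addrNK IH.
Qed.

Lemma unitmx_mxpow n : mxpow n \in unitmx.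
Proof. by rewrite unitmxE det_mxpow unitfE expfz_neq0// -unitfE -unitmxE. Qed.

End matrix_powers.

Section dilations.
Context {R : realType} {d : nat} (D : 'M[int]_d).
Local Notation Rd := 'cV[R]_d.
Local Notation leb := (lebesgue_cV R d).
Local Notation Zd := 'cV[int]_d.
Local Notation m := (@absdet R d D).
Local Notation DR := (@DR R d D).

(** A singular matrix would have the eigenvalue 0. *)
Lemma dilation_matrix_unit : dilation_matrix R D -> DR \in unitmx.
Proof.
move=> hD; rewrite unitmxE unitfE; apply/negP => /eqP D0.
have : eigenvalue (map_mx intr D : 'M[R[i]]_d) 0.
  rewrite /eigenvalue /eigenspace raddf0 subr0 kermx_eq0 row_free_unit unitmxE unitfE negbK.
  rewrite det_map_mx; move: D0; rewrite /DR det_map_mx => /eqP; rewrite intr_eq0 => /eqP ->.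
  by rewrite /= rmorph0 eqxx.
by move=> /hD; rewrite normr0 ltr10.
Qed.

Hypothesis uD : DR \in unitmx.

Let uE : DR^T \in unitmx. Proof. by rewrite unitmx_tr. Qed.

Lemma absdetE : m = `|\det DR|.
Proof. by rewrite /absdet /DR det_map_mx -intr_norm. Qed.

Lemma absdet_gt0 : 0 < m.
Proof. by rewrite absdetE normr_gt0 -unitfE -unitmxE. Qed.

Let m0 := absdet_gt0.

Local Notation E := (mxpow DR^T).

Lemma det_DRT_pow n : `|\det (E n)| = m ^ n.
Proof.
rewrite det_mxpow// det_tr absdetE; case: n => k; rewrite ?NegzE -?exprnN -?exprnP.
  exact: normrX.
by rewrite normfV normrX.
Qed.

Lemma iota_nE n (x : Rd) : iota_n D n x = torus_pi (E (- n) *m x).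
Proof. by rewrite /iota_n iterz_mulmx. Qed.

Lemma measurable_iota n : measurable_fun setT (@iota_n R d D n).
Proof.
rewrite (_ : iota_n D n = @torus_pi R d \o mulmx (E (- n))); last first.
  by apply/funext => x; rewrite iota_nE.
exact: (measurableT_comp (@measurable_torus_pi R d) (measurable_mulmx _)).
Qed.

(** The fibre is the image of the coset [x + Z^d] under the n-th power of the transposed dilation.
    Parametrising it by Z^d makes fibre sums measurable and lets integrals unfold along them. *)
Lemma fiber_bij n (x : Rd) :
  set_bij [set: Zd]%classic (fiber D n (torus_pi x)) (fun k => E n *m (x + zvec k)).
Proof.
split.
- move=> k _; rewrite /fiber /= iota_nE mulmxA mxpowNK// mul1mx.
  by apply/torus_piP; exists k.
- move=> k l _ _ /(congr1 (mulmx (E (- n)))); rewrite !mulmxA mxpowNK// !mul1mx => /addrI.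
  exact: zvec_inj.
- move=> y; rewrite /fiber /= iota_nE => /torus_piP[k yk]; exists k => //.
  by rewrite -yk mulmxA mxpowVK// mul1mx.
Qed.

Lemma esum_fiber n (x : Rd) (F : Rd -> \bar R) :
  (\esum_(y in fiber D n (torus_pi x)) F y =
   \esum_(k in [set: Zd]) F (E n *m (x + zvec k)))%E.
Proof. exact: (reindex_esum _ _ _ _ (fiber_bij n x)). Qed.

Lemma measurable_torusP d' (S : measurableType d') (h : torus R d -> S) :
  measurable_fun setT (h \o @torus_pi R d) -> measurable_fun setT h.
Proof.
by move=> mh _ B mB; have := mh measurableT B mB; rewrite !setTI.
Qed.

Lemma measurable_fiber_sum n (F : Rd -> \bar R) : measurable_fun setT F -> (forall x, (0 <= F x)%E) ->
  measurable_fun setT (fun z : torus R d => (\esum_(y in fiber D n z) F y)%E).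
Proof.
move=> mF F0; apply: measurable_torusP.
rewrite (_ : _ \o _ = (fun x => (\esum_(k in [set: Zd]) F (E n *m (x + zvec k)))%E)); last first.
  by apply/funext => x; rewrite /= esum_fiber.
have := @measurable_periodise R d (fun y => F (E n *m y)); apply => //.
exact: (measurableT_comp mF (measurable_mulmx _)).
Qed.

(** The change of variables by the n-th power of the transposed dilation has Jacobian [m ^ n],
    exactly the normalisation of the bracket; the rest is unfolding. *)
Lemma integral_fiber n (F : Rd -> \bar R) : measurable_fun setT F -> (forall x, (0 <= F x)%E) ->
  (\int[leb]_x F x = \int[@haar R d]_z ((m ^ n)%:E * \esum_(y in fiber D n z) F y))%E.
Proof.
move=> mF F0.
have mFE : measurable_fun setT (fun y => F (E n *m y)).
  exact: (measurableT_comp mF (measurable_mulmx _)).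
have mn0 : 0 < m ^ n by rewrite exprz_gt0.
rewrite ge0_integralZl_EFin//; last 3 first.
- by move=> z _; exact: esum_ge0.
- exact: measurable_fiber_sum.
- exact: ltW.
rewrite haar_integral//; last 2 first.
- exact: measurable_fiber_sum.
- by move=> z; exact: esum_ge0.
rewrite [in RHS](eq_integral (fun x : Rd => \esum_(k in [set: Zd]) F (E n *m (x + zvec k)))%E); last first.
  by move=> x _; rewrite esum_fiber.
rewrite -(@integral_unfold R d (fun y => F (E n *m y)))//.
rewrite (unitmx_scales_lebesgue (unitmx_mxpow uE n))//.
by rewrite det_DRT_pow muleA -EFinM mulfV ?mul1e// gt_eqF.
Qed.

End dilations.

(** * Absolutely summable families *)

Section summable_families.
Context {R : realType} {T : choiceType}.
Implicit Types (S : set T) (f g : T -> R).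

(** The identity [f^\+ + b = a + f^\-] is summed and rearranged, all four sums being finite. The
    freedom in choosing [a] and [b] is what gives additivity. *)
Lemma rsum_sub S f (a b : T -> R) : (forall x, 0 <= a x) -> (forall x, 0 <= b x) ->
  (\esum_(x in S) (a x)%:E < +oo)%E -> (\esum_(x in S) (b x)%:E < +oo)%E ->
  (forall x, f x = a x - b x) ->
  rsum S f = fine (\esum_(x in S) (a x)%:E) - fine (\esum_(x in S) (b x)%:E).
Proof.
move=> a0 b0 aoo boo fab.
have pa x : f^\+ x <= a x by rewrite /funrpos fab ge_max a0 andbT lerBlDr lerDl.
have nb x : f^\- x <= b x by rewrite /funrneg fab ge_max b0 andbT opprB lerBlDr lerDl.
have poo : (\esum_(x in S) (f^\+ x)%:E < +oo)%E.
  by apply: le_lt_trans aoo; apply: le_esum => x _; rewrite lee_fin.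
have noo : (\esum_(x in S) (f^\- x)%:E < +oo)%E.
  by apply: le_lt_trans boo; apply: le_esum => x _; rewrite lee_fin.
have fn (h : T -> R) : (forall x, 0 <= h x) -> (\esum_(x in S) (h x)%:E < +oo)%E ->
    (\esum_(x in S) (h x)%:E)%E \is a fin_num.
  by move=> h0; rewrite ge0_fin_numE// esum_ge0// => x _; rewrite lee_fin.
have : (\esum_(x in S) (f^\+ x)%:E + \esum_(x in S) (b x)%:E =
        \esum_(x in S) (a x)%:E + \esum_(x in S) (f^\- x)%:E)%E.
  rewrite -!esumD; try by move=> x _; rewrite lee_fin.
  apply: eq_esum => x _; rewrite -!EFinD; congr EFin.
  have := congr1 (fun h => h x) (funrposBneg f); rewrite !fctE fab; lra.
rewrite /rsum; move: (fn _ a0 aoo) (fn _ b0 boo) (fn _ (fun x => funrpos_ge0 f x) poo) (fn _ (fun x => funrneg_ge0 f x) noo).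
move: (esum _ _) (esum _ _) (esum _ _) (esum _ _) => [x| |] [y| |] [z| |] [w| |] //= _ _ _ _ [].
lra.
Qed.

(** One inequality is proved for every positive factor; applied to [r^-1] it gives the other. *)
Lemma esumZ S (a : T -> R) (r : R) : (forall x, 0 <= a x) -> 0 <= r ->
  (\esum_(x in S) (r * a x)%:E = r%:E * \esum_(x in S) (a x)%:E)%E.
Proof.
have H (s : R) (b : T -> R) : (forall x, 0 <= b x) -> 0 < s ->
    (\esum_(x in S) (s * b x)%:E <= s%:E * \esum_(x in S) (b x)%:E)%E.
  move=> b0 s0; apply: ge_ereal_sup => _ [X [finX XS] <-].
  rewrite fsbig_finite//= sumEFin -mulr_sumr EFinM lee_pmul2l//.
  apply: esum_ge; exists X => //.
  by rewrite fsbig_finite//= sumEFin.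
move=> a0; rewrite le_eqVlt => /predU1P[<-|r0].
  by rewrite mul0e esum1// => x _; rewrite mul0r.
apply/eqP; rewrite eq_le H//=; have ri : 0 < r^-1 by rewrite invr_gt0.
have := H r^-1 (fun x => r * a x) (fun x => mulr_ge0 (ltW r0) (a0 x)) ri.
under eq_esum do rewrite mulKf ?gt_eqF//.
move=> h; rewrite -(@lee_pmul2l _ r^-1%:E)// muleA -EFinM mulVf ?gt_eqF// mul1e//.
Qed.

Lemma summable_parts S f : (\esum_(x in S) `|f x|%:E < +oo)%E ->
  (\esum_(x in S) (f^\+ x)%:E < +oo)%E /\ (\esum_(x in S) (f^\- x)%:E < +oo)%E.
Proof.
move=> foo; split; apply: le_lt_trans foo; apply: le_esum => x _; rewrite lee_fin.
  by rewrite /funrpos ge_max; apply/andP; split; [exact: ler_norm|exact: normr_ge0].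
by rewrite /funrneg ge_max -normrN; apply/andP; split; [exact: ler_norm|exact: normr_ge0].
Qed.

Lemma rsumD S f g : (\esum_(x in S) `|f x|%:E < +oo)%E -> (\esum_(x in S) `|g x|%:E < +oo)%E ->
  rsum S (fun x => f x + g x) = rsum S f + rsum S g.
Proof.
move=> /summable_parts[fp fn] /summable_parts[gp gn].
have D (a b : T -> R) : (forall x, 0 <= a x) -> (forall x, 0 <= b x) ->
    (\esum_(x in S) (a x + b x)%:E = \esum_(x in S) (a x)%:E + \esum_(x in S) (b x)%:E)%E.
  by move=> a0 b0; rewrite -esumD// => x _; rewrite lee_fin.
have fin (h : T -> R) : (forall x, 0 <= h x) -> (\esum_(x in S) (h x)%:E < +oo)%E ->
    (\esum_(x in S) (h x)%:E)%E \is a fin_num.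
  by move=> h0; rewrite ge0_fin_numE// esum_ge0// => x _; rewrite lee_fin.
rewrite (@rsum_sub _ _ (fun x => f^\+ x + g^\+ x) (fun x => f^\- x + g^\- x)); last 5 first.
- by move=> x; rewrite addr_ge0.
- by move=> x; rewrite addr_ge0.
- by rewrite D// lte_add_pinfty.
- by rewrite D// lte_add_pinfty.
- move=> x; have := congr1 (fun h => h x) (funrposBneg f); have := congr1 (fun h => h x) (funrposBneg g).
  by rewrite !fctE; lra.
by rewrite !D// !fineD ?fin// /rsum; lra.
Qed.

Lemma rsumN S f : rsum S (fun x => - f x) = - rsum S f.
Proof. by rewrite /rsum opprB (_ : (fun x => - f x) = \- f)// funrposN funrnegN. Qed.

(** A divergent part has [fine] equal to 0 both before and after scaling; a negative factor is
    reduced to a positive one by [rsumN]. *)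
Lemma rsumZ S f (r : R) : rsum S (fun x => r * f x) = r * rsum S f.
Proof.
have H (s : R) : 0 <= s -> rsum S (fun x => s * f x) = s * rsum S f.
  move=> s0; rewrite /rsum ge0_funrposM// ge0_funrnegM// !esumZ//.
  have fM (u : \bar R) : fine (s%:E * u) = s * fine u.
    move: s0; rewrite le_eqVlt => /predU1P[<-|s0]; first by rewrite mul0e mul0r.
    by case: u => [u| |] //=; rewrite ?gt0_muley ?gt0_muleNy ?lte_fin// mulr0.
  by rewrite !fM mulrBr.
have [r0|r0] := leP 0 r; first exact: H.
rewrite -[RHS]opprK -mulNr -H ?oppr_ge0 ?ltW// -rsumN; congr rsum.
by apply/funext => x; rewrite mulNr opprK.
Qed.

Lemma csumZ S (F : T -> R[i]) (c : R[i]) : (\esum_(x in S) (normc (F x))%:E < +oo)%E ->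
  csum S (fun x => c * F x) = c * csum S F.
Proof.
move=> Foo; have sR : (\esum_(x in S) `|Re (F x)|%:E < +oo)%E.
  by apply: le_lt_trans Foo; apply: le_esum => x _; rewrite lee_fin normc_Re_le.
have sI : (\esum_(x in S) `|Im (F x)|%:E < +oo)%E.
  by apply: le_lt_trans Foo; apply: le_esum => x _; rewrite lee_fin normc_Im_le.
have Z (h : T -> R) (r : R) : (\esum_(x in S) `|h x|%:E < +oo)%E ->
    (\esum_(x in S) `|r * h x|%:E < +oo)%E.
  move=> hoo; under eq_esum do rewrite normrM; rewrite esumZ//.
  by rewrite lte_mul_pinfty// lee_fin.
apply: complexP; rewrite !ReImE /csum /=.
  transitivity (rsum S (fun x => Re c * Re (F x) + - Im c * Im (F x))).
    by congr rsum; apply/funext => x; rewrite ReImE mulNr.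
  by rewrite rsumD ?rsumZ ?mulNr//; exact: Z.
transitivity (rsum S (fun x => Re c * Im (F x) + Im c * Re (F x))).
  by congr rsum; apply/funext => x; rewrite ReImE.
by rewrite rsumD ?rsumZ//; exact: Z.
Qed.

Lemma csum_ge0 S (a : T -> R) : (forall x, 0 <= a x) ->
  csum S (fun x => (a x)%:C%C) = (fine (\esum_(x in S) (a x)%:E))%:C%C.
Proof.
move=> a0; apply: complexP; rewrite /csum /= /rsum.
  rewrite (_ : _^\+ = a); last by apply/funext => x; exact/max_idPl.
  rewrite (_ : _^\- = fun=> 0); last first.
    by apply/funext => x; apply/max_idPr; rewrite oppr_le0.
  by rewrite (@esum1 _ _ _ (fun=> 0%E))// subr0.
by rewrite !esum1 ?subrr// => x _; rewrite /funrpos /funrneg ?oppr0 maxxx.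
Qed.

Lemma rsum_le S f : (\esum_(x in S) `|f x|%:E < +oo)%E ->
  `|rsum S f| <= fine (\esum_(x in S) `|f x|%:E).
Proof.
move=> foo; have [pf nf] := summable_parts foo.
have fin (h : T -> R) : (forall x, 0 <= h x) -> (\esum_(x in S) (h x)%:E < +oo)%E ->
    (\esum_(x in S) (h x)%:E)%E \is a fin_num.
  by move=> h0; rewrite ge0_fin_numE// esum_ge0// => x _; rewrite lee_fin.
have p0 : 0 <= fine (\esum_(x in S) (f^\+ x)%:E) by rewrite fine_ge0// esum_ge0// => x _; rewrite lee_fin.
have n0 : 0 <= fine (\esum_(x in S) (f^\- x)%:E) by rewrite fine_ge0// esum_ge0// => x _; rewrite lee_fin.
have -> : (\esum_(x in S) `|f x|%:E = \esum_(x in S) (f^\+ x)%:E + \esum_(x in S) (f^\- x)%:E)%E.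
  rewrite -esumD; try by move=> x _; rewrite lee_fin.
  apply: eq_esum => x _; rewrite -EFinD; congr EFin.
  by have := congr1 (fun h => h x) (funrposDneg f); rewrite !fctE /= => ->.
rewrite fineD ?fin// /rsum ler_norml; apply/andP; split; lra.
Qed.

End summable_families.

(** * Fibre sums, brackets and the module action *)

Section brackets.
Context {R : realType} {d : nat} (D : 'M[int]_d).
Local Notation Rd := 'cV[R]_d.
Local Notation leb := (lebesgue_cV R d).
Local Notation haar := (@haar R d).
Local Notation m := (@absdet R d D).
Local Notation torus := (torus R d).
Hypothesis uD : @DR R d D \in unitmx.
Implicit Types (n : int) (F p q : Rd -> R[i]) (z : torus).

Let m0 : 0 < m := absdet_gt0 uD.
Let mn0 n : 0 < m ^ n. Proof. by rewrite exprz_gt0. Qed.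

(** The bracket of [p] and [q] depends only on the product of [q] with the conjugate of [p]. For
    integrable [F] this is the density, with respect to Haar measure, of the image of [F dx] under
    [iota_n]. *)
Definition fiber_sum n F z : R[i] := (m ^ n)%:C%C * csum (fiber D n z) F.

Lemma bracketE n p q : bracket D n p q = fiber_sum n (fun x => (p x)^* * q x).
Proof. by []. Qed.

Lemma ae_fiber_fin n (G : Rd -> R) : measurable_fun setT G -> (forall x, 0 <= G x) ->
  (\int[leb]_x (G x)%:E < +oo)%E ->
  {ae haar, forall z, (\esum_(y in fiber D n z) (G y)%:E < +oo)%E}.
Proof.
move=> mG G0 Goo.
have mGe : measurable_fun setT (fun x => (G x)%:E) by exact/measurable_EFinP.
have G0e x : (0 <= (G x)%:E)%E by rewrite lee_fin.
have mS := measurable_fiber_sum uD n mGe G0e.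
have iS : haar.-integrable setT (fun z => (m ^ n)%:E * \esum_(y in fiber D n z) (G y)%:E)%E.
  apply/integrableP; split; first by apply: emeasurable_funM => //; exact: measurable_cst.
  under eq_integral do rewrite gee0_abs ?mule_ge0 ?lee_fin ?(ltW (mn0 n))// ?esum_ge0//.
  by rewrite -(integral_fiber uD).
have := integrable_ae measurableT iS; apply: filterS => z /(_ I).
have := @esum_ge0 _ _ (fiber D n z) (fun y => (G y)%:E) (fun y _ => G0e y).
case: (esum _ _) => [r| |] //= _; first by rewrite ltry.
by rewrite gt0_muley ?lte_fin.
Qed.

(** [fine] alters the fibre sum only where it is infinite, on a null set; the result is a real
    integrand to which linearity applies. *)
Lemma fiber_real n (G : Rd -> R) : measurable_fun setT G -> (forall x, 0 <= G x) ->
  (\int[leb]_x (G x)%:E < +oo)%E ->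
  let a z := m ^ n * fine (\esum_(y in fiber D n z) (G y)%:E) in
  [/\ measurable_fun setT a, haar.-integrable setT (EFin \o a) &
      (\int[haar]_z (a z)%:E = \int[leb]_x (G x)%:E)%E].
Proof.
move=> mG G0 Goo a.
have mGe : measurable_fun setT (fun x => (G x)%:E) by exact/measurable_EFinP.
have G0e x : (0 <= (G x)%:E)%E by rewrite lee_fin.
have mS := measurable_fiber_sum uD n mGe G0e.
have S0 z : (0 <= \esum_(y in fiber D n z) (G y)%:E)%E by exact: esum_ge0.
have ma : measurable_fun setT a.
  by apply: measurable_funM; [exact: measurable_cst|apply: (measurableT_comp _ mS); exact: fine_measurable].
have a0 z : 0 <= a z by rewrite mulr_ge0 ?(ltW (mn0 n))// fine_ge0.
have E : (\int[haar]_z (a z)%:E = \int[leb]_x (G x)%:E)%E.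
  rewrite (integral_fiber uD n mGe G0e); apply: ge0_ae_eq_integral => //.
  - exact/measurable_EFinP.
  - by apply: emeasurable_funM => //; exact: measurable_cst.
  - by move=> z _; rewrite lee_fin.
  - by move=> z _; rewrite mule_ge0// lee_fin ltW.
  - apply: filterS (ae_fiber_fin n mG G0 Goo) => z zoo _.
    by rewrite /a EFinM fineK// ge0_fin_numE.
split => //; apply/integrableP; split; first exact/measurable_EFinP.
by under eq_integral do rewrite /= ger0_norm//; rewrite E.
Qed.

Lemma ae_fiber_summable n F : cintegrable leb F ->
  {ae haar, forall z, (\esum_(y in fiber D n z) (normc (F y))%:E < +oo)%E}.
Proof.
move=> /cintegrableP[mF Foo]; exact: (ae_fiber_fin n (measurable_normc mF) (fun x => normc_ge0 (F x)) Foo).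
Qed.

Lemma fiber_rsum n (f : Rd -> R) : leb.-integrable setT (EFin \o f) ->
  haar.-integrable setT (EFin \o (fun z => m ^ n * rsum (fiber D n z) f)) /\
  Rintegral haar setT (fun z => m ^ n * rsum (fiber D n z) f) = Rintegral leb setT f.
Proof.
move=> If; have Ip := integrable_funrpos measurableT If.
have In := integrable_funrneg measurableT If.
have fin (g : Rd -> R) : (forall x, 0 <= g x) -> leb.-integrable setT (EFin \o g) ->
    measurable_fun setT g /\ (\int[leb]_x (g x)%:E < +oo)%E.
  move=> g0 /integrableP[/measurable_EFinP mg]; split => //.
  by move: b; under eq_integral do rewrite /= ger0_norm//.
have [mp pfin] := fin _ (funrpos_ge0 f) Ip; have [mn nfin] := fin _ (funrneg_ge0 f) In.
have [_ Ip' Ep] := fiber_real n mp (funrpos_ge0 f) pfin.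
have [_ In' En] := fiber_real n mn (funrneg_ge0 f) nfin.
rewrite (_ : (fun z => _) = (fun z => m ^ n * fine (\esum_(y in fiber D n z) (f^\+ y)%:E) -
   m ^ n * fine (\esum_(y in fiber D n z) (f^\- y)%:E))); last first.
  by apply/funext => z; rewrite /rsum mulrBr.
split; first exact: (integrableB measurableT Ip' In').
rewrite RintegralB// /Rintegral Ep En -[in RHS](funrposBneg f).
by rewrite -[RHS]/(Rintegral leb setT (fun x => f^\+ x - f^\- x)) RintegralB.
Qed.

Let Re_fiber_sum n F z : Re (fiber_sum n F z) = m ^ n * rsum (fiber D n z) (fun x => Re (F x)).
Proof. by rewrite /fiber_sum cReM /= mul0r subr0. Qed.

Let Im_fiber_sum n F z : Im (fiber_sum n F z) = m ^ n * rsum (fiber D n z) (fun x => Im (F x)).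
Proof. by rewrite /fiber_sum cImM /= mul0r addr0. Qed.

Lemma cintegrable_fiber_sum n F : cintegrable leb F -> cintegrable haar (fiber_sum n F).
Proof.
move=> [IR II]; split.
  have := (fiber_rsum n IR).1; congr integrable.
  by apply/funext => z; rewrite Re_fiber_sum.
have := (fiber_rsum n II).1; congr integrable.
by apply/funext => z; rewrite Im_fiber_sum.
Qed.

Lemma cintegral_fiber_sum n F : cintegrable leb F ->
  cintegral haar (fiber_sum n F) = cintegral leb F.
Proof.
move=> [IR II]; apply: complexP => /=.
  rewrite -(fiber_rsum n IR).2; apply: eq_Rintegral => z _; exact: Re_fiber_sum.
rewrite -(fiber_rsum n II).2; apply: eq_Rintegral => z _; exact: Im_fiber_sum.
Qed.

Lemma fiber_iota n z y : fiber D n z y -> iota_n D n y = z. Proof. by []. Qed.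

Lemma eq_csum (T : choiceType) (S : set T) (f g : T -> R[i]) : (forall x, S x -> f x = g x) ->
  csum S f = csum S g.
Proof.
move=> fg; rewrite /csum /rsum; congr ((fine _ - fine _) +i* (fine _ - fine _))%C;
  by apply: eq_esum => x Sx; rewrite /funrpos /funrneg fg.
Qed.

(** A function of [iota_n] is constant on the fibre and leaves the sum. Summability is what makes
    [csum] commute with a complex factor. *)
Lemma fiber_sumM n F (u : torus -> R[i]) z : (\esum_(y in fiber D n z) (normc (F y))%:E < +oo)%E ->
  fiber_sum n (fun x => u (iota_n D n x) * F x) z = u z * fiber_sum n F z.
Proof.
move=> Foo; rewrite /fiber_sum [RHS]mulrCA -(csumZ (u z) Foo); congr (_ * _).
by apply: eq_csum => x /fiber_iota ->.
Qed.

Lemma cmeasurable_iota n (u : torus -> R[i]) : cmeasurable u -> cmeasurable (u \o iota_n D n).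
Proof. by move=> mu; apply: cmeasurable_comp => //; exact: measurable_iota. Qed.

Lemma cintegral_fiber_sumM n F (u : torus -> R[i]) : cintegrable leb F -> cmeasurable u ->
  cintegrable leb (fun x => u (iota_n D n x) * F x) ->
  cintegrable haar (fun z => u z * fiber_sum n F z) /\
  cintegral leb (fun x => u (iota_n D n x) * F x) = cintegral haar (fun z => u z * fiber_sum n F z).
Proof.
move=> IF mu IuF; have ae : {ae haar, forall z,
    fiber_sum n (fun x => u (iota_n D n x) * F x) z = u z * fiber_sum n F z}.
  by apply: filterS (ae_fiber_summable n IF) => z; exact: fiber_sumM.
have mR : cmeasurable (fun z => u z * fiber_sum n F z).
  by apply: cmeasurableM => //; exact: (cintegrable_cmeasurable (cintegrable_fiber_sum n IF)).
have IL := cintegrable_fiber_sum n IuF.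
split; first exact: ae_eq_cintegrable IL.
rewrite -(cintegral_fiber_sum n IuF); apply: ae_eq_cintegral => //.
exact: (cintegrable_cmeasurable IL).
Qed.

Lemma cmeasurable_circ n p (u : torus -> R[i]) : cmeasurable p -> cmeasurable u ->
  cmeasurable (circ D n p u).
Proof. by move=> mp mu; apply: cmeasurableM => //; exact: cmeasurable_iota. Qed.

(** [q |-> [[p, q]]_n] is the adjoint of [u |-> p o_n u]. With a character for [u], an inner product
    appears as a Fourier coefficient of the bracket. *)
Lemma ip_circ n p q (u : torus -> R[i]) : L2 leb p -> L2 leb q -> cmeasurable u ->
  L2 leb (circ D n p u) ->
  ip leb (circ D n p u) q = cintegral haar (fun z => (u z)^* * bracket D n p q z).
Proof.
move=> Lp Lq mu Lpu; rewrite bracketE.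
have E : (fun x => (circ D n p u x)^* * q x) =
    (fun x => (u (iota_n D n x))^* * ((p x)^* * q x)).
  by apply/funext => x; rewrite /circ; apply: complexP; rewrite !ReImE; ring.
have IuF := cintegrable_ip Lpu Lq; rewrite E in IuF.
rewrite /ip E; exact: (cintegral_fiber_sumM (cintegrable_ip Lp Lq) (cmeasurable_conj mu) IuF).2.
Qed.

Lemma bracket_selfE n p z :
  bracket D n p p z = (m ^ n * fine (\esum_(y in fiber D n z) (normc (p y) ^+ 2)%:E))%:C%C.
Proof.
rewrite bracketE /fiber_sum (_ : (fun x => _) = (fun x => (normc (p x) ^+ 2)%:C%C)).
  by rewrite csum_ge0 ?rmorphM// => x; exact: sqr_ge0.
by apply/funext => x; rewrite conj_mul_self.
Qed.

Lemma ae_sqr_summable n p : L2 leb p ->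
  {ae haar, forall z, (\esum_(y in fiber D n z) (normc (p y) ^+ 2)%:E < +oo)%E}.
Proof.
move=> [mp poo]; exact: (ae_fiber_fin n (measurable_sqr_normc mp) (fun x => sqr_ge0 (normc (p x))) poo).
Qed.

Lemma bracket_sq1 n p : L2 leb p -> {ae haar, forall z, bracket D n p p z = 1} ->
  {ae haar, forall z, bracket_sq D n p z = 1%E}.
Proof.
move=> Lp; apply: filterS2 (ae_sqr_summable n Lp) => z zoo; rewrite bracket_selfE => /complexI.
rewrite /bracket_sq -[X in (_ * X)%E]fineK; first by rewrite -EFinM => ->.
by rewrite ge0_fin_numE// esum_ge0// => x _; rewrite lee_fin sqr_ge0.
Qed.

Section unit_generator.
Variables (n : int) (p : Rd -> R[i]).
Hypothesis Lp : L2 leb p.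
Hypothesis p1 : {ae haar, forall z, bracket D n p p z = 1}.

(** On the fibre over [z] the factor [|u z|^2] is constant, and what remains is the bracket of [p]
    with itself, equal to 1. *)
Lemma N2_circ (u : torus -> R[i]) : cmeasurable u -> N2 leb (circ D n p u) = N2 haar u.
Proof.
move=> mu; have mpu := cmeasurable_circ n Lp.1 mu.
rewrite /N2 (integral_fiber uD n); last 2 first.
- exact/measurable_EFinP/measurable_sqr_normc.
- by move=> x; rewrite lee_fin sqr_ge0.
apply: ge0_ae_eq_integral => //.
- apply: emeasurable_funM; first exact: measurable_cst.
  apply: measurable_fiber_sum => //; first exact/measurable_EFinP/measurable_sqr_normc.
  by move=> x; rewrite lee_fin sqr_ge0.
- exact/measurable_EFinP/measurable_sqr_normc.
- move=> z _; rewrite mule_ge0 ?lee_fin ?(ltW (mn0 n))// esum_ge0// => x _.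
  by rewrite lee_fin sqr_ge0.
- by move=> z _; rewrite lee_fin sqr_ge0.
apply: filterS (bracket_sq1 Lp p1) => z; rewrite /bracket_sq => z1 _.
transitivity ((m ^ n)%:E * \esum_(y in fiber D n z) (normc (u z) ^+ 2 * normc (p y) ^+ 2)%:E)%E.
  congr (_ * _)%E; apply: eq_esum => y /fiber_iota yz.
  by rewrite /circ yz Normc.normcM exprMn mulrC.
rewrite esumZ ?sqr_ge0//; last by move=> y; exact: sqr_ge0.
by rewrite muleCA z1 mule1.
Qed.

Lemma L2_circ (u : torus -> R[i]) : L2 haar u -> L2 leb (circ D n p u).
Proof. by move=> [mu uoo]; split; [apply: cmeasurable_circ => //; case: Lp|rewrite N2_circ]. Qed.

Lemma nr_circ (u : torus -> R[i]) : L2 haar u -> nr leb (circ D n p u) = nr haar u.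
Proof. by move=> [mu uoo]; rewrite /nr N2_circ. Qed.

Lemma bracket_L2 q : L2 leb q -> L2 haar (bracket D n p q).
Proof.
move=> Lq; have Ipq := cintegrable_ip Lp Lq.
have mb : cmeasurable (bracket D n p q).
  by rewrite bracketE; apply: cintegrable_cmeasurable; exact: cintegrable_fiber_sum.
have mq2 : measurable_fun setT (fun x => (normc (q x) ^+ 2)%:E).
  by apply/measurable_EFinP/measurable_sqr_normc; case: Lq.
have q20 x : (0 <= (normc (q x) ^+ 2)%:E)%E by rewrite lee_fin sqr_ge0.
have mS : measurable_fun setT (bracket_sq D n q).
  by apply: emeasurable_funM; [exact: measurable_cst|exact: measurable_fiber_sum].
have S0 z : (0 <= bracket_sq D n q z)%E.
  by rewrite /bracket_sq mule_ge0 ?lee_fin ?(ltW (mn0 n))// esum_ge0.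
(* The factor 2 absorbs the separate estimates of the real and imaginary parts of the bracket. *)
split => //; apply: (@le_lt_trans _ _ (2%:E * N2 leb q)%E); last first.
  by rewrite lte_mul_pinfty//; case: Lq.
rewrite [X in (_ * X)%E](integral_fiber uD n mq2 q20) -ge0_integralZl_EFin//; last first.
  by move=> z _; exact: S0.
apply: ae_ge0_le_integral => //.
- by move=> z _; rewrite lee_fin sqr_ge0.
- exact/measurable_EFinP/measurable_sqr_normc.
- by move=> z _; apply: mule_ge0 => //; exact: S0.
- by apply: emeasurable_funM; [exact: measurable_cst|exact: mS].
have := ae_sqr_summable n Lq; have := ae_fiber_summable n Ipq.
apply: filterS3 (bracket_sq1 Lp p1) => z p1z pqoo qoo _.
rewrite -/(bracket_sq D n q z).
pose f y := normc ((p y)^* * q y); pose A := \esum_(y in fiber D n z) (f y)%:E.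
have f0 y : 0 <= f y by exact: normc_ge0.
have A0 : (0 <= A)%E by apply: esum_ge0 => y _; rewrite lee_fin.
pose s := m ^ n * fine A.
have s0 : 0 <= s by rewrite mulr_ge0 ?(ltW (mn0 n))// fine_ge0.
have sA : s%:E = ((m ^ n)%:E * A)%E by rewrite /s EFinM fineK// ge0_fin_numE.
have part (h : Rd -> R) : (forall y, `|h y| <= f y) -> `|m ^ n * rsum (fiber D n z) h| <= s.
  move=> hf; rewrite normrM gtr0_norm// ler_pM2l//.
  have hA : (\esum_(y in fiber D n z) `|h y|%:E <= A)%E by apply: le_esum => y _; rewrite lee_fin.
  rewrite (le_trans (rsum_le (le_lt_trans hA pqoo)))// fine_le//.
    by rewrite ge0_fin_numE ?(le_lt_trans hA)// esum_ge0// => y _; rewrite lee_fin.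
  by rewrite ge0_fin_numE.
(* Cauchy-Schwarz on the fibre without square roots: the square of [s |p y| - |q y|] is nonnegative;
   summed over the fibre, with the bracket of [p] with itself equal to 1, this gives [2 s^2 <= s^2 +
   [[q, q]]_n]. *)
have sq : ((s ^+ 2)%:E <= bracket_sq D n q z)%E.
  have h1 : ((2 * s * s)%:E <= (s ^+ 2)%:E * bracket_sq D n p z + bracket_sq D n q z)%E.
    rewrite EFinM sA muleCA /A -esumZ//; last by rewrite mulr_ge0.
    rewrite /bracket_sq muleCA -muleDr//; last first.
      by rewrite ge0_adde_def// inE ?mule_ge0 ?lee_fin ?sqr_ge0// esum_ge0// => y _; rewrite lee_fin sqr_ge0.
    rewrite lee_pmul2l//; last by rewrite lte_fin.
    rewrite -esumZ; [|by move=> y; exact: sqr_ge0|exact: sqr_ge0].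
    rewrite -esumD; last 2 first.
    - by move=> y _; rewrite lee_fin mulr_ge0// sqr_ge0.
    - by move=> y _; rewrite lee_fin sqr_ge0.
    apply: le_esum => y _; rewrite -EFinD lee_fin /f Normc.normcM normc_conj -subr_ge0.
    by rewrite (_ : _ - _ = (s * normc (p y) - normc (q y)) ^+ 2) ?sqr_ge0//; ring.
  rewrite p1z mule1 in h1; move: h1; case: (bracket_sq D n q z) (S0 z) => [r| |] //= _.
    by rewrite -EFinD !lee_fin expr2; lra.
  by move=> _; rewrite leey.
apply: (@le_trans _ _ (2%:E * (s ^+ 2)%:E)%E); last by rewrite lee_pmul2l.
rewrite -EFinM lee_fin bracketE sqr_normc Re_fiber_sum Im_fiber_sum mulrDl mul1r.
have sqr_le (a : R) : `|a| <= s -> a ^+ 2 <= s ^+ 2.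
  by move=> h; rewrite -real_normK ?num_real// ler_pXn2r ?nnegrE.
by apply: lerD; apply: sqr_le; apply: part => y; [exact: normc_Re_le|exact: normc_Im_le].
Qed.

End unit_generator.
End brackets.

(** * Uniqueness of Fourier coefficients on the torus *)

Section multiplicative_class.
Context {R : realType} {d : measure_display} {T : measurableType d}.
Variable mu : {measure set T -> \bar R}.
Context {I : Type} (E : I -> T -> R[i]) (H : T -> R[i]).
Hypothesis mE : forall i, cmeasurable (E i).
Hypothesis E1 : forall i x, normc (E i x) <= 1.
Hypothesis IH : cintegrable mu H.

(* The bounded functions t such that multiplication by t preserves { f | \int f E_i H = 0 for all i } form
   an algebra closed under bounded pointwise limits, hence the sets whose indicator is such a t form a
   sigma-algebra. *)
Definition bounded_mfun (f : T -> R) := measurable_fun setT f /\ exists M, forall x, `|f x| <= M.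

Definition annihilates (f : T -> R) := bounded_mfun f /\
  forall i, cintegral mu (fun x => (f x)%:C%C * (E i x * H x)) = 0.

Definition multiplier (t : T -> R) := bounded_mfun t /\
  forall f, annihilates f -> annihilates (fun x => f x * t x).

Lemma bounded_mfunM f g : bounded_mfun f -> bounded_mfun g -> bounded_mfun (fun x => f x * g x).
Proof.
move=> [mf [M fM]] [mg [N gN]]; split; first exact: measurable_funM.
by exists (M * N) => x; rewrite normrM ler_pM.
Qed.

Lemma bounded_mfun_lin a f g : bounded_mfun f -> bounded_mfun g ->
  bounded_mfun (fun x => a * f x + g x).
Proof.
move=> [mf [M fM]] [mg [N gN]]; split.
  by apply: measurable_funD => //; apply: measurable_funM => //; exact: measurable_cst.
exists (`|a| * M + N) => x; rewrite (le_trans (ler_normD _ _))// lerD// normrM ler_wpM2l//.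
Qed.

Lemma cintegrable_bounded f i : bounded_mfun f ->
  cintegrable mu (fun x => (f x)%:C%C * (E i x * H x)).
Proof.
move=> [mf [M fM]]; have mH := cintegrable_cmeasurable IH.
apply: (@le_cintegrable _ _ _ _ _ (fun x => `|M| * normc (H x))).
- by apply: cmeasurableM; [exact: cmeasurable_real|exact: cmeasurableM].
- have := integrableZl measurableT `|M| (cintegrable_normc IH).
  by congr integrable; apply/funext => x; rewrite /= EFinM.
- move=> x; rewrite !Normc.normcM /= expr0n addr0 sqrtr_sqr.
  apply: ler_pM => //; first by rewrite mulr_ge0 ?normc_ge0.
    by rewrite (le_trans (fM x))// ler_norm.
  by rewrite ler_piMl ?normc_ge0.
Qed.

Lemma annihilates_lin a f g : annihilates f -> annihilates g ->
  annihilates (fun x => a * f x + g x).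
Proof.
move=> [bf f0] [bg g0]; split; first exact: bounded_mfun_lin.
move=> i; rewrite (_ : (fun x => _) = (fun x => a%:C%C * ((f x)%:C%C * (E i x * H x)) +
    (g x)%:C%C * (E i x * H x))); last first.
  by apply/funext => x; rewrite rmorphD rmorphM /=; ring.
rewrite cintegralD; [|by apply: cintegrableZ; exact: cintegrable_bounded|exact: cintegrable_bounded].
by rewrite cintegralZ ?f0 ?g0 ?mulr0 ?addr0//; exact: cintegrable_bounded.
Qed.

Lemma cvg_Rintegral (u : nat -> T -> R) (v g : T -> R) :
  (forall n, measurable_fun setT (u n)) -> mu.-integrable setT (EFin \o g) ->
  (forall n x, `|u n x| <= g x) -> (forall x, u n x @[n --> \oo] --> v x) ->
  Rintegral mu setT (u n) @[n --> \oo] --> Rintegral mu setT v.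
Proof.
move=> mu_ Ig ug uv.
have mv : measurable_fun setT v by apply: (@measurable_fun_cvg _ _ _ setT u) => // x _; exact: uv.
have Iu n : mu.-integrable setT (EFin \o u n).
  apply: le_integrable Ig => //; first exact/measurable_EFinP.
  by move=> x _ /=; rewrite lee_fin (le_trans (ug n x))// ler_norm.
have vg x : `|v x| <= g x.
  by apply: (cvgr_to_le (cvg_norm (uv x))); apply: nearW => n; exact: ug.
have Iv : mu.-integrable setT (EFin \o v).
  apply: le_integrable Ig => //; first exact/measurable_EFinP.
  by move=> x _ /=; rewrite lee_fin (le_trans (vg x))// ler_norm.
have dc := @dominated_cvg _ _ _ mu setT measurableT (fun n => EFin \o u n) (EFin \o v) (EFin \o g).
have {}dc : (\int[mu]_x (u n x)%:E @[n --> \oo] --> \int[mu]_x (v x)%:E)%E.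
  apply: dc => //.
  - by move=> n; exact/measurable_EFinP.
  - by move=> x _; apply: cvg_EFin; [exact: nearW|exact: uv].
  - by move=> n x _ /=; rewrite lee_fin.
apply: fine_cvg; rewrite /Rintegral fineK//.
by apply: integrable_fin_num.
Qed.

Lemma annihilates_lim (u : nat -> T -> R) v M : (forall n, annihilates (u n)) ->
  (forall n x, `|u n x| <= M) -> (forall x, u n x @[n --> \oo] --> v x) -> annihilates v.
Proof.
move=> Ku uM uv.
have mv : measurable_fun setT v.
  by apply: (@measurable_fun_cvg _ _ _ setT u) => [n|x _]; [exact: (Ku n).1.1|exact: uv].
split.
  split => //; exists M => x.
  by apply: (cvgr_to_le (cvg_norm (uv x))); apply: nearW => n; exact: uM.
move=> i; pose G x := E i x * H x.
have mH := cintegrable_cmeasurable IH.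
have IG : cintegrable mu G.
  have b1 : bounded_mfun (fun=> 1).
    by split; [exact: measurable_cst|exists 1 => x; rewrite normr1].
  by apply: eq_cintegrable (cintegrable_bounded i b1) => x; rewrite rmorph1 mul1r.
have Ig : mu.-integrable setT (EFin \o (fun x => `|M| * normc (G x))).
  have := integrableZl measurableT `|M| (cintegrable_normc IG).
  by congr integrable; apply/funext => x; rewrite /= EFinM.
have key (r : T -> R) : measurable_fun setT r -> (forall x, `|r x| <= normc (G x)) ->
    (forall n, Rintegral mu setT (fun x => u n x * r x) = 0) ->
    Rintegral mu setT (fun x => v x * r x) = 0.
  move=> mr rG u0.
  have c : Rintegral mu setT (fun x => u n x * r x) @[n --> \oo] --> Rintegral mu setT (fun x => v x * r x).
    apply: (@cvg_Rintegral _ _ _ _ Ig).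
    - by move=> n; apply: measurable_funM => //; exact: (Ku n).1.1.
    - by move=> n x; rewrite normrM ler_pM// (le_trans (uM n x))// ler_norm.
    - by move=> x; apply: cvgM => //; exact: cvg_cst.
  move: c; rewrite (_ : (fun n => _) = (fun=> 0)); last by apply/funext.
  by move=> c; apply/esym; apply: (cvg_unique _ (cvg_cst (0 : R)) c).
have [mGR mGI] := cintegrable_cmeasurable IG.
apply: complexP => /=.
  under eq_Rintegral do rewrite cReM /= mul0r subr0.
  apply: (key (fun x => Re (G x))) => // [x|n]; first exact: normc_Re_le.
  have := congr1 (@complex.Re R) ((Ku n).2 i); rewrite /= => <-.
  by apply: eq_Rintegral => x _; rewrite [RHS]cReM /= mul0r subr0.
under eq_Rintegral do rewrite cImM /= mul0r addr0.
apply: (key (fun x => Im (G x))) => // [x|n]; first exact: normc_Im_le.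
have := congr1 (@complex.Im R) ((Ku n).2 i); rewrite /= => <-.
by apply: eq_Rintegral => x _; rewrite [RHS]cImM /= mul0r addr0.
Qed.

Lemma multiplier_lim (u : nat -> T -> R) v M : (forall n, multiplier (u n)) ->
  (forall n x, `|u n x| <= M) -> (forall x, u n x @[n --> \oo] --> v x) -> multiplier v.
Proof.
move=> mu_ uM uv; split.
  split; first by apply: (@measurable_fun_cvg _ _ _ setT u) => [n|x _]; [exact: (mu_ n).1.1|exact: uv].
  by exists M => x; apply: (cvgr_to_le (cvg_norm (uv x))); apply: nearW => n; exact: uM.
move=> f Kf; have [[_ [N fN]] _] := Kf.
apply: (@annihilates_lim (fun n x => f x * u n x) _ (N * M)).
- by move=> n; exact: (mu_ n).2.
- by move=> n x; rewrite normrM ler_pM.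
- by move=> x; apply: cvgM => //; exact: cvg_cst.
Qed.

Lemma multiplier_cst c : multiplier (fun=> c).
Proof.
split; first by split; [exact: measurable_cst|exists `|c|].
move=> f Kf; have := annihilates_lin (c - 1) Kf Kf; congr annihilates.
by apply/funext => x; ring.
Qed.

Lemma multiplierM s t : multiplier s -> multiplier t -> multiplier (fun x => s x * t x).
Proof.
move=> [bs Ks] [bt Kt]; split; first exact: bounded_mfunM.
by move=> f Kf; have := Kt _ (Ks _ Kf); under eq_fun do rewrite -mulrA.
Qed.

Lemma multiplier_lin a s t : multiplier s -> multiplier t -> multiplier (fun x => a * s x + t x).
Proof.
move=> [bs Ks] [bt Kt]; split; first exact: bounded_mfun_lin.
move=> f Kf; have := annihilates_lin a (Ks _ Kf) (Kt _ Kf); congr annihilates.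
by apply/funext => x; ring.
Qed.

Lemma multiplierX t n : multiplier t -> multiplier (fun x => t x ^+ n).
Proof.
move=> mt; elim: n => [|n IHn]; first exact: multiplier_cst.
by under eq_fun do rewrite exprS; exact: multiplierM.
Qed.

(** The classical approximation of the absolute value in the proof of the Stone-Weierstrass theorem.
    Each iterate is a polynomial in [y], so it sends multipliers to multipliers. *)
Fixpoint sqrt_iter (y : R) n : R :=
  if n is n'.+1 then sqrt_iter y n' + (y ^+ 2 - sqrt_iter y n' ^+ 2) / 2 else 0.

(* The iteration converges to |y| from below, the error being multiplied by at most 1 - |y|/2 at each step. *)
Lemma sqrt_iterP y n : `|y| <= 1 ->
  0 <= sqrt_iter y n <= `|y| /\ `|y| - sqrt_iter y n <= `|y| * (1 - `|y| / 2) ^+ n.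
Proof.
have -> : sqrt_iter y n = sqrt_iter `|y| n.
  by elim: n => //= n ->; rewrite real_normK ?num_real.
have := normr_ge0 y; move: `|y| => {}y y0 y1; elim: n => [|n [/andP[r0 ry] IHn]] /=.
  by rewrite lexx y0 subr0 expr0 mulr1.
move: (sqrt_iter y n) r0 ry IHn => r r0 ry IHn.
have h : y - (r + (y ^+ 2 - r ^+ 2) / 2) = (y - r) * (1 - (y + r) / 2) by field.
split.
  apply/andP; split; last by rewrite -subr_ge0 h mulr_ge0; lra.
  by rewrite addr_ge0// divr_ge0// subr_ge0 ler_pXn2r.
rewrite h [(1 - y / 2) ^+ n.+1]exprS mulrCA; apply: (@le_trans _ _ ((y - r) * (1 - y / 2))).
  by apply: ler_wpM2l; lra.
by rewrite mulrC; apply: ler_wpM2l => //; lra.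
Qed.

Lemma multiplier_norm t : multiplier t -> (forall x, `|t x| <= 1) -> multiplier (fun x => `|t x|).
Proof.
move=> mt t1; apply: (@multiplier_lim (fun n x => sqrt_iter (t x) n) _ 1).
- elim=> [|n IHn] /=; first exact: multiplier_cst.
  have h := multiplier_lin (- 2^-1) (multiplierX 2 IHn) (multiplier_lin 2^-1 (multiplierX 2 mt) IHn).
  by move: h; congr multiplier; apply/funext => x; ring.
- by move=> n x; have [/andP[r0 rt] _] := sqrt_iterP n (t1 x); rewrite ger0_norm// (le_trans rt).
- move=> x; have [t0|t0] := eqVneq (t x) 0.
    rewrite t0 normr0; apply: (@cvg_trans _ ((fun=> 0 : R) @ \oo)); last exact: cvg_cst.
    apply: near_eq_cvg; apply: nearW => n; apply/esym.
    have [] := @sqrt_iterP 0 n; rewrite ?normr0//.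
    by move=> /andP[h1 h2] _; apply/eqP; rewrite eq_le h1 h2.
  have tp : 0 < `|t x| by rewrite normr_gt0.
  rewrite -[X in _ --> X](subr0 `|t x|).
  rewrite (_ : sqrt_iter (t x) = (fun n => `|t x| - (`|t x| - sqrt_iter (t x) n))); last first.
    by apply/funext => n; rewrite opprB addrC subrK.
  apply: cvgB; first exact: cvg_cst.
  apply: (@squeeze_cvgr _ _ _ _ (fun=> 0) (fun n => `|t x| * (1 - `|t x| / 2) ^+ n)).
  + apply: nearW => n; have [/andP[_ r1] r2] := sqrt_iterP n (t1 x).
    by rewrite subr_ge0 r1.
  + exact: cvg_cst.
  + apply: cvg_geometric; rewrite ger0_norm; last by have := t1 x; lra.
    lra.
Qed.

Definition multiplier_set (A : set T) := measurable A /\ multiplier (\1_A : T -> R).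

(** The positive part [p] of [t] is a multiplier with values in [0, 1], and [1 - (1 - p) ^+ n] tends
    to the indicator of the set where [p] is positive. *)
Lemma multiplier_set_gt0 t : multiplier t -> (forall x, `|t x| <= 1) ->
  multiplier_set [set x | 0 < t x].
Proof.
move=> mt t1; have mA : measurable [set x | 0 < t x].
  have := mt.1.1 measurableT `]0, +oo[%classic (measurable_itv _); rewrite setTI.
  by congr measurable; apply/seteqP; split => x /=; rewrite in_itv /= andbT.
split => //.
pose p x := 2^-1 * `|t x| + 2^-1 * t x.
have mp : multiplier p.
  apply: multiplier_lin; first exact: multiplier_norm.
  by have := multiplier_lin 2^-1 mt (multiplier_cst 0); under eq_fun do rewrite addr0.
have pE x : p x = if 0 < t x then t x else 0.
  by rewrite /p; case: ltP => tx; [rewrite gtr0_norm//; field|rewrite ler0_norm//; field].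
have p01 x : 0 <= p x <= 1.
  by rewrite pE; case: ifPn => tx; rewrite ?lexx ?ler01// (ltW tx) (le_trans (ler_norm _)).
apply: (@multiplier_lim (fun n x => -1 * (1 - p x) ^+ n + 1) _ 1).
- move=> n; apply: multiplier_lin; last exact: multiplier_cst.
  apply: multiplierX; have := multiplier_lin (-1) mp (multiplier_cst 1); congr multiplier.
  by apply/funext => x; ring.
- move=> n x; have /andP[p0 p1] := p01 x.
  have h0 : 0 <= (1 - p x) ^+ n by rewrite exprn_ge0// subr_ge0.
  have h1 : (1 - p x) ^+ n <= 1 by rewrite exprn_ile1 ?subr_ge0// lerBlDr lerDl.
  by rewrite ger0_norm; lra.
- move=> x; have /andP[p0 p1] := p01 x.
  rewrite indicE; have [tx|tx] := boolP (0 < t x); last first.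
    rewrite memNset; last by rewrite /=; exact/negP.
    apply: (@cvg_trans _ ((fun=> 0 : R) @ \oo)); last exact: cvg_cst.
    by apply: near_eq_cvg; apply: nearW => n; rewrite pE (negbTE tx) subr0 expr1n; ring.
  rewrite mem_set//= -[X in _ --> X]add0r; apply: cvgD; last exact: cvg_cst.
  rewrite -(mulr0 (-1)); apply: cvgM; first exact: cvg_cst.
  apply: cvg_expr; rewrite ger0_norm ?subr_ge0// pE tx ltrBlDr ltrDl//.
Qed.

Lemma multiplier_setC A : multiplier_set A -> multiplier_set (~` A).
Proof.
move=> [mA KA]; split; first exact: measurableC.
have := multiplier_lin (-1) KA (multiplier_cst 1); congr multiplier.
by apply/funext => x; rewrite !indicE in_setC; case: (x \in A) => /=; ring.
Qed.

Lemma multiplier_setT : multiplier_set setT.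
Proof.
split => //; have := multiplier_cst 1; congr multiplier.
by apply/funext => x; rewrite indicE in_setT.
Qed.

Lemma multiplier_setI A B : multiplier_set A -> multiplier_set B -> multiplier_set (A `&` B).
Proof.
move=> [mA KA] [mB KB]; split; first exact: measurableI.
have := multiplierM KA KB; congr multiplier.
by apply/funext => x; rewrite !indicE in_setI; case: (x \in A) (x \in B) => [] [] /=; ring.
Qed.

Lemma multiplier_setU A B : multiplier_set A -> multiplier_set B -> multiplier_set (A `|` B).
Proof.
by move=> KA KB; rewrite -[_ `|` _]setCK setCU; apply/multiplier_setC/multiplier_setI; exact: multiplier_setC.
Qed.

Lemma multiplier_bigcup (A : nat -> set T) : (forall n, multiplier_set (A n)) ->
  multiplier_set (\bigcup_n A n).
Proof.
move=> KA; pose B n := \big[setU/set0]_(i < n) A i.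
have KB n : multiplier_set (B n).
  rewrite /B; elim: n => [|n IHn]; last by rewrite big_ord_recr /=; exact: multiplier_setU.
  by rewrite big_ord0 -setCT; apply: multiplier_setC; exact: multiplier_setT.
split; first by apply: bigcupT_measurable => n; exact: (KA n).1.
apply: (@multiplier_lim (fun n => \1_(B n)) _ 1) => [n|n x|x].
- exact: (KB n).2.
- by rewrite indicE; case: (_ \in _) => /=; rewrite ?normr0 ?normr1.
- rewrite indicE; have [[n _ An]|nA] := pselect ((\bigcup_n A n) x).
    rewrite mem_set; last by exists n.
    apply: (@cvg_trans _ ((fun=> 1 : R) @ \oo)); last exact: cvg_cst.
    apply: near_eq_cvg; exists n.+1 => // k /= nk.
    rewrite indicE mem_set// /B -bigcup_mkord; exists n => //.
  rewrite memNset//; apply: (@cvg_trans _ ((fun=> 0 : R) @ \oo)); last exact: cvg_cst.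
  apply: near_eq_cvg; apply: nearW => k; rewrite indicE memNset//.
  by rewrite /B -bigcup_mkord => -[j _ Aj]; apply: nA; exists j.
Qed.

Lemma sigma_algebra_multiplier_set : sigma_algebra setT multiplier_set.
Proof.
split; first by rewrite -setCT; apply: multiplier_setC; exact: multiplier_setT.
  by move=> A KA; rewrite setTD; exact: multiplier_setC.
exact: multiplier_bigcup.
Qed.

(** Applying the multiplier [\1_A] to the constant 1 and testing against the trivial character shows
    that [H] has integral 0 over every measurable [A]. *)
Lemma ae_eq0_multiplier (i0 : I) : E i0 = (fun=> 1) -> annihilates (fun=> 1) ->
  (forall A, measurable A -> multiplier_set A) -> {ae mu, forall x, H x = 0}.
Proof.
move=> Ei0 K1 all_mult.
have key A : measurable A -> cintegral mu (fun x => (\1_A x)%:C%C * H x) = 0.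
  move=> mA; have [_ /(_ _ K1) [_ /(_ i0) <-]] := (all_mult _ mA).2.
  by congr cintegral; apply/funext => x; rewrite Ei0 !mul1r.
have part (r : T -> R) : mu.-integrable setT (EFin \o r) ->
    (forall A, measurable A -> Rintegral mu setT (fun x => \1_A x * r x) = 0) ->
    {ae mu, forall x, r x = 0}.
  move=> Ir r0; have : ae_eq mu setT (EFin \o r) (cst 0%E).
    apply: (integral_ae_eq measurableT Ir); first exact: measurable_cst.
    move=> A _ mA; rewrite integral0 integral_mkcond.
    have E' : ((EFin \o r) \_ A = fun x => (\1_A x * r x)%:E)%E.
      by apply/funext => x; rewrite patchE indicE; case: (x \in A); rewrite /= ?mul1r ?mul0r.
    rewrite E' -[LHS]fineK; first by congr EFin; exact: r0.
    apply: integrable_fin_num => //; rewrite -E'.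
    by apply/(integrable_mkcond _ mA); exact: (integrableS measurableT mA (@subsetT _ A) Ir).
  by apply: filterS => x /= /(_ Logic.I) [].
have [IR II] := IH.
have hR : {ae mu, forall x, Re (H x) = 0}.
  apply: part => // A mA; have := congr1 (@complex.Re R) (key A mA); rewrite /= => <-.
  by apply: eq_Rintegral => x _; rewrite [RHS]cReM /= mul0r subr0.
have hI : {ae mu, forall x, Im (H x) = 0}.
  apply: part => // A mA; have := congr1 (@complex.Im R) (key A mA); rewrite /= => <-.
  by apply: eq_Rintegral => x _; rewrite [RHS]cImM /= mul0r addr0.
by apply: filterS2 hR hI => x h1 h2; exact: complexP.
Qed.

End multiplicative_class.

(** * Characters of the torus *)

Section characters.
Context {R : realType}.

Lemma expiD (s t : R) : expi (s + t) = expi s * expi t.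
Proof. by apply: complexP; rewrite ?cReM ?cImM /= ?cosD ?sinD //; ring. Qed.

Lemma expi0 : expi (0 : R) = 1.
Proof. by rewrite /expi cos0 sin0. Qed.

Lemma expiN (t : R) : expi (- t) = (expi t)^*.
Proof. by apply: complexP; rewrite ?cRe_conj ?cIm_conj /= ?cosN ?sinN. Qed.

Lemma normc_expi (t : R) : normc (expi t) = 1.
Proof. by rewrite /= cos2Dsin2 sqrtr1. Qed.

Lemma expi_pi : expi (pi : R) = -1.
Proof. by rewrite /expi cospi sinpi; apply: complexP; rewrite /= ?oppr0. Qed.

Lemma expi_2pi_int (k : int) : expi (2 * pi * k%:~R : R) = 1.
Proof.
have e2 : expi (2 * pi : R) = 1 by rewrite mulr_natl mulr2n expiD expi_pi mulrNN mulr1.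
have eN (n : nat) : expi (2 * pi * n%:R : R) = 1.
  elim: n => [|n IH]; first by rewrite mulr0 expi0.
  have -> : n.+1%:R = n%:R + 1 :> R by rewrite natr1.
  rewrite [X in expi X]mulrDr mulr1.
  by rewrite expiD IH mul1r.
case: k => n; first exact: eN.
by rewrite NegzE mulrNz mulrN expiN eN; apply: complexP; rewrite ?cRe_conj ?cIm_conj /= ?oppr0.
Qed.

Context {d : nat}.
Local Notation Rd := 'cV[R]_d.
Local Notation Zd := 'cV[int]_d.

Lemma pairingC (x y : Rd) : pairing x y = pairing y x.
Proof. by rewrite /pairing; congr (expi (_ * _)); apply: eq_bigr => i _; rewrite mulrC. Qed.

Lemma pairingDr (x y z : Rd) : pairing x (y + z) = pairing x y * pairing x z.
Proof.
rewrite /pairing -expiD -mulrDr -big_split; congr (expi (_ * _)).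
by apply: eq_bigr => i _; rewrite mxE mulrDr.
Qed.

Lemma pairingDl (x y z : Rd) : pairing (x + y) z = pairing x z * pairing y z.
Proof. by rewrite pairingC pairingDr !(pairingC z). Qed.

Lemma pairing0l (x : Rd) : pairing 0 x = 1.
Proof. by rewrite /pairing big1 ?mulr0 ?expi0// => i _; rewrite mxE mul0r. Qed.

Lemma pairingNl (x y : Rd) : pairing (- x) y = (pairing x y)^*.
Proof.
rewrite /pairing -expiN -mulrN -sumrN; congr (expi (_ * _)).
by apply: eq_bigr => i _; rewrite mxE mulNr.
Qed.

Lemma normc_pairing (x y : Rd) : normc (pairing x y) = 1.
Proof. exact: normc_expi. Qed.

Lemma pairing_mulmx (A : 'M[R]_d) (x y : Rd) : pairing (A *m x) y = pairing x (A^T *m y).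
Proof.
have dotE (u v : Rd) : \sum_(i < d) u i ord0 * v i ord0 = (u^T *m v) ord0 ord0.
  by rewrite mxE; apply: eq_bigr => i _; rewrite mxE.
by rewrite /pairing !dotE trmx_mul mulmxA.
Qed.

Lemma pairing_zvec (k l : Zd) : pairing (zvec k) (zvec l) = 1 :> R[i].
Proof.
rewrite /pairing -[RHS](expi_2pi_int (\sum_(i < d) k i ord0 * l i ord0)).
congr (expi (_ * _)); rewrite rmorph_sum; apply: eq_bigr => i _.
by rewrite !mxE rmorphM.
Qed.

Lemma cmeasurable_expi d' (S : measurableType d') (f : S -> R) : measurable_fun setT f ->
  cmeasurable (fun x => expi (f x)).
Proof.
by move=> mf; split => /=; apply: (measurableT_comp _ mf); apply: continuous_measurable_fun;
  [exact: continuous_cos|exact: continuous_sin].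
Qed.

Lemma cmeasurable_pairing (x : Rd) : cmeasurable (pairing x).
Proof.
apply: cmeasurable_expi; apply: measurable_funM; first exact: measurable_cst.
apply: measurable_sum => i; apply: measurable_funM; first exact: measurable_cst.
exact: measurable_matrix_coord.
Qed.

(** Evaluated at the chosen representative of the class; since integer vectors pair to 1, any other
    representative gives the same value. *)
Definition chi (k : Zd) (z : torus R d) : R[i] := pairing (zvec k) (repr z).

Lemma chiE k x : chi k (torus_pi x) = pairing (zvec k) x.
Proof.
rewrite /chi; have /torus_piP[l ->] : torus_pi (repr (torus_pi x)) = torus_pi x by rewrite /torus_pi reprK.
by rewrite pairingDr pairing_zvec mulr1.
Qed.

Lemma chi_iota (D : 'M[int]_d) n k (x : Rd) : @DR R d D \in unitmx ->
  chi k (iota_n D n x) = pairing (zvec k) (mxpow (@DR R d D)^T (- n) *m x).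
Proof. by move=> uD; rewrite iota_nE// chiE. Qed.

Lemma cmeasurable_torusP (h : torus R d -> R[i]) : cmeasurable (h \o @torus_pi R d) -> cmeasurable h.
Proof. by move=> [h1 h2]; split; apply: measurable_torusP. Qed.

Lemma cmeasurable_chi k : cmeasurable (chi k).
Proof.
apply: cmeasurable_torusP; rewrite (_ : _ \o _ = pairing (zvec k)).
  exact: cmeasurable_pairing.
by apply/funext => x; exact: chiE.
Qed.

Lemma normc_chi k z : normc (chi k z) = 1. Proof. exact: normc_pairing. Qed.

Lemma chiD k l z : chi (k + l) z = chi k z * chi l z.
Proof. by rewrite /chi zvecD pairingDl. Qed.

Lemma chiN k z : chi (- k) z = (chi k z)^*.
Proof. by rewrite /chi zvecN pairingNl. Qed.

Lemma chi0 z : chi 0 z = 1.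
Proof. by rewrite /chi zvec0 pairing0l. Qed.

End characters.

(** * Locating a point of the circle by its sine and cosine *)

Section sin_cos_itv.
Context {R : realType}.
Implicit Types x a : R.

(** The sign of the sine tells the two halves of the period apart. On each half the cosine is
    monotone, so together they determine the position in [0, 1[. *)
Lemma sin_2pi_lt0 x : 0 <= x < 1 -> (sin (2 * pi * x) < 0) = (2^-1 < x).
Proof.
have pi0 := pi_gt0 R.
move=> /andP[x0 x1]; apply/idP/idP => h.
  rewrite ltNge; apply/negP => x2; move: h; rewrite ltNge sin_ge0_pi// !mulr_ge0//=; last exact: ltW.
  by rewrite mulrAC ger_pMl//; lra.
rewrite -oppr_gt0 -sinN (_ : - (2 * pi * x) = 2 * pi * (1 - x) - pi - pi); last by ring.
have sB (y : R) : sin (y - pi) = - sin y by rewrite sinB cospi sinpi; ring.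
rewrite !sB opprK.
apply: sin_gt0_pi; rewrite !mulr_gt0 ?subr_gt0//= mulrAC gtr_pMl//; lra.
Qed.

Lemma cos_2pi_sub x : cos (2 * pi * x) = cos (2 * pi * (1 - x)) :> R.
Proof.
rewrite (_ : 2 * pi * (1 - x) = pi + pi - 2 * pi * x); last by ring.
have cD (y : R) : cos (pi + y) = - cos y by rewrite cosD cospi sinpi; ring.
by rewrite -addrA !cD opprK cosN.
Qed.

Lemma cos_2pi_lt x a : 0 <= x <= 2^-1 -> 0 <= a <= 2^-1 ->
  (cos (2 * pi * x) < cos (2 * pi * a)) = (a < x).
Proof.
have pi0 := pi_gt0 R.
have in0pi (y : R) : 0 <= y <= 2^-1 -> 2 * pi * y \in `[0, pi].
  move=> /andP[y0 y1]; rewrite in_itv /= !mulr_ge0//=; last exact: ltW.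
  by rewrite mulrAC ger_pMl//; lra.
by move=> hx ha; rewrite ltr_cos ?in0pi// ltr_pM2l// mulr_gt0.
Qed.

End sin_cos_itv.

(** * From half-spaces to all Borel sets of the cube *)

Section torus_uniqueness.
Context {R : realType} {d : nat}.
Local Notation Rd := 'cV[R]_d.
Local Notation Zd := 'cV[int]_d.
Local Notation cube := (@unit_cube R d).
Local Notation haar := (@haar R d).

Local Notation mu := (@cube_measure R d).

Lemma ae_cube (P : Rd -> Prop) : (forall x, cube x -> P x) -> {ae mu, forall x, P x}.
Proof.
move=> cP; exists (~` cube); split.
- by apply: measurableC; exact: measurable_unit_cube.
- by rewrite /mu /= /mrestr setICl measure0.
- by move=> x nPx cx; apply: nPx; exact: cP.
Qed.

Lemma cmeasurable_comp_pi (h : torus R d -> R[i]) : cmeasurable h -> cmeasurable (h \o @torus_pi R d).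
Proof. by move=> mh; apply: cmeasurable_comp => //; exact: measurable_torus_pi. Qed.

Lemma cintegrable_haar (h : torus R d -> R[i]) : cintegrable haar h -> cintegrable mu (h \o @torus_pi R d).
Proof.
move=> /cintegrableP[mh hoo]; apply/cintegrableP; split; first exact: cmeasurable_comp_pi.
move: hoo; rewrite ge0_integral_haar//; first exact/measurable_EFinP/measurable_normc.
by move=> z; rewrite lee_fin normc_ge0.
Qed.

Lemma Rintegral_haar (h : torus R d -> R) : measurable_fun setT h ->
  mu.-integrable setT (EFin \o (h \o @torus_pi R d)) ->
  Rintegral haar setT h = Rintegral mu setT (h \o @torus_pi R d).
Proof.
move=> mh ih; have mpi := @measurable_torus_pi R d.
have mhe : measurable_fun setT (EFin \o h) by exact/measurable_EFinP.
by rewrite /Rintegral [X in fine X](integral_pushforward mpi mhe _ measurableT)// preimage_setT.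
Qed.

Lemma cintegral_haar (h : torus R d -> R[i]) : cintegrable haar h ->
  cintegral haar h = cintegral mu (h \o @torus_pi R d).
Proof.
move=> Ih; have [IR II] := cintegrable_haar Ih; have [mR mI] := cintegrable_cmeasurable Ih.
by apply: complexP => /=; rewrite Rintegral_haar.
Qed.

Section uniqueness.
Variable H : Rd -> R[i].
Hypothesis IH : cintegrable mu H.
Hypothesis H0 : forall k : Zd, cintegral mu (fun x => pairing (zvec k) x * H x) = 0.

Let E (k : Zd) : Rd -> R[i] := pairing (zvec k).
Let mE k : cmeasurable (E k). Proof. exact: cmeasurable_pairing. Qed.
Let E1 k x : normc (E k x) <= 1. Proof. by rewrite normc_pairing. Qed.
Local Notation annihilates := (annihilates mu E H).
Local Notation multiplier := (multiplier mu E H).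
Local Notation multiplier_set := (multiplier_set mu E H).

Let ann1 : annihilates (fun=> 1).
Proof.
split; first by split; [exact: measurable_cst|exists 1 => x; rewrite normr1].
by move=> k; rewrite -[RHS](H0 k); congr cintegral; apply/funext => x; rewrite rmorph1 mul1r.
Qed.

(** Multiplication by a combination of the characters [k] and [-k] only shifts the frequency [l] at
    which the integral is known to vanish. *)
Let mult_character (t : Rd -> R) (a b : R[i]) (k : Zd) : measurable_fun setT t ->
  (forall x, (t x)%:C%C = a * E k x + b * E (- k) x) -> multiplier t.
Proof.
move=> mt tE; have bt : bounded_mfun t.
  split => //; exists (normc a + normc b) => x.
  have -> : `|t x| = normc (t x)%:C%C by rewrite /= expr0n addr0 sqrtr_sqr.
  by rewrite tE (le_trans (le_normcD _ _))// !Normc.normcM !normc_pairing !mulr1.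
split => // f [bf f0]; split; first exact: bounded_mfunM.
move=> l; have ED (j j' : Zd) x : E (j + j') x = E j x * E j' x by rewrite /E zvecD pairingDl.
rewrite (_ : (fun x => _) = (fun x => a * ((f x)%:C%C * (E (k + l) x * H x)) +
    b * ((f x)%:C%C * (E (- k + l) x * H x)))); last first.
  by apply/funext => x; rewrite rmorphM /= tE !ED; ring.
have I j : cintegrable mu (fun x => (f x)%:C%C * (E j x * H x)) by exact: cintegrable_bounded.
by rewrite cintegralD ?cintegralZ ?f0 ?mulr0 ?addr0//; exact: cintegrableZ.
Qed.

Section coordinate.
Variable i : 'I_d.
Let k : Zd := delta_mx i ord0.

Let Ek x : E k x = expi (2 * pi * x i ord0).
Proof.
rewrite /E /pairing (bigD1 i)//= big1 ?addr0; last first.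
  by move=> j ji; rewrite !mxE (negbTE ji) mul0r.
by rewrite !mxE !eqxx mul1r.
Qed.

Let c (x : Rd) := cos (2 * pi * x i ord0).
Let s (x : Rd) := sin (2 * pi * x i ord0).

Let mult_c : multiplier c.
Proof.
have [mc _] := mE k.
apply: (@mult_character c 2^-1 2^-1 k).
  by move: mc; congr measurable_fun; apply/funext => x; rewrite Ek.
move=> x; have -> : E (- k) x = (E k x)^* by rewrite /E zvecN pairingNl.
rewrite Ek; have e : (2%:R : R[i])^-1 = (2^-1)%:C%C by rewrite fmorphV rmorph_nat.
by rewrite e; apply: complexP; rewrite !ReImE /= /c; field.
Qed.

Let mult_s : multiplier s.
Proof.
have [_ ms] := mE k.
apply: (@mult_character s (0 -i* 2^-1)%C (0 +i* 2^-1)%C k).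
  by move: ms; congr measurable_fun; apply/funext => x; rewrite Ek.
move=> x; have -> : E (- k) x = (E k x)^* by rewrite /E zvecN pairingNl.
by rewrite Ek; apply: complexP; rewrite !ReImE /= /s; field.
Qed.

(** [multiplier_set_gt0] wants a multiplier bounded by 1, so [t - v] is divided by [1 + |v|]. *)
Let set_gt (t : Rd -> R) (v : R) : multiplier t -> (forall x, `|t x| <= 1) ->
  multiplier_set [set x | v < t x].
Proof.
move=> mt t1; have v0 : 0 < 1 + `|v| by rewrite ltr_pwDl.
have mc := multiplier_cst mE E1 IH (- v / (1 + `|v|)).
have ml := multiplier_lin mE E1 IH (1 + `|v|)^-1 mt mc.
have h := multiplier_set_gt0 mE E1 IH ml.
have e x : (1 + `|v|)^-1 * t x + - v / (1 + `|v|) = (t x - v) / (1 + `|v|) by rewrite mulrC -mulrDl.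
rewrite (_ : [set x | v < t x] = [set x | 0 < (1 + `|v|)^-1 * t x + - v / (1 + `|v|)]).
  apply: h => x; rewrite e normf_div (gtr0_norm v0) ler_pdivrMr// mul1r.
  by rewrite (le_trans (ler_normB _ _))// lerD2r.
by apply/seteqP; split => x /=; rewrite e pmulr_lgt0 ?invr_gt0// subr_gt0.
Qed.

Let set_lt (t : Rd -> R) (v : R) : multiplier t -> (forall x, `|t x| <= 1) ->
  multiplier_set [set x | t x < v].
Proof.
move=> mt t1; have mN : multiplier (fun x => -1 * t x + 0).
  exact: (multiplier_lin mE E1 IH (-1) mt (multiplier_cst mE E1 IH 0)).
have tE x : -1 * t x + 0 = - t x by ring.
rewrite (_ : [set x | t x < v] = [set x | - v < -1 * t x + 0]).
  by apply: set_gt => // x; rewrite tE normrN.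
by apply/seteqP; split => x /=; rewrite tE ltrN2.
Qed.

Let c1 x : `|c x| <= 1. Proof. by rewrite ler_norml cos_geN1 cos_le1. Qed.
Let s1 x : `|s x| <= 1. Proof. by rewrite ler_norml sin_geN1 sin_le1. Qed.

(** The measure does not charge the complement of the cube, so only the trace of a set on the cube
    matters. This allows half-spaces to be replaced by periodic sets. *)
Let mset_ae (A B : set Rd) : measurable B -> A `&` cube = B `&` cube -> multiplier_set A -> multiplier_set B.
Proof.
move=> mB AB [mA [bA KA]]; split => //.
have bB : bounded_mfun (\1_B : Rd -> R).
  split; first exact: measurable_indic.
  by exists 1 => x; rewrite indicE; case: (x \in B); rewrite ?normr1 ?normr0.
split => // f Kf; split; first by apply: bounded_mfunM => //; case: Kf.
move=> k'; have [bfA /(_ k') fA0] := KA _ Kf; rewrite -fA0.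
apply: ae_eq_cintegral.
- by apply: (@cintegrable_cmeasurable _ _ _ mu); apply: cintegrable_bounded => //; apply: bounded_mfunM => //; case: Kf.
- by apply: (@cintegrable_cmeasurable _ _ _ mu); exact: cintegrable_bounded.
- apply: ae_cube => x cx; rewrite !indicE (_ : (x \in A) = (x \in B))//.
  have : (A `&` cube) x <-> (B `&` cube) x by rewrite AB.
  move=> [h1 h2]; apply/idP/idP; rewrite !inE => h.
    by have [] := h1 (conj h cx).
  by have [] := h2 (conj h cx).
Qed.

(** On the cube the half-space is everything for [a < 0] and empty for [a >= 1]. Up to 1/2 it is the
    union of the set where the sine is negative and the set where the cosine is below that of [a];
    beyond 1/2 it is the intersection of the former with the set where the cosine is above. *)
Let ray (a : R) : multiplier_set [set x : Rd | a < x i ord0].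
Proof.
have mr : measurable [set x : Rd | a < x i ord0].
  have := @measurable_matrix_coord _ R d 1 i ord0 measurableT `]a, +oo[%classic (measurable_itv _).
  by rewrite setTI; congr measurable; apply/seteqP; split => x /=; rewrite in_itv /= andbT.
have mT := multiplier_setT mE E1 IH.
have mC := multiplier_setC mE E1 IH.
have mI (A B : set Rd) : multiplier_set A -> multiplier_set B -> multiplier_set (A `&` B).
  exact: multiplier_setI.
have mU := multiplier_setU mE E1 IH.
have [a0|a0] := ltP a 0.
  apply: (@mset_ae setT) => //; apply/seteqP; split => x [_ cx]; split => //=.
  by have /andP[x0 _] := cx i; exact: lt_le_trans a0 x0.
have [a1|a1] := leP 1 a.
  apply: (@mset_ae set0) => //; last by rewrite -setCT; exact: mC.
  apply/seteqP; split => x [h cx] //.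
  by have /andP[_ x1] := cx i; move: h => /=; rewrite ltNge (le_trans (ltW x1) a1).
have [a2|a2] := leP a 2^-1.
  apply: (@mset_ae ([set x | s x < 0] `|` [set x | c x < cos (2 * pi * a)])) => //; last first.
    by apply: mU; exact: set_lt.
  apply/seteqP; split => x [h cx]; split => //; have /andP[x0 x1] := cx i.
    move: h; rewrite /= /s /c sin_2pi_lt0 ?x0// => -[h|h]; first exact: le_lt_trans h.
    have [x2|x2] := leP (x i ord0) 2^-1; last exact: le_lt_trans x2.
    by rewrite cos_2pi_lt ?x0 ?a0 in h.
  rewrite /= /s /c sin_2pi_lt0 ?x0//; have [x2|x2] := leP (x i ord0) 2^-1; last by left.
  by right; rewrite cos_2pi_lt ?x0 ?a0.
apply: (@mset_ae ([set x | s x < 0] `&` [set x | cos (2 * pi * a) < c x])) => //; last first.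
  by apply: mI; [exact: set_lt|exact: set_gt].
have ca (y : R) : 2^-1 < y -> y < 1 -> (cos (2 * pi * a) < cos (2 * pi * y)) = (a < y).
  move=> y0 y1; rewrite cos_2pi_sub (cos_2pi_sub y) cos_2pi_lt; first by rewrite ltrD2l ltrN2.
    by apply/andP; split; lra.
  by apply/andP; split; lra.
apply/seteqP; split => x [h cx]; split => //; have /andP[x0 x1] := cx i.
  move: h; rewrite /= /s /c sin_2pi_lt0 ?x0// => -[h1 h2].
  by rewrite -ca.
have x2 : 2^-1 < x i ord0 by exact: lt_trans h.
by split; rewrite /= /s /c ?sin_2pi_lt0 ?x0// ca.
Qed.

Lemma multiplier_set_coord (B : set R) : measurable B -> multiplier_set [set x : Rd | B (x i ord0)].
Proof.
have sig := sigma_algebra_multiplier_set mE E1 IH.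
move=> mB; have : (@RGenOInfty.G R).-sigma.-measurable B by rewrite -RGenOInfty.measurableE.
suff sub : <<s @RGenOInfty.G R >> `<=` [set C : set R | multiplier_set [set x : Rd | C (x i ord0)]] by exact: sub.
apply: smallest_sub.
  case: sig => s0 sC sU; split => //.
    by move=> A hA; rewrite setTD; have := sC _ hA; rewrite setTD.
  by move=> F hF; exact: (sU (fun n => [set x : Rd | F n (x i ord0)])).
move=> _ [a ->]; have := ray a; congr multiplier_set.
by apply/seteqP; split => x /=; rewrite in_itv /= andbT.
Qed.

End coordinate.

(** The multiplier sets form a sigma-algebra containing the coordinate cylinders, hence all
    measurable sets. *)
Lemma ae_cube_eq0 : {ae mu, forall x, H x = 0}.
Proof.
apply: (ae_eq0_multiplier IH (i0 := 0) _ ann1).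
  by apply/funext => x; rewrite /E zvec0 pairing0l.
suff sub : <<s @matrix_cylinder _ R d 1 >> `<=` multiplier_set by exact: sub.
apply: smallest_sub; first exact: (sigma_algebra_multiplier_set mE E1 IH).
move=> _ [[i j] [B mB ->]]; rewrite ord1; exact: multiplier_set_coord.
Qed.

End uniqueness.

Lemma torus_fourier_unique (h : torus R d -> R[i]) : cintegrable haar h ->
  (forall k : Zd, cintegral haar (fun z => chi k z * h z) = 0) -> {ae haar, forall z, h z = 0}.
Proof.
move=> Ih h0; have mh := cintegrable_cmeasurable Ih.
have Ichi k : cintegrable haar (fun z => chi k z * h z).
  apply: (@le_cintegrable _ _ _ _ _ (fun z => normc (h z))).
  - by apply: cmeasurableM => //; exact: cmeasurable_chi.
  - exact: cintegrable_normc.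
  - by move=> z; rewrite Normc.normcM normc_chi mul1r.
have H0 : {ae mu, forall x, h (torus_pi x) = 0}.
  apply: (ae_cube_eq0 (cintegrable_haar Ih)) => k.
  rewrite -[RHS](h0 k) cintegral_haar//; congr cintegral; apply/funext => x.
  by rewrite /= chiE.
have : (\int[haar]_z `|(normc (h z))%:E| = 0)%E.
  rewrite ge0_integral_haar; last 2 first.
  - by apply: measurableT_comp => //; exact/measurable_EFinP/measurable_normc.
  - by move=> z; exact: abse_ge0.
  rewrite -[RHS](integral0 mu setT); apply: ge0_ae_eq_integral => //.
  - apply: measurableT_comp => //; apply/measurable_EFinP/measurable_normc.
    exact: cmeasurable_comp_pi.
  - by apply: filterS H0 => x -> _; rewrite Normc.normc0 abse0.
move/ae_eq_integral_abs => /(_ measurableT) h1.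
have : ae_eq haar setT (fun z => (normc (h z))%:E) (cst 0%E).
  by apply: h1; exact/measurable_EFinP/measurable_normc.
by apply: filterS => z /= /(_ Logic.I) [] /Normc.eq0_normc.
Qed.

End torus_uniqueness.

(** Links two encodings of linear combinations: lists of terms, which concatenation closes under
    addition, and coefficient functions on a list of indices, the form used by
    [orthonormal_basis]. *)
Lemma regroup_sum {A : nzRingType} {I : eqType} (l : seq (A * I)) (e : I -> A) :
  \sum_(p <- l) p.1 * e p.2 =
  \sum_(i <- undup (map snd l)) (\sum_(p <- l | p.2 == i) p.1) * e i.
Proof.
have us := undup_uniq (map snd l); set s := undup _ in us *.
under [RHS]eq_bigr do rewrite mulr_suml big_mkcond.
rewrite exchange_big /=; apply: eq_big_seq => p pl.
have ps : p.2 \in s by rewrite mem_undup map_f.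
rewrite (bigD1_seq p.2)//= eqxx big1 ?addr0// => i.
by rewrite eq_sym => /negbTE ->.
Qed.

(** * The characters as an orthonormal basis on the unit cube *)

Section cube_basis.
Context {R : realType} {d : nat}.
Local Notation Rd := 'cV[R]_d.
Local Notation leb := (lebesgue_cV R d).
Local Notation Zd := 'cV[int]_d.
Local Notation cube := (@unit_cube R d).
Local Notation mu := (@cube_measure R d).
Local Notation E k := (pairing (zvec k : Rd)).

Lemma integral_cube_vanish (f : Rd -> \bar R) : measurable_fun setT f -> (forall x, ~ cube x -> f x = 0%E) ->
  (\int[mu]_x f x = \int[leb]_x f x)%E.
Proof.
have ge0 (g : Rd -> \bar R) : measurable_fun setT g -> (forall x, 0 <= g x)%E ->
    (forall x, ~ cube x -> g x = 0%E) -> (\int[mu]_x g x = \int[leb]_x g x)%E.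
  move=> mg g0 gc; rewrite ge0_integral_cube// integral_mkcond; apply: eq_integral => x _.
  by rewrite patchE; case: ifPn => // /negP; rewrite inE => /gc ->.
move=> mf f0; rewrite [LHS]integralE [RHS]integralE.
rewrite ge0 ?[X in (_ - X)%E]ge0//.
- exact: measurable_funeneg.
- by move=> x xc; rewrite funenegE f0// oppe0 maxxx.
- exact: measurable_funepos.
- by move=> x xc; rewrite funeposE f0// maxxx.
Qed.

Lemma lebesgue_unit_cube : leb cube = 1%E.
Proof.
have {1}<- : (\int[leb]_x (\1_cube x)%:E = leb cube)%E.
  by rewrite integral_indic ?setIT//; exact: measurable_unit_cube.
elim: (d) => [|n IH].
  rewrite (_ : (fun x => _) = cst 1%E); last first.
    by apply/funext => x; rewrite indicE mem_set//= => -[].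
  by rewrite integral_cst// mul1e /= diracT.
have mi (k : nat) : measurable_fun setT (fun x : 'cV[R]_k => (\1_(@unit_cube R k) x)%:E).
  by apply/measurable_EFinP/measurable_indic; exact: measurable_unit_cube.
rewrite integral_cVS//.
have E' (x : R) (y : 'cV[R]_n) : \1_(@unit_cube R n.+1) (col_mx x%:M y) =
    \1_(`[0, 1[%classic : set R) x * \1_(@unit_cube R n) y.
  have cu (j : 'I_1) : (col_mx x%:M y : 'cV[R]_(1 + n)) (lshift n j) ord0 = x.
    by rewrite col_mxEu !ord1 mxE eqxx mulr1n.
  have cd (j : 'I_n) : (col_mx x%:M y : 'cV[R]_(1 + n)) (rshift 1 j) ord0 = y j ord0.
    by rewrite col_mxEd.
  have cubeE : @unit_cube R n.+1 (col_mx x%:M y) <-> 0 <= x < 1 /\ @unit_cube R n y.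
    split=> [h|[hx hy] i].
      split=> [|i]; first by rewrite -(cu ord0); exact: h.
      by rewrite -cd; exact: h.
    have [j E|j E] := split_ordP (i : 'I_(1 + n)).
      by rewrite [i in X in 0 <= X < 1]E cu.
    by rewrite [i in X in 0 <= X < 1]E cd.
  rewrite !indicE -natrM mulnb (_ : (_ \in @unit_cube R n.+1) = (x \in `[0, 1[%classic) && (y \in @unit_cube R n))//.
  by apply/idP/andP; rewrite !inE /= in_itv /=; case: cubeE.
transitivity (\int[@lebesgue_measure R]_x (\1_(`[0, 1[%classic : set R) x)%:E)%E.
  apply: eq_integral => x _; under eq_integral do rewrite E' EFinM.
  rewrite ge0_integralZl_EFin//; last exact: mi.
  by rewrite IH mule1.
rewrite integral_indic//= setIT.
by rewrite (@lebesgue_measure_itv R `[0, 1[) /= lte_fin ltr01 oppr0 adde0.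
Qed.

Lemma cube_measureT : mu setT = 1%E.
Proof. by rewrite /mu /= /mrestr setTI lebesgue_unit_cube. Qed.

(** The cube has mass 1, so the constant 1 is square-integrable and can be paired with [f]. *)
Lemma L2_cube_integrable (f : Rd -> R[i]) : L2 mu f -> cintegrable mu f.
Proof.
move=> Lf; have L1 : L2 mu (fun=> 1).
  split; first exact: cmeasurable_cst.
  rewrite /N2; under eq_integral do rewrite Normc.normc1 expr1n.
  by rewrite integral_cst// mul1e cube_measureT ltry.
apply: eq_cintegrable (cintegrable_ip L1 Lf) => x.
by rewrite (_ : (1 : R[i])^* = 1) ?mul1r// ; apply: complexP; rewrite ?cRe_conj ?cIm_conj //= oppr0.
Qed.

(** The integral is rewritten over the translated cube and unfolded: exactly one integer translate
    of each point lies in that cube, and [f] has the same value there. *)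
Lemma ge0_integral_periodic (a : Rd) (f : Rd -> \bar R) : measurable_fun setT f -> (forall x, (0 <= f x)%E) ->
  (forall x k, f (x + zvec k) = f x) ->
  (\int[mu]_x f (x + a)%R = \int[mu]_x f x)%E.
Proof.
move=> mf f0 fper; have mc := @measurable_unit_cube R d.
have mfa : measurable_fun setT (fun x : Rd => f (x + a)).
  exact: (measurableT_comp mf (measurable_mxD _)).
rewrite [LHS]ge0_integral_cube// [RHS]ge0_integral_cube// [LHS]integral_mkcond.
pose G (x : Rd) := (f x * (\1_cube (x - a))%:E)%E.
have mG : measurable_fun setT G.
  apply: emeasurable_funM => //; apply/measurable_EFinP.
  exact: (measurableT_comp (measurable_indic mc) (measurable_mxD _)).
have G0 x : (0 <= G x)%E by rewrite mule_ge0// lee_fin.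
transitivity (\int[leb]_x G ((x : Rd) + a)%R)%E.
  apply: eq_integral => x _; rewrite /G addrK patchE indicE.
  by case: (x \in cube); rewrite ?mule1 ?mule0.
rewrite ge0_integral_cVD// integral_unfold//; apply: eq_integral => x _.
pose k0 := - floorv (x - a).
have ck : cube (x + zvec k0 - a) by rewrite zvecN addrAC; exact: cube_floorv.
rewrite -[RHS](@esum_set1 _ _ k0 (fun=> f x))// [RHS]esum_mkcond; apply: eq_esum => k _.
rewrite /G fper indicE; have [kk|kk] := boolP (k \in [set k0]).
  by move: kk; rewrite inE /= => ->; rewrite mem_set// mule1.
rewrite memNset ?mule0// => ck'; move/negP: kk; apply; rewrite inE /=.
apply: oppr_inj; apply: (@cube_zvec_uniq _ _ (x - a)).
  by rewrite zvecN opprK addrAC.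
by rewrite zvecN opprK addrAC.
Qed.

Lemma Rintegral_periodic (a : Rd) (f : Rd -> R) : measurable_fun setT f -> (forall x, `|f x| <= 1) ->
  (forall x k, f (x + zvec k) = f x) ->
  Rintegral mu setT (fun x => f (x + a)) = Rintegral mu setT f.
Proof.
move=> mf f1 fper.
have fin (g : Rd -> R) : measurable_fun setT g -> (forall x, `|g x| <= 1) -> mu.-integrable setT (EFin \o g).
  move=> mg g1; apply: measurable_bounded_integrable => //; first by rewrite cube_measureT ltry.
  exists 1; split; first exact: num_real.
  by move=> M M1 x _; exact: (le_trans (g1 x) (ltW M1)).
have mfa : measurable_fun setT (fun x : Rd => f (x + a)).
  exact: (measurableT_comp mf (measurable_mxD _)).
have I1 : mu.-integrable setT (EFin \o (cst 1 : Rd -> R)).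
  by apply: fin => [|x]; [exact: measurable_cst|rewrite /= normr1].
have If := fin _ mf f1; have Ifa := fin _ mfa (fun x => f1 (x + a)).
(* Adding 1 makes the bounded function nonnegative; the constant, integrable on the cube, is
   cancelled afterwards. *)
have : Rintegral mu setT (fun x => 1 + f (x + a)) = Rintegral mu setT (fun x => 1 + f x).
  rewrite /Rintegral; congr fine.
  apply: (@ge0_integral_periodic a (fun x => (1 + f x)%:E)).
  - by apply/measurable_EFinP; apply: measurable_funD => //; exact: measurable_cst.
  - by move=> x; rewrite lee_fin; have := f1 x; rewrite ler_norml => /andP[+ _]; lra.
  - by move=> x k; rewrite fper.
by rewrite !RintegralD// => /addrI.
Qed.

Lemma L2_pairing (k : Zd) : L2 mu (E k).
Proof.
split; first exact: cmeasurable_pairing.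
rewrite /N2; under eq_integral do rewrite normc_pairing expr1n.
by rewrite integral_cst// mul1e cube_measureT ltry.
Qed.

Lemma cintegrable_pairing (k : Zd) : cintegrable mu (E k).
Proof. exact/L2_cube_integrable/L2_pairing. Qed.

(* A translation by half a period changes the sign of the character. *)
Lemma cintegral_pairing (k : Zd) : cintegral mu (E k) = (k == 0)%:R.
Proof.
have [->|k0] := eqVneq k 0.
  rewrite (_ : E 0 = fun=> 1); last by apply/funext => x; rewrite zvec0 pairing0l.
  by rewrite /cintegral !Rintegral_cst// cube_measureT /= mulr1 mul0r.
have [i ki] : exists i, k i ord0 != 0.
  apply: contrapT => /forallNP ka; move/negP: k0; apply; apply/eqP/matrixP => i j.
  by rewrite ord1 mxE; apply/eqP/negPn/negP; exact: ka.
pose a : Rd := \col_j (if j == i then (2 * (k i ord0)%:~R)^-1 else 0).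
have Ea : pairing (zvec k) a = -1 :> R[i].
  rewrite -expi_pi /pairing (bigD1 i)//= big1 ?addr0; last first.
    by move=> j ji; rewrite !mxE (negbTE ji) mulr0.
  congr expi; rewrite !mxE eqxx.
  have : (k i ord0)%:~R != 0 :> R by rewrite intr_eq0.
  by move=> h; field; rewrite h.
have per x l : E k (x + zvec l) = E k x by rewrite pairingDr pairing_zvec mulr1.
have Ex x : E k (x + a) = - E k x by rewrite pairingDr Ea mulrN1.
have [mR mI] := cmeasurable_pairing (zvec k : Rd).
have [IR II] := cintegrable_pairing k.
have opp (r : R) : r = - r -> r = 0 by lra.
have RN (f : Rd -> R) : mu.-integrable setT (EFin \o f) ->
    Rintegral mu setT (fun x => - f x) = - Rintegral mu setT f.
  by move=> If; under eq_Rintegral do rewrite -mulN1r; rewrite RintegralZl// mulN1r.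
apply: complexP => /=; apply: opp; rewrite -RN//.
  rewrite -(@Rintegral_periodic a (fun x => Re (E k x)))//.
  - by apply: eq_Rintegral => x _; rewrite Ex cReN.
  - by move=> x; rewrite (le_trans (normc_Re_le _))// normc_pairing.
  - by move=> x l; rewrite per.
rewrite -(@Rintegral_periodic a (fun x => Im (E k x)))//.
- by apply: eq_Rintegral => x _; rewrite Ex cImN.
- by move=> x; rewrite (le_trans (normc_Im_le _))// normc_pairing.
- by move=> x l; rewrite per.
Qed.

Lemma ip_pairing (k l : Zd) : ip mu (E k) (E l) = (k == l)%:R.
Proof.
rewrite /ip (_ : (fun x => _) = E (l - k)); last first.
  by apply/funext => x; rewrite zvecD zvecN pairingDl pairingNl mulrC.
by rewrite cintegral_pairing subr_eq0 eq_sym.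
Qed.

(** A function orthogonal to all characters vanishes almost everywhere by uniqueness, so
    [total_dense] applies to their span. *)
Lemma cube_characters_dense (f : Rd -> R[i]) : L2 mu f -> forall eps : R, 0 < eps ->
  exists (s : seq Zd) (c : Zd -> R[i]),
    nr mu (fun x => f x - \sum_(k <- s) c k * E k x) < eps.
Proof.
move=> Lf eps e0.
pose W : set (Rd -> R[i]) := [set g | exists l : seq (R[i] * Zd), g = fun x => \sum_(p <- l) p.1 * E p.2 x].
have [] := @total_dense _ _ _ mu W _ _ _ _ f Lf eps e0.
- move=> _ [l ->]; apply: (@L2_lincomb _ _ _ mu _ l (fun p => p.1) (fun p => E p.2)) => p.
  exact: L2_pairing.
- by exists [::]; apply/funext => x; rewrite big_nil.
- move=> a _ _ [l ->] [l' ->]; exists ([seq (a * p.1, p.2) | p <- l] ++ l').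
  apply/funext => x; rewrite big_cat big_map /= mulr_sumr; congr (_ + _).
  by apply: eq_bigr => p _; rewrite mulrA.
- move=> g Lg g0.
  have : {ae mu, forall x, g x = 0}.
    apply: (ae_cube_eq0 (L2_cube_integrable Lg)) => k.
    have WE : W (E (- k)).
      by exists [:: (1, - k)]; apply/funext => x; rewrite big_seq1 mul1r.
    rewrite -[RHS](g0 _ WE); congr cintegral; apply/funext => x.
    by rewrite zvecN pairingNl; congr (_ * _); apply: complexP; rewrite !ReImE ?opprK.
  move=> ae; rewrite /nr (ae_eq_N2 Lg.1 (cmeasurable_cst 0) ae).
  rewrite /N2; under eq_integral do rewrite Normc.normc0 expr0n /=.
  by rewrite integral0 sqrtr0.
move=> _ [l ->] fl; exists (undup (map snd l)), (fun i => \sum_(p <- l | p.2 == i) p.1).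
rewrite [X in nr mu X](_ : _ = (fun x => f x - \sum_(p <- l) p.1 * E p.2 x))//.
by apply/funext => x; rewrite -(regroup_sum l (fun k => E k x)).
Qed.

Lemma cube_parseval (f : Rd -> R[i]) : L2 mu f ->
  (\esum_(k in [set: Zd]) (normc (ip mu (E k) f) ^+ 2)%:E)%E = N2 mu f.
Proof.
move=> Lf; apply: parseval => //; [exact: L2_pairing|exact: ip_pairing|exact: cube_characters_dense].
Qed.

End cube_basis.

(** * The Fourier transform on L^2 *)

Section scaled_change_of_variables.
Context {R : realType} {d1 d2 : measure_display} {X : measurableType d1} {Y : measurableType d2}.
Variables (mu : {measure set X -> \bar R}) (nu : {measure set Y -> \bar R}).
Variables (phi : X -> Y) (c : R).
Hypothesis mphi : measurable_fun setT phi.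
Hypothesis c0 : 0 <= c.
Hypothesis phiE : forall f : Y -> \bar R, measurable_fun setT f -> (forall y, (0 <= f y)%E) ->
  (\int[mu]_x f (phi x) = c%:E * \int[nu]_y f y)%E.

Lemma N2_comp (f : Y -> R[i]) : cmeasurable f -> N2 mu (f \o phi) = (c%:E * N2 nu f)%E.
Proof.
move=> mf; rewrite /N2 -(phiE (f := fun y => (normc (f y) ^+ 2)%:E))//.
  exact/measurable_EFinP/measurable_sqr_normc.
by move=> y; rewrite lee_fin sqr_ge0.
Qed.

Lemma L2_comp (f : Y -> R[i]) : L2 nu f -> L2 mu (f \o phi).
Proof.
move=> [mf foo]; split; first exact: cmeasurable_comp.
by rewrite N2_comp// lte_mul_pinfty// lee_fin.
Qed.

Lemma cintegrable_comp (f : Y -> R[i]) : cintegrable nu f -> cintegrable mu (f \o phi).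
Proof.
move=> /cintegrableP[mf foo]; apply/cintegrableP; split; first exact: cmeasurable_comp.
rewrite (phiE (f := fun y => (normc (f y))%:E)); first by rewrite lte_mul_pinfty// lee_fin.
  exact/measurable_EFinP/measurable_normc.
by move=> y; rewrite lee_fin normc_ge0.
Qed.

(** The hypothesis concerns nonnegative functions, so it is applied to the positive and negative
    parts. *)
Lemma Rintegral_comp (r : Y -> R) : nu.-integrable setT (EFin \o r) ->
  Rintegral mu setT (r \o phi) = c * Rintegral nu setT r.
Proof.
move=> Ir; have Ip := integrable_funrpos measurableT Ir; have In := integrable_funrneg measurableT Ir.
have ge0 (g : Y -> R) : (forall y, 0 <= g y) -> nu.-integrable setT (EFin \o g) ->
    mu.-integrable setT (EFin \o (g \o phi)) /\ Rintegral mu setT (g \o phi) = c * Rintegral nu setT g.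
  move=> g0 /integrableP[mg goo].
  have E : (\int[mu]_x (g (phi x))%:E = c%:E * \int[nu]_y (g y)%:E)%E.
    by rewrite (phiE (f := EFin \o g))// => y; rewrite lee_fin.
  have gfin : (\int[nu]_y (g y)%:E < +oo)%E.
    by move: goo; under eq_integral do rewrite /= ger0_norm//.
  split.
    apply/integrableP; split; first exact: (measurableT_comp mg mphi).
    under eq_integral do rewrite /= ger0_norm//.
    by rewrite E lte_mul_pinfty// lee_fin.
  rewrite /Rintegral /= E fineM// ge0_fin_numE//.
  by apply: integral_ge0 => y _; rewrite lee_fin.
have [Ip' Ep] := ge0 _ (funrpos_ge0 r) Ip; have [In' En] := ge0 _ (funrneg_ge0 r) In.
have -> : r \o phi = (fun x => (r^\+ \o phi) x - (r^\- \o phi) x).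
  by apply/funext => x /=; rewrite -[in LHS](funrposBneg r).
rewrite RintegralB// Ep En -mulrBr -RintegralB//; congr (_ * _).
by rewrite -[in RHS](funrposBneg r).
Qed.

Lemma cintegral_comp (f : Y -> R[i]) : cintegrable nu f ->
  cintegral mu (f \o phi) = c%:C%C * cintegral nu f.
Proof.
move=> [IR II]; apply: complexP; rewrite ?cReM ?cImM /= ?mul0r ?subr0 ?addr0.
  exact: (Rintegral_comp IR).
exact: (Rintegral_comp II).
Qed.

End scaled_change_of_variables.

(** * The transform of integrable functions and affine maps *)

Section plancherel.
Context {R : realType} {d : nat}.
Local Notation Rd := 'cV[R]_d.
Local Notation leb := (lebesgue_cV R d).
Local Notation Zd := 'cV[int]_d.
Local Notation cube := (@unit_cube R d).
Local Notation mu := (@cube_measure R d).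
Local Notation fn := (Rd -> R[i]).
Implicit Types (f g u v : fn) (A : 'M[R]_d).

Lemma cmeasurable_pairing2 : cmeasurable (fun z : Rd * Rd => pairing z.2 z.1 : R[i]).
Proof.
apply: cmeasurable_expi; apply: measurable_funM; first exact: measurable_cst.
apply: measurable_sum => i; apply: measurable_funM.
  exact: (measurableT_comp (measurable_matrix_coord i ord0) measurable_snd).
exact: (measurableT_comp (measurable_matrix_coord i ord0) measurable_fst).
Qed.

(** Tonelli makes the integrals of the positive and negative parts measurable in the parameter, and
    [fine] preserves measurability even where their difference is infinite. *)
Lemma measurable_Rintegral_param (g : Rd * Rd -> R) : measurable_fun setT g ->
  measurable_fun setT (fun y => Rintegral leb setT (fun x => g (y, x))).
Proof.
move=> mg; have mp : measurable_fun setT (fun z => (g^\+ z)%:E).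
  by apply/measurable_EFinP; exact: measurable_funrpos.
have mn : measurable_fun setT (fun z => (g^\- z)%:E).
  by apply/measurable_EFinP; exact: measurable_funrneg.
have h1 := @measurable_fun_fubini_tonelli_F _ _ _ _ R leb _ mp (fun z => ltac:(by rewrite lee_fin)).
have h2 := @measurable_fun_fubini_tonelli_F _ _ _ _ R leb _ mn (fun z => ltac:(by rewrite lee_fin)).
rewrite (_ : (fun y => _) = fine \o (fun y =>
    (\int[leb]_x (g^\+ (y, x))%:E - \int[leb]_x (g^\- (y, x))%:E)%E)); last first.
  apply/funext => y; rewrite /Rintegral /=; congr fine; rewrite integralE.
  by congr (_ - _)%E; apply: eq_integral => x _; rewrite ?funeposE ?funenegE EFin_max.
have mf : measurable_fun setT (@fine R) by exact: fine_measurable.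
exact: (measurableT_comp mf (emeasurable_funB h1 h2)).
Qed.

Lemma cmeasurable_fourier1 f : cmeasurable f -> cmeasurable (fourier1 f).
Proof.
move=> mf; have mF : cmeasurable (fun z : Rd * Rd => f z.2 * pairing z.2 z.1).
  by apply: cmeasurableM; [exact: cmeasurable_comp|exact: cmeasurable_pairing2].
by split; [exact: (measurable_Rintegral_param mF.1)|exact: (measurable_Rintegral_param mF.2)].
Qed.

Lemma cintegrable_pairingM f xi : cintegrable leb f -> cintegrable leb (fun x => f x * pairing x xi).
Proof.
move=> If; apply: (@le_cintegrable _ _ _ _ _ (fun x => normc (f x))).
- apply: cmeasurableM; first exact: cintegrable_cmeasurable If.
  by rewrite (_ : (fun x => _) = pairing xi); [exact: cmeasurable_pairing|apply/funext => x; rewrite pairingC].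
- exact: cintegrable_normc.
- by move=> x; rewrite Normc.normcM normc_pairing mulr1.
Qed.

Lemma fourier1_lin (a : R[i]) f g : cintegrable leb f -> cintegrable leb g ->
  fourier1 (fun x => a * f x + g x) = (fun xi => a * fourier1 f xi + fourier1 g xi).
Proof.
move=> If Ig; apply/funext => xi; rewrite /fourier1 -cintegralZ; last exact: cintegrable_pairingM.
rewrite -cintegralD; [|by apply: cintegrableZ; exact: cintegrable_pairingM|exact: cintegrable_pairingM].
by congr cintegral; apply/funext => x; ring.
Qed.

Lemma fourier1B f g : cintegrable leb f -> cintegrable leb g ->
  fourier1 (fun x => f x - g x) = (fun xi => fourier1 f xi - fourier1 g xi).
Proof.
move=> If Ig; have := fourier1_lin (-1) Ig If.
rewrite (_ : (fun x => -1 * g x + f x) = (fun x => f x - g x)); last by apply/funext => x; ring.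
by move=> ->; apply/funext => xi; ring.
Qed.

Let integral_mulmx A (uA : A \in unitmx) (F : Rd -> \bar R) (mF : measurable_fun setT F)
  (F0 : forall x, (0 <= F x)%E) := unitmx_scales_lebesgue uA mF F0.

Let integral_shift (b : Rd) (F : Rd -> \bar R) : measurable_fun setT F -> (forall x, (0 <= F x)%E) ->
  (\int[leb]_x F (x + b)%R = 1%:E * \int[leb]_x F x)%E.
Proof. by move=> mF F0; rewrite mul1e ge0_integral_cVD. Qed.

Let det_ge0 A : 0 <= `|\det A|^-1. Proof. by rewrite invr_ge0. Qed.

Lemma N2_mulmx A f : A \in unitmx -> cmeasurable f ->
  N2 leb (fun x => f (A *m x)) = (`|\det A|^-1%:E * N2 leb f)%E.
Proof. by move=> uA; apply: N2_comp; exact: integral_mulmx. Qed.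

Lemma L2_mulmx A f : A \in unitmx -> L2 leb f -> L2 leb (fun x => f (A *m x)).
Proof.
by move=> uA; apply: (L2_comp (measurable_mulmx A) (det_ge0 A)); exact: integral_mulmx.
Qed.

Lemma cintegrable_mulmx A f : A \in unitmx -> cintegrable leb f -> cintegrable leb (fun x => f (A *m x)).
Proof.
by move=> uA; apply: (cintegrable_comp (measurable_mulmx A) (det_ge0 A)); exact: integral_mulmx.
Qed.

Lemma N2_shift b f : cmeasurable f -> N2 leb (fun x => f (x + b)) = N2 leb f.
Proof. by move=> mf; have := N2_comp (@integral_shift b) mf; rewrite mul1e. Qed.

Lemma L2_shift b f : L2 leb f -> L2 leb (fun x => f (x + b)).
Proof. by apply: (L2_comp (measurable_mxD b) ler01); exact: integral_shift. Qed.

Lemma cintegrable_shift b f : cintegrable leb f -> cintegrable leb (fun x => f (x + b)).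
Proof. by apply: (cintegrable_comp (measurable_mxD b) ler01); exact: integral_shift. Qed.

Lemma fourier1_mulmx A f : A \in unitmx -> cintegrable leb f ->
  fourier1 (fun x => f (A *m x)) = (fun xi => (`|\det A|^-1)%:C%C * fourier1 f ((invmx A)^T *m xi)).
Proof.
move=> uA If; apply/funext => xi.
rewrite -(cintegral_comp (measurable_mulmx A) (det_ge0 A) (integral_mulmx uA)); last first.
  exact: cintegrable_pairingM.
by congr cintegral; apply/funext => x; rewrite /= -pairing_mulmx mulmxA mulVmx// mul1mx.
Qed.

Lemma fourier1_shift b f : cintegrable leb f ->
  fourier1 (fun x => f (x + b)) = (fun xi => (pairing b xi)^* * fourier1 f xi).
Proof.
move=> If; apply/funext => xi; rewrite /fourier1 -cintegralZ; last exact: cintegrable_pairingM.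
have I1 : cintegrable leb (fun x => (pairing b xi)^* * (f x * pairing x xi)).
  by apply: cintegrableZ; exact: cintegrable_pairingM.
have := cintegral_comp (measurable_mxD b) ler01 (@integral_shift b) I1.
rewrite mul1r => <-; congr cintegral; apply/funext => x /=.
by rewrite -pairingNl mulrCA -pairingDl (_ : - b + (x + b) = x)// addrCA addNr addr0.
Qed.

(** Expressed with the extended-valued [N2], so that no finiteness of the transform is
    presupposed. *)
Definition isometric f := N2 leb (fourier1 f) = N2 leb f.

(** The transform of [f (A x)] carries the factor [|det A|^-1], whose square meets the Jacobian
    [|det A|] of the dual matrix. Both norms thus scale by [|det A|^-1], which cancels. *)
Lemma isometric_mulmx A f : A \in unitmx -> cintegrable leb f ->
  isometric (fun x => f (A *m x)) -> isometric f.
Proof.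
move=> uA If; have mf := cintegrable_cmeasurable If; have mFf := cmeasurable_fourier1 mf.
have d0 : 0 < `|\det A| by rewrite normr_gt0 -unitfE -unitmxE.
have uA' : (invmx A)^T \in unitmx by rewrite unitmx_tr unitmx_inv.
rewrite /isometric N2_mulmx// fourier1_mulmx// N2Z; last first.
  exact: (cmeasurable_comp mFf (measurable_mulmx _)).
rewrite N2_mulmx// det_tr det_inv normfV invrK.
have -> : normc (`|\det A|^-1)%:C%C = `|\det A|^-1.
  by rewrite /= expr0n addr0 sqrtr_sqr ger0_norm// invr_ge0.
rewrite muleA -EFinM expr2 -mulrA mulVf ?gt_eqF// mulr1 => h.
have : (`|\det A|%:E * (`|\det A|^-1%:E * N2 leb (fourier1 f)) = `|\det A|%:E * (`|\det A|^-1%:E * N2 leb f))%E.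
  by rewrite h.
by rewrite !muleA -!EFinM mulfV ?gt_eqF// !mul1e.
Qed.

Lemma isometric_shift b f : cintegrable leb f ->
  isometric (fun x => f (x + b)) -> isometric f.
Proof.
move=> If; have mf := cintegrable_cmeasurable If.
rewrite /isometric (N2_shift b mf) fourier1_shift// => <-; apply: eq_integral => xi _.
by rewrite Normc.normcM normc_conj normc_pairing mul1r.
Qed.

(* Summing Parseval's identity for [x |-> u x e(x, theta)] over theta in the unit cube unfolds to the integral over R^d. *)
Lemma isometric_cube u : L2 leb u -> (forall x, ~ cube x -> u x = 0) -> isometric u.
Proof.
move=> Lu uc; have mFu := cmeasurable_fourier1 Lu.1.
have N2E' v : cmeasurable v -> (forall x, ~ cube x -> v x = 0) -> N2 mu v = N2 leb v.
  move=> mv vc; apply: integral_cube_vanish; first exact/measurable_EFinP/measurable_sqr_normc.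
  by move=> x /vc ->; rewrite Normc.normc0 expr0n.
have key th : (\esum_(k in [set: Zd]) (normc (fourier1 u (th + zvec k)) ^+ 2)%:E = N2 leb u)%E.
  pose v x := u x * pairing x th.
  have mv : cmeasurable v.
    apply: cmeasurableM; first exact: Lu.1.
    by rewrite (_ : (fun x => _) = pairing th); [exact: cmeasurable_pairing|apply/funext => x; rewrite pairingC].
  have nv x : normc (v x) = normc (u x) by rewrite Normc.normcM normc_pairing mulr1.
  have vc x : ~ cube x -> v x = 0 by move=> /uc; rewrite /v => ->; rewrite mul0r.
  have Nv : N2 leb v = N2 leb u by apply: eq_integral => x _; rewrite nv.
  have Lv : L2 mu v by split => //; rewrite N2E'// Nv; case: Lu.
  rewrite -Nv -N2E'// -cube_parseval//.
  (* The transform pairs without conjugation whereas the inner product conjugates its first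
     argument; the frequencies are therefore reindexed by their opposites. *)
  have bij : set_bij [set: Zd]%classic [set: Zd]%classic -%R.
    by split => [//|x y _ _ /oppr_inj//|x _]; exists (- x) => //; rewrite opprK.
  rewrite [RHS](reindex_esum _ _ _ _ bij); apply: eq_esum => k _; congr ((normc _ ^+ 2)%:E).
  rewrite /ip /fourier1.
  have E : (fun x => (pairing (zvec (- k)) x)^* * v x) = (fun x => u x * pairing x (th + zvec k)).
    apply/funext => x; rewrite zvecN pairingNl pairingDr (pairingC x (zvec k)) /v.
    by rewrite [X in X * _ = _](_ : _ = pairing (zvec k) x); [ring|apply: complexP; rewrite !ReImE ?opprK].
  rewrite E; have mw : cmeasurable (fun x => u x * pairing x (th + zvec k)).
    rewrite -E; apply: cmeasurableM => //; apply: cmeasurable_conj; exact: cmeasurable_pairing.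
  rewrite /cintegral /Rintegral; congr (fine _ +i* fine _)%C; apply/esym/integral_cube_vanish;
    try (by apply/measurable_EFinP; case: mw); by move=> x /uc ->; rewrite mul0r.
rewrite /isometric [LHS]integral_unfold; last 2 first.
- exact/measurable_EFinP/measurable_sqr_normc.
- by move=> x; rewrite lee_fin sqr_ge0.
under eq_integral do rewrite key.
rewrite integral_cst//; last exact: measurable_unit_cube.
by rewrite [X in (_ * X)%E](@lebesgue_unit_cube R d) mule1.
Qed.

End plancherel.

(** * Plancherel's identity for integrable square-integrable functions *)

Section plancherel_extension.
Context {R : realType} {d : nat}.
Local Notation Rd := 'cV[R]_d.
Local Notation leb := (lebesgue_cV R d).
Local Notation cube := (@unit_cube R d).
Local Notation fn := (Rd -> R[i]).
Implicit Types (f g u v : fn).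

(** Half-open, so as to be an exact affine image of the unit cube when [N] is positive. *)
Definition box (N : nat) : set Rd := [set x | forall i, - N%:R <= x i ord0 < N%:R].
Definition trunc (N : nat) u : fn := fun x => (\1_(box N) x)%:C%C * u x.

Lemma measurable_box N : measurable (box N).
Proof.
rewrite (_ : box N = \bigcap_(i in [set: 'I_d]%classic)
    ((fun X : Rd => X i ord0) @^-1` `[- N%:R, N%:R[)); last first.
  apply/seteqP; split=> x /=; first by move=> H i _ /=; rewrite in_itv /= H.
  by move=> H i; have := H i Logic.I; rewrite /= in_itv.
apply: fin_bigcap_measurable => [|i _]; first exact: finite_finset.
by rewrite -[X in measurable X]setTI; apply: measurable_matrix_coord.
Qed.

Lemma le_box N M : (N <= M)%N -> box N `<=` box M.
Proof.
move=> NM x xN i; have /andP[h1 h2] := xN i; have : N%:R <= M%:R :> R by rewrite ler_nat.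
by move=> h; rewrite (lt_le_trans h2 h) (le_trans _ h1)// lerN2.
Qed.

Lemma box_exhausts (x : Rd) : exists N, forall n, (N <= n)%N -> box n x.
Proof.
exists (\sum_(i < d) (Num.truncn `|x i ord0|).+1)%N => n Nn i.
have : `|x i ord0| < n%:R.
  apply: lt_le_trans (truncnS_gt _) _; rewrite ler_nat (leq_trans _ Nn)//.
  by rewrite (bigD1 i)//= leq_addr.
by rewrite ltr_norml => /andP[h1 h2]; rewrite ltW.
Qed.

Lemma cmeasurable_trunc N u : cmeasurable u -> cmeasurable (trunc N u).
Proof.
by move=> mu; apply: cmeasurableM => //; apply: cmeasurable_real; apply: measurable_indic; exact: measurable_box.
Qed.

Lemma normc_trunc N u x : normc (trunc N u x) <= normc (u x).
Proof.
rewrite /trunc Normc.normcM /= expr0n addr0 sqrtr_sqr indicE.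
by case: (x \in box N); rewrite ?normr1 ?mul1r// normr0 mul0r normc_ge0.
Qed.

Lemma L2_trunc N u : L2 leb u -> L2 leb (trunc N u).
Proof.
by move=> Lu; apply: (le_L2 _ (normc_trunc N u) Lu); exact: cmeasurable_trunc Lu.1.
Qed.

Lemma cintegrable_trunc1 N u : cintegrable leb u -> cintegrable leb (trunc N u).
Proof.
move=> Iu; apply: (le_cintegrable _ (cintegrable_normc Iu)) => [|x]; last exact: normc_trunc.
by apply: cmeasurable_trunc; exact: cintegrable_cmeasurable Iu.
Qed.

Lemma trunc_out N u x : ~ box N x -> trunc N u x = 0.
Proof. by move=> xN; rewrite /trunc indicE memNset// mul0r. Qed.

Lemma trunc_in N u x : box N x -> trunc N u x = u x.
Proof. by move=> xN; rewrite /trunc indicE mem_set// mul1r. Qed.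

Lemma L2_cube_cintegrable v : L2 leb v -> (forall x, ~ cube x -> v x = 0) -> cintegrable leb v.
Proof.
move=> [mv voo] vc.
have h (F : Rd -> \bar R) := @integral_cube_vanish R d F.
have : cintegrable (@cube_measure R d) v.
  apply: L2_cube_integrable; split => //; rewrite /N2 h//.
    exact/measurable_EFinP/measurable_sqr_normc.
  by move=> x /vc ->; rewrite Normc.normc0 expr0n.
move=> /cintegrableP[_ vfin]; apply/cintegrableP; split => //; rewrite -h//.
  exact/measurable_EFinP/measurable_normc.
by move=> x /vc ->; rewrite Normc.normc0.
Qed.

(* The affine map [x |-> 2 N x - N] carries the unit cube onto [box N]. *)
Lemma box_cintegrable_isometric N u : (0 < N)%N -> L2 leb u -> (forall x, ~ box N x -> u x = 0) ->
  cintegrable leb u /\ isometric u.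
Proof.
move=> N0 Lu uN.
pose A : 'M[R]_d := (2 * N%:R)%:M; pose b : Rd := const_mx (- N%:R).
have nN : 0 < N%:R :> R by rewrite ltr0n.
have a0 : 0 < 2 * N%:R :> R by rewrite mulr_gt0.
have uA : A \in unitmx by rewrite unitmxE unitfE det_scalar expf_neq0// gt_eqF.
pose v x := u (x + b); pose w x := v (A *m x).
have Lv : L2 leb v by exact: L2_shift.
have Lw : L2 leb w by exact: L2_mulmx.
have wc x : ~ cube x -> w x = 0.
  move=> xc; apply: uN => xb; apply: xc => i; have := xb i.
  rewrite /A mul_scalar_mx !mxE => /andP[h1 h2].
  have h3 : 0 <= 2 * N%:R * x i ord0 by lra.
  have h4 : 2 * N%:R * x i ord0 < 2 * N%:R * 1 by lra.
  by rewrite pmulr_rge0// in h3; rewrite ltr_pM2l// in h4; rewrite h3 h4.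
have Iw : cintegrable leb w by exact: L2_cube_cintegrable.
have Iv : cintegrable leb v.
  have uA' : invmx A \in unitmx by rewrite unitmx_inv.
  apply: eq_cintegrable (cintegrable_mulmx uA' Iw) => x.
  by rewrite /w mulmxA mulmxV// mul1mx.
have Iu : cintegrable leb u.
  by apply: eq_cintegrable (cintegrable_shift (- b) Iv) => x; rewrite /v subrK.
split => //; apply: (@isometric_shift _ _ b) => //; apply: (@isometric_mulmx _ _ A) => //.
exact: isometric_cube.
Qed.

Lemma trunc_cvg u x : exists N, forall n, (N <= n)%N -> trunc n u x = u x.
Proof. by have [N HN] := box_exhausts x; exists N => n /HN; exact: trunc_in. Qed.

Lemma trunc_cvg_L2 u : L2 leb u -> forall eps : R, 0 < eps -> exists N, forall n, (N <= n)%N ->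
  nr leb (fun x => u x - trunc n u x) < eps.
Proof.
move=> Lu eps e0; have Ld n : L2 leb (fun x => u x - trunc n u x) by apply: L2B => //; exact: L2_trunc.
have c : Rintegral leb setT (fun x => normc (u x - trunc n u x) ^+ 2) @[n --> \oo] -->
    Rintegral leb setT (fun=> 0).
  apply: (@cvg_Rintegral _ _ _ leb _ _ (fun x => normc (u x) ^+ 2)).
  - by move=> n; apply: measurable_sqr_normc; case: (Ld n).
  - apply/integrableP; split; first by apply/measurable_EFinP; apply: measurable_sqr_normc; case: Lu.
    under eq_integral do rewrite /= ger0_norm ?sqr_ge0//.
    by case: Lu.
  - move=> n x; rewrite ger0_norm ?sqr_ge0// ler_pXn2r ?nnegrE ?normc_ge0//.
    have [xb|xb] := pselect (box n x); last by rewrite trunc_out// subr0.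
    by rewrite trunc_in// subrr Normc.normc0 normc_ge0.
  - move=> x; have [N HN] := trunc_cvg u x.
    apply: (@cvg_trans _ ((fun=> 0 : R) @ \oo)); last exact: cvg_cst.
    apply: near_eq_cvg; exists N => // n /= /HN ->.
    by rewrite subrr Normc.normc0 expr0n.
have E : Rintegral leb setT (fun=> 0 : R) = 0 by rewrite /Rintegral integral0.
rewrite E in c; have /cvgrPdist_lt/(_ (eps ^+ 2)) := c; rewrite exprn_gt0// => /(_ isT)[N _ HN].
exists N => n Nn; rewrite -(@ltr_pXn2r _ 2)// ?nnegrE ?nr_ge0 ?(ltW e0)//.
have := HN n Nn; rewrite /= sub0r normrN => /(le_lt_trans (ler_norm _)).
by congr (_ < _); rewrite /Rintegral -[X in fine X]/(N2 leb _) N2E.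
Qed.

Lemma fourier1_trunc_cvg u : cintegrable leb u -> forall xi,
  Re (fourier1 (trunc n u) xi) @[n --> \oo] --> Re (fourier1 u xi) /\
  Im (fourier1 (trunc n u) xi) @[n --> \oo] --> Im (fourier1 u xi).
Proof.
move=> Iu xi.
have mt n : cmeasurable (fun x => trunc n u x * pairing x xi).
  by apply: (@cintegrable_cmeasurable _ _ _ leb); apply: cintegrable_pairingM; exact: cintegrable_trunc1.
have nt n x : normc (trunc n u x * pairing x xi) <= normc (u x).
  by rewrite Normc.normcM normc_pairing mulr1 normc_trunc.
have Iu' : leb.-integrable setT (EFin \o (fun x => normc (u x))) by exact: cintegrable_normc.
split; apply: (@cvg_Rintegral _ _ _ leb _ _ (fun x => normc (u x))) => //.
- by move=> n; case: (mt n).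
- by move=> n x; rewrite (le_trans (normc_Re_le _)).
- move=> x; have [N HN] := trunc_cvg u x; apply: cvg_near_cst; exists N => // n /= /HN ->.
  by [].
- by move=> n; case: (mt n).
- by move=> n x; rewrite (le_trans (normc_Im_le _)).
- move=> x; have [N HN] := trunc_cvg u x; apply: cvg_near_cst; exists N => // n /= /HN ->.
  by [].
Qed.

(** The isometry is known on truncations. Fatou's lemma, with [n] fixed and [k] growing, bounds the
    distance between the transforms of [u] and of [trunc n u] by that between the functions
    themselves; square-integrability and equality of norms follow. *)
Theorem plancherel1 u : cintegrable leb u -> L2 leb u ->
  L2 leb (fourier1 u) /\ nr leb (fourier1 u) = nr leb u.
Proof.
move=> Iu Lu; have mFu := cmeasurable_fourier1 Lu.1.
have It n : cintegrable leb (trunc n u) by exact: cintegrable_trunc1.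
have Lt n : L2 leb (trunc n u) by exact: L2_trunc.
have mFt n := cmeasurable_fourier1 (Lt n).1.
have iso n v : (0 < n)%N -> L2 leb v -> (forall x, ~ box n x -> v x = 0) ->
    L2 leb (fourier1 v) /\ nr leb (fourier1 v) = nr leb v.
  move=> n0 Lv vn; have [_ iv] := box_cintegrable_isometric n0 Lv vn.
  split; last by rewrite /nr iv.
  by split; [apply: cmeasurable_fourier1; case: Lv|rewrite iv; case: Lv].
have key n : (0 < n)%N -> (N2 leb (fun xi => fourier1 u xi - fourier1 (trunc n u) xi)%R
    <= N2 leb (fun x => u x - trunc n u x)%R)%E.
  move=> n0; apply: (@fatou_le _ _ _ leb (fun k xi => normc (fourier1 (trunc k u) xi - fourier1 (trunc n u) xi) ^+ 2) _ _ n).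
  - by move=> k; apply: measurable_sqr_normc; exact: cmeasurableB.
  - by move=> *; exact: sqr_ge0.
  - by move=> xi; have [cR cI] := fourier1_trunc_cvg Iu xi; exact: cvg_sqr_normcB cR cI.
  - move=> k nk; rewrite -[leLHS]/(N2 leb (fun xi => fourier1 (trunc k u) xi - fourier1 (trunc n u) xi)).
    rewrite -fourier1B//; have LB : L2 leb (fun x => trunc k u x - trunc n u x) by exact: L2B.
    have [|LF nF] := iso k _ (leq_trans n0 nk) LB.
      move=> x xk; rewrite !trunc_out ?subrr// => xn; apply: xk; exact: le_box xn.
    rewrite N2E// nF -N2E//; apply: ge0_le_integral => //.
    + by move=> x _; rewrite lee_fin sqr_ge0.
    + by apply/measurable_EFinP/measurable_sqr_normc; case: LB.
    + by apply/measurable_EFinP/measurable_sqr_normc; apply: cmeasurableB; [case: Lu|case: (Lt n)].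
    + move=> x _; rewrite lee_fin ler_pXn2r ?nnegrE ?normc_ge0//.
      have [xn|xn] := pselect (box n x).
        by rewrite (trunc_in _ xn) (trunc_in _ (le_box nk xn)).
      by rewrite (trunc_out _ xn) !subr0 normc_trunc.
have LB n : L2 leb (fun x => u x - trunc n u x) by exact: L2B.
have LFB n : (0 < n)%N -> L2 leb (fun xi => fourier1 u xi - fourier1 (trunc n u) xi).
  move=> n0; split; first exact: cmeasurableB.
  by rewrite (le_lt_trans (key n n0))//; case: (LB n).
have LFt n : (0 < n)%N -> L2 leb (fourier1 (trunc n u)) /\ nr leb (fourier1 (trunc n u)) = nr leb (trunc n u).
  by move=> n0; apply: (iso n) => // x; exact: trunc_out.
have LFu : L2 leb (fourier1 u).
  rewrite (_ : fourier1 u = (fun xi => (fourier1 u xi - fourier1 (trunc 1 u) xi) + fourier1 (trunc 1 u) xi)).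
    by apply: L2D; [exact: LFB|case: (LFt 1%N)].
  by apply/funext => xi; rewrite subrK.
split => //; apply/eqP; rewrite -subr_eq0 -normr_le0; apply/ler_addgt0Pr => e e0; rewrite add0r.
have e2 : 0 < e / 2 by rewrite divr_gt0.
(* The shift by one makes the box nondegenerate, as the isometry on boxes demands. *)
have [N HN] := trunc_cvg_L2 Lu e2; pose n := N.+1.
have hn : nr leb (fun x => u x - trunc n u x) < e / 2 by apply: HN.
have [Ln nn] := LFt n isT.
have h1 : nr leb (fun xi => fourier1 u xi - fourier1 (trunc n u) xi) <= nr leb (fun x => u x - trunc n u x).
  have := key n isT; rewrite !N2E//; last exact: LFB.
  by rewrite lee_fin ler_pXn2r ?nnegrE ?nr_ge0.
have h2 := nr_dist LFu Ln; have h3 := nr_dist Lu (Lt n); rewrite nn in h2.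
have : `|nr leb (fourier1 u) - nr leb u| <= `|nr leb (fourier1 u) - nr leb (trunc n u)| + `|nr leb u - nr leb (trunc n u)|.
  rewrite (_ : _ - nr leb u = (nr leb (fourier1 u) - nr leb (trunc n u)) - (nr leb u - nr leb (trunc n u))); last by ring.
  exact: ler_normB.
move=> h4; apply: (le_trans h4); apply: (@le_trans _ _ (e / 2 + e / 2)); last by rewrite -splitr.
by apply: lerD; [apply: (le_trans h2); apply: (le_trans h1); exact: ltW|apply: (le_trans h3); exact: ltW].
Qed.

End plancherel_extension.

(** * The transform on L^2 as a relation *)

Section fourier_transform.
Context {R : realType} {d : nat}.
Local Notation Rd := 'cV[R]_d.
Local Notation leb := (lebesgue_cV R d).
Local Notation fn := (Rd -> R[i]).
Local Notation nr := (nr leb).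
Implicit Types (f g u v : fn) (w : nat -> fn).

Lemma Lp2P f : Lp 2%:E f <-> L2 leb f.
Proof. by rewrite L2P. Qed.

Lemma Lp1P f : Lp 1%:E f <-> cintegrable leb f.
Proof.
have E : cLnorm leb 1%:E f = (\int[leb]_x (normc (f x))%:E)%E.
  rewrite /cLnorm Lnorm1; apply: eq_integral => x _.
  by rewrite gee0_abs// lee_fin normc_ge0.
by rewrite /Lp /= E; apply: iff_sym; exact: cintegrableP.
Qed.

Lemma L2distE f g : L2 leb f -> L2 leb g -> L2dist f g = (nr (fun x => f x - g x))%:E.
Proof. by move=> Lf Lg; rewrite /L2dist cLnorm2E//; exact: L2B. Qed.

Lemma cvg_L2dist w f : (forall n, L2 leb (w n)) -> L2 leb f ->
  (L2dist (w k) f @[k --> \oo] --> 0%E) <->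
  forall eps : R, 0 < eps -> exists N, forall n, (N <= n)%N -> nr (fun x => w n x - f x) < eps.
Proof.
move=> Lw Lf; rewrite (_ : (fun k => L2dist (w k) f) = EFin \o (fun k => nr (fun x => w k x - f x))); last first.
  by apply/funext => k; rewrite /= L2distE.
split=> [/fine_cvgP[_ /cvgrPdist_lt c] eps /c[N _ HN]|c].
  exists N => n /HN; rewrite /= sub0r normrN; exact: le_lt_trans (ler_norm _).
apply: cvg_EFin; first exact: nearW.
apply/cvgrPdist_lt => eps /c[N HN]; exists N => // n /= /HN.
by rewrite sub0r normrN ger0_norm ?nr_ge0.
Qed.

(** Merges the two limits of the definition into a single rank. [plancherel1] puts the transforms of
    the approximants in L^2, so that distances become real norms. *)
Lemma is_fourierP f g : L2 leb f ->
  is_fourier f g <-> L2 leb g /\ exists w, [/\ forall k, cintegrable leb (w k), forall k, L2 leb (w k) &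
    forall eps : R, 0 < eps -> exists N, forall n, (N <= n)%N ->
      nr (fun x => w n x - f x) < eps /\ nr (fun x => fourier1 (w n) x - g x) < eps].
Proof.
move=> Lf; split=> [[/Lp2P Lg [w [Lw wf wg]]]|[Lg [w [Iw Lw c]]]].
  split => //; have Iw k : cintegrable leb (w k) by apply/Lp1P; case: (Lw k).
  have L2w k : L2 leb (w k) by apply/Lp2P; case: (Lw k).
  exists w; split => // eps e0.
  have LFw k : L2 leb (fourier1 (w k)) by case: (plancherel1 (Iw k) (L2w k)).
  have /(_ eps e0)[N1 H1] := (cvg_L2dist L2w Lf).1 wf.
  have /(_ eps e0)[N2 H2] := (cvg_L2dist LFw Lg).1 wg.
  exists (maxn N1 N2) => n; rewrite geq_max => /andP[h1 h2].
  by split; [exact: H1|exact: H2].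
have LFw k : L2 leb (fourier1 (w k)) by case: (plancherel1 (Iw k) (Lw k)).
split; first exact/Lp2P.
exists w; split.
- by move=> k; split; [apply/Lp1P|apply/Lp2P].
- apply/(cvg_L2dist Lw Lf) => eps /c[N HN]; exists N => n /HN; exact: proj1.
- apply/(cvg_L2dist LFw Lg) => eps /c[N HN]; exists N => n /HN; exact: proj2.
Qed.

Lemma is_fourier_L2 f g : is_fourier f g -> L2 leb g.
Proof. by case=> /Lp2P. Qed.

Lemma is_fourier_nr f g : L2 leb f -> is_fourier f g -> nr g = nr f.
Proof.
move=> Lf /(is_fourierP _ Lf)[Lg [w [Iw Lw c]]].
apply/eqP; rewrite -subr_eq0 -normr_le0; apply/ler_addgt0Pr => e e0; rewrite add0r.
have e2 : 0 < e / 2 by rewrite divr_gt0.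
have [N /(_ N (leqnn N))[h1 h2]] := c _ e2.
have [LF nF] := plancherel1 (Iw N) (Lw N).
have h3 := nr_dist (Lw N) Lf; have h4 := nr_dist LF Lg; rewrite nF in h4.
rewrite (_ : nr g - nr f = (nr (w N) - nr f) - (nr (w N) - nr g)); last by ring.
rewrite (le_trans (ler_normB _ _))// [leRHS]splitr lerD//; apply: ltW.
  exact: le_lt_trans h3 h1.
exact: le_lt_trans h4 h2.
Qed.

Lemma is_fourier_lin (a : R[i]) f f' g g' : L2 leb f -> L2 leb f' ->
  is_fourier f g -> is_fourier f' g' -> is_fourier (fun x => a * f x + f' x) (fun x => a * g x + g' x).
Proof.
move=> Lf Lf' /(is_fourierP _ Lf)[Lg [w [Iw Lw c]]] /(is_fourierP _ Lf')[Lg' [w' [Iw' Lw' c']]].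
apply/is_fourierP; first by apply: L2D => //; exact: L2Z.
split; first by apply: L2D => //; exact: L2Z.
exists (fun k x => a * w k x + w' k x); split.
- by move=> k; apply: cintegrableD => //; exact: cintegrableZ.
- by move=> k; apply: L2D => //; exact: L2Z.
(* [normc a + 1] is divided by instead of [normc a], which may be 0. *)
move=> eps e0; have a0 : 0 < normc a + 1 by rewrite ltr_wpDl ?normc_ge0.
have e1 : 0 < eps / 2 / (normc a + 1) by rewrite !divr_gt0.
have e2 : 0 < eps / 2 by rewrite divr_gt0.
have [N1 H1] := c _ e1; have [N2 H2] := c' _ e2.
have key p p' q q' : L2 leb p -> L2 leb p' -> L2 leb q -> L2 leb q' ->
    nr (fun x => p x - q x) < eps / 2 / (normc a + 1) -> nr (fun x => p' x - q' x) < eps / 2 ->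
    nr (fun x => (a * p x + p' x) - (a * q x + q' x)) < eps.
  move=> Lp Lp' Lq Lq' h1 h2.
  have L1 : L2 leb (fun x => p x - q x) by exact: L2B.
  have L1' : L2 leb (fun x => p' x - q' x) by exact: L2B.
  rewrite (_ : (fun x => _) = (fun x => a * (p x - q x) + (p' x - q' x))); last first.
    by apply/funext => x; ring.
  rewrite (le_lt_trans (nrD (L2Z a L1) L1'))// [ltRHS]splitr ler_ltD// nrZ//.
  move: h1; rewrite ltr_pdivlMr// => /ltW; apply: le_trans.
  by rewrite mulrC ler_wpM2l ?nr_ge0// lerDl.
exists (maxn N1 N2) => n; rewrite geq_max => /andP[/H1[h1 h2] /H2[h3 h4]].
have [LF _] := plancherel1 (Iw n) (Lw n); have [LF' _] := plancherel1 (Iw' n) (Lw' n).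
by split; [exact: key|rewrite fourier1_lin//; exact: key].
Qed.

(** The combination [-1 f + f] provides 0 as a transform of the zero function, after which linearity
    applies. *)
Lemma is_fourierZ (a : R[i]) f g : L2 leb f -> is_fourier f g ->
  is_fourier (fun x => a * f x) (fun x => a * g x).
Proof.
move=> Lf fg; have := is_fourier_lin (-1) Lf Lf fg fg.
rewrite (_ : (fun x => -1 * f x + f x) = (fun=> 0)); last by apply/funext => x; ring.
rewrite (_ : (fun x => -1 * g x + g x) = (fun=> 0)); last by apply/funext => x; ring.
move=> /(is_fourier_lin a Lf (L2_cst0 leb) fg).
by under eq_fun do rewrite addr0; under [X in is_fourier _ X]eq_fun do rewrite addr0.
Qed.

(** The truncations converge to [f] and their transforms form a Cauchy sequence by [plancherel1];
    completeness provides the limit. *)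
Lemma is_fourier_ex f : L2 leb f -> exists g, is_fourier f g.
Proof.
move=> Lf; pose w k := trunc k.+1 f.
have Lw k : L2 leb (w k) by exact: L2_trunc.
have Iw k : cintegrable leb (w k).
  by have [] := @box_cintegrable_isometric _ _ k.+1 (w k) isT (Lw k) (fun x => @trunc_out _ _ _ _ x).
have LFw k : L2 leb (fourier1 (w k)) by case: (plancherel1 (Iw k) (Lw k)).
have wc eps : 0 < eps -> exists N, forall n, (N <= n)%N -> nr (fun x => w n x - f x) < eps.
  move=> /(trunc_cvg_L2 Lf)[N HN]; exists N => n Nn.
  by rewrite nrBC; apply: HN; exact: leqW.
have [|g Lg gc] := @riesz_fischer _ _ _ leb (fun k => fourier1 (w k)) LFw.
  move=> eps e0; have e2 : 0 < eps / 2 by rewrite divr_gt0.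
  have [N HN] := wc _ e2; exists N => m n Nm Nn.
  rewrite -fourier1B// (plancherel1 _ _).2; [|exact: cintegrableB|exact: L2B].
  apply: le_lt_trans (nr_sub_le (Lw _) (Lw _) Lf) _.
  by rewrite [ltRHS]splitr; apply: ltrD; [exact: HN|rewrite nrBC; exact: HN].
exists g; apply/is_fourierP => //; split => //; exists w; split => // eps e0.
have [N1 H1] := wc _ e0; have [N2 H2] := gc _ e0.
exists (maxn N1 N2) => n; rewrite geq_max => /andP[h1 h2].
by split; [exact: H1|exact: H2].
Qed.

Lemma fourierP f : L2 leb f -> is_fourier f (fourier f).
Proof. by move=> /is_fourier_ex[g fg]; exact: (xgetPex _ (ex_intro _ g fg)). Qed.

(** Polarisation: preservation of the norm of a sum gives the real part, and multiplication by i
    transfers the imaginary part to it. *)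
Lemma is_fourier_ip f f' g g' : L2 leb f -> L2 leb f' -> is_fourier f g -> is_fourier f' g' ->
  ip leb g g' = ip leb f f'.
Proof.
move=> Lf Lf' fg fg'; have Lg := is_fourier_L2 fg; have Lg' := is_fourier_L2 fg'.
have key p q : L2 leb p -> is_fourier p q -> Re (ip leb q g') = Re (ip leb p f').
  move=> Lp pq; have Lq := is_fourier_L2 pq.
  have := is_fourier_lin 1 Lp Lf' pq fg'.
  rewrite (_ : (fun x => 1 * p x + f' x) = (fun x => p x + f' x)); last by apply/funext => x; ring.
  rewrite (_ : (fun x => 1 * q x + g' x) = (fun x => q x + g' x)); last by apply/funext => x; ring.
  move=> /(is_fourier_nr (L2D Lp Lf')) h.
  have := sqr_nrD Lp Lf'; rewrite -h sqr_nrD// (is_fourier_nr Lp pq) (is_fourier_nr Lf' fg').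
  by move=> E; lra.
apply: complexP; first exact: key.
rewrite !Im_ip//; apply: key; first exact: L2Z.
exact: is_fourierZ.
Qed.

End fourier_transform.

(** * Translations and dilations on the Fourier side *)

Section fourier_intertwining.
Context {R : realType} {d : nat}.
Local Notation Rd := 'cV[R]_d.
Local Notation leb := (lebesgue_cV R d).
Local Notation fn := (Rd -> R[i]).
Local Notation nr := (nr leb).
Implicit Types (f g : fn) (A : 'M[R]_d).

(** Two isometries intertwined by [fourier1] on integrable functions carry an approximating sequence
    for [f] to one for [S f], hence are intertwined by its L^2 extension. *)
Lemma is_fourier_map (S T : fn -> fn) f g :
  (forall u, cintegrable leb u -> cintegrable leb (S u)) ->
  (forall u, L2 leb u -> L2 leb (S u) /\ nr (S u) = nr u) ->
  (forall u, L2 leb u -> L2 leb (T u) /\ nr (T u) = nr u) ->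
  (forall u v, (fun x => S u x - S v x) = S (fun x => u x - v x)) ->
  (forall u v, (fun x => T u x - T v x) = T (fun x => u x - v x)) ->
  (forall u, cintegrable leb u -> fourier1 (S u) = T (fourier1 u)) ->
  L2 leb f -> is_fourier f g -> is_fourier (S f) (T g).
Proof.
move=> SI S2 T2 SB TB ST Lf /(is_fourierP _ Lf)[Lg [w [Iw Lw c]]].
apply/is_fourierP; first exact: (S2 _ Lf).1.
split; first exact: (T2 _ Lg).1.
exists (fun k => S (w k)); split=> [k|k|eps /c[N HN]]; [exact: SI|exact: (S2 _ (Lw k)).1|].
exists N => n /HN[h1 h2]; have LF := (plancherel1 (Iw n) (Lw n)).1.
by rewrite ST// SB TB (S2 _ (L2B (Lw n) Lf)).2 (T2 _ (L2B LF Lg)).2.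
Qed.

Lemma L2_translate gamma f : L2 leb f -> L2 leb (translate gamma f).
Proof. exact: L2_shift. Qed.

Lemma is_fourier_translate gamma f g : L2 leb f -> is_fourier f g ->
  is_fourier (translate gamma f) (fun xi => pairing (zvec gamma) xi * g xi).
Proof.
apply: (is_fourier_map (S := translate gamma) (T := fun g xi => pairing (zvec gamma) xi * g xi)).
- by move=> u; exact: cintegrable_shift.
- by move=> u Lu; split; [exact: L2_shift|rewrite /nr N2_shift//; case: Lu].
- have E u xi : normc (pairing (zvec gamma) xi * u xi) = normc (u xi).
    by rewrite Normc.normcM normc_pairing mul1r.
  move=> u Lu; split; last by apply: eq_nr; apply: eq_integral => xi _; rewrite E.
  apply: (le_L2 _ _ Lu); last by move=> xi; rewrite E.
  by apply: cmeasurableM; [exact: cmeasurable_pairing|case: Lu].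
- by [].
- by move=> u v; apply/funext => xi; rewrite mulrBr.
- move=> u Iu; rewrite /translate fourier1_shift//; apply/funext => xi.
  by rewrite pairingNl; congr (_ * _); apply: complexP; rewrite !ReImE ?opprK.
Qed.

Lemma scaled_mulmx_isometry (a : R) A f : A \in unitmx -> a ^+ 2 = `|\det A| -> L2 leb f ->
  L2 leb (fun x => a%:C%C * f (A *m x)) /\ nr (fun x => a%:C%C * f (A *m x)) = nr f.
Proof.
move=> uA aA Lf; split; first by apply: L2Z; exact: L2_mulmx.
apply: eq_nr; rewrite N2Z; last by case: (L2_mulmx uA Lf).
rewrite N2_mulmx//; last by case: Lf.
rewrite muleA -EFinM (_ : _ * _ = 1) ?mul1e//.
have -> : normc a%:C%C ^+ 2 = `|\det A|.
  by rewrite -aA /= expr0n addr0 sqrtr_sqr real_normK// num_real.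
by rewrite mulfV// normr_eq0 -unitfE -unitmxE.
Qed.

(** [a ^+ 2 = |det A|] makes the dilation an isometry; then [b = a^-1] equals [a |det A|^-1], the
    factor that the change of variables produces on the Fourier side. *)
Lemma is_fourier_scaled_mulmx (a b : R) A f g : A \in unitmx -> a ^+ 2 = `|\det A| -> a * b = 1 ->
  L2 leb f -> is_fourier f g ->
  is_fourier (fun x => a%:C%C * f (A *m x)) (fun xi => b%:C%C * g ((invmx A)^T *m xi)).
Proof.
move=> uA aA ab; have uA' : (invmx A)^T \in unitmx by rewrite unitmx_tr unitmx_inv.
have a0 : a != 0 by apply: contra_eq_neq ab => ->; rewrite mul0r eq_sym oner_eq0.
have bV : b = a^-1 by rewrite -[LHS]mul1r -(mulVf a0) -mulrA ab mulr1.
have bE : b = a * `|\det A|^-1 by rewrite -aA expr2 invfM mulrA mulfV// mul1r.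
apply: (is_fourier_map (S := fun f x => a%:C%C * f (A *m x)) (T := fun g xi => b%:C%C * g ((invmx A)^T *m xi))).
- by move=> u Iu; apply: cintegrableZ; exact: cintegrable_mulmx.
- by move=> u; exact: scaled_mulmx_isometry.
- move=> u; apply: scaled_mulmx_isometry => //.
  by rewrite det_tr det_inv normfV -aA -exprVn bV.
- by move=> u v; apply/funext => x; rewrite mulrBr.
- by move=> u v; apply/funext => x; rewrite mulrBr.
- move=> u Iu; apply/funext => xi.
  rewrite {1}/fourier1; under [X in cintegral _ X]eq_fun do rewrite -mulrA.
  rewrite cintegralZ; last by apply: cintegrable_pairingM; exact: cintegrable_mulmx.
  by rewrite -/(fourier1 _ _) fourier1_mulmx// mulrA bE rmorphM.
Qed.

Variable D : 'M[int]_d.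
Hypothesis uD : @DR R d D \in unitmx.
Local Notation m := (@absdet R d D).
Local Notation Q := (@DR R d D)^T.

Let m0 : 0 < m := absdet_gt0 uD.

Let sm0 : Num.sqrt m != 0. Proof. by rewrite gt_eqF// sqrtr_gt0. Qed.

Lemma dil_fourier f g : L2 leb f -> is_fourier f g ->
  L2 leb (dil D f) /\ is_fourier (dil D f) (hdil D g).
Proof.
move=> Lf fg; have h : Num.sqrt m ^+ 2 = `|\det (@DR R d D)| by rewrite sqr_sqrtr ?ltW// absdetE.
split; first exact: (scaled_mulmx_isometry uD h Lf).1.
by rewrite /hdil -trmx_inv; apply: is_fourier_scaled_mulmx => //; rewrite mulfV.
Qed.

Lemma dilV_fourier f g : L2 leb f -> is_fourier f g ->
  L2 leb (dilV D f) /\ is_fourier (dilV D f) (hdilV D g).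
Proof.
have uV : invmx (@DR R d D) \in unitmx by rewrite unitmx_inv.
move=> Lf fg; have h : (Num.sqrt m)^-1 ^+ 2 = `|\det (invmx (@DR R d D))|.
  by rewrite det_inv normfV exprVn sqr_sqrtr ?ltW// absdetE.
split; first exact: (scaled_mulmx_isometry uV h Lf).1.
by rewrite /hdilV -[@DR R d D in X in is_fourier _ X]invmxK; apply: is_fourier_scaled_mulmx => //; rewrite mulVf.
Qed.

Lemma dilz_fourier n f g : L2 leb f -> is_fourier f g ->
  L2 leb (dilz D n f) /\ is_fourier (dilz D n f) (hdilz D n g).
Proof.
move=> Lf fg; case: n => k; rewrite /dilz /hdilz /=.
  by elim: k => [|k [IH1 IH2]] //=; exact: dil_fourier.
apply: (fun h => dilV_fourier h.1 h.2).
by elim: k => [|k [IH1 IH2]] //=; exact: dilV_fourier.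
Qed.

(** [hdilz D n] is a scalar times composition with a matrix power, so a factor [h] is merely
    composed with that power. This turns the character produced by a translation into [chi] composed
    with [iota_n]. *)
Lemma hdilzM n (h : fn) g :
  hdilz D n (fun xi => h xi * g xi) = (fun xi => h (mxpow Q (- n) *m xi) * hdilz D n g xi).
Proof.
have uQ : Q \in unitmx by rewrite unitmx_tr.
have S k xi : mxpow Q (- k%:Z) *m (invmx Q *m xi) = mxpow Q (- k.+1%:Z) *m xi.
  rewrite mulmxA -addn1 PoszD opprD mxpowD//; congr (_ *m _ *m _).
  by rewrite /mxpow /= mulmx1.
have P k xi : mxpow Q k%:Z *m (Q *m xi) = mxpow Q k.+1%:Z *m xi.
  by rewrite mulmxA -addn1 PoszD mxpowD// mxpow1.
case: n => k; rewrite /hdilz.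
  elim: k => [|k IH] /=; first by apply/funext => xi; rewrite mul1mx.
  by rewrite [iter k _ _]IH; apply/funext => xi; rewrite /hdil S mulrCA.
suff H : iter k.+1 (hdilV D) (fun xi => h xi * g xi) =
    (fun xi => h (mxpow Q k.+1%:Z *m xi) * iter k.+1 (hdilV D) g xi) by exact: H.
elim: k => [|k IH]; first by apply/funext => xi; rewrite /= /hdilV mulrCA /mxpow /= mulmx1.
by rewrite iterS IH [in RHS]iterS; apply/funext => xi; rewrite /hdilV P mulrCA.
Qed.

Lemma wavelet_fourier n gamma f : L2 leb f ->
  L2 leb (dilz D n (translate gamma f)) /\
  is_fourier (dilz D n (translate gamma f)) (circ D n (hdilz D n (fourier f)) (chi gamma)).
Proof.
move=> Lf; have := dilz_fourier n (L2_translate gamma Lf) (is_fourier_translate gamma Lf (fourierP Lf)).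
rewrite hdilzM (_ : (fun xi => _) = circ D n (hdilz D n (fourier f)) (chi gamma))//.
by apply/funext => xi; rewrite /circ chi_iota// mulrC.
Qed.

End fourier_intertwining.

(** * Orthonormal systems in the modules Y_n *)

Section bracket_systems.
Context {R : realType} {d : nat} (D : 'M[int]_d).
Local Notation Rd := 'cV[R]_d.
Local Notation Zd := 'cV[int]_d.
Local Notation leb := (lebesgue_cV R d).
Local Notation haar := (@haar R d).
Local Notation mu := (@cube_measure R d).
Local Notation torus := (torus R d).
Local Notation DR := (@DR R d D).
Local Notation Q := DR^T.
Hypothesis uD : DR \in unitmx.
Implicit Types (p q f : Rd -> R[i]) (u v w : torus -> R[i]).

Lemma N2_haar u : cmeasurable u -> N2 haar u = N2 mu (u \o @torus_pi R d).
Proof.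
move=> mu_; rewrite /N2 ge0_integral_haar//; first exact/measurable_EFinP/measurable_sqr_normc.
by move=> z; rewrite lee_fin sqr_ge0.
Qed.

Lemma L2_haar u : cmeasurable u -> L2 haar u <-> L2 mu (u \o @torus_pi R d).
Proof.
move=> mu_; split=> -[_ h]; split; rewrite -?N2_haar// ?N2_haar//.
Qed.

Lemma chi_pi k : @chi R d k \o @torus_pi R d = pairing (zvec k).
Proof. by apply/funext => x; rewrite /= chiE. Qed.

Lemma L2_chi k : L2 haar (chi k).
Proof. by apply/L2_haar; [exact: cmeasurable_chi|rewrite chi_pi; exact: L2_pairing]. Qed.

Lemma cintegral_chi k : cintegral haar (chi k) = (k == 0)%:R.
Proof.
rewrite cintegral_haar ?chi_pi ?cintegral_pairing//.
have := cintegrable_ip (L2_chi 0) (L2_chi k); apply: eq_cintegrable => z.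
by rewrite chi0 rmorph1 mul1r.
Qed.

Lemma ip_chi k l : ip haar (chi k) (chi l) = (k == l)%:R.
Proof.
rewrite /ip (_ : (fun z => _) = chi (l - k)); last first.
  by apply/funext => z; rewrite chiD chiN mulrC.
by rewrite cintegral_chi subr_eq0 eq_sym.
Qed.

Lemma torus_characters_dense u : L2 haar u -> forall eps : R, 0 < eps ->
  exists (s : seq Zd) (c : Zd -> R[i]), nr haar (fun z => u z - \sum_(k <- s) c k * chi k z) < eps.
Proof.
move=> Lu eps e0; have mu_ := Lu.1.
have [s [c sc]] := cube_characters_dense ((L2_haar mu_).1 Lu) e0.
exists s, c; have LS : L2 haar (fun z => u z - \sum_(k <- s) c k * chi k z).
  by apply: L2B => //; apply: L2_lincomb => k; exact: L2_chi.
rewrite /nr N2_haar; last by case: LS.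
rewrite (_ : _ \o _ = (fun x => (u \o @torus_pi R d) x - \sum_(k <- s) c k * pairing (zvec k) x))//.
by apply/funext => x /=; congr (_ - _); apply: eq_bigr => k _; rewrite chiE.
Qed.

(** By [ip_circ] the hypothesis prescribes all Fourier coefficients of the integrable bracket, and
    they are those of the constant [c]. *)
Lemma chi_circ_orthogonal n p q (c : R[i]) : L2 leb p -> L2 leb q ->
  (forall k, L2 leb (circ D n p (chi k))) ->
  (forall k, ip leb (circ D n p (chi k)) q = (k == 0)%:R * c) ->
  {ae haar, forall z, bracket D n p q z = c}.
Proof.
move=> Lp Lq Lc pq; have Ib : cintegrable haar (bracket D n p q).
  by rewrite bracketE; apply: cintegrable_fiber_sum => //; exact: cintegrable_ip.
have I1 : cintegrable haar (chi 0 : torus -> R[i]).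
  have := cintegrable_ip (L2_chi 0) (L2_chi 0); apply: eq_cintegrable => z.
  by rewrite chi0 rmorph1 mul1r.
have Ic : cintegrable haar (fun z : torus => c) .
  by apply: eq_cintegrable (cintegrableZ c I1) => z; rewrite chi0 mulr1.
suff : {ae haar, forall z, bracket D n p q z - c = 0}.
  by apply: filterS => z /eqP; rewrite subr_eq0 => /eqP.
apply: torus_fourier_unique; first exact: cintegrableB.
move=> k; have Ichi v : cintegrable haar v -> cintegrable haar (fun z => chi k z * v z).
  move=> Iv; apply: (@le_cintegrable _ _ _ _ _ (fun z => normc (v z))).
  - by apply: cmeasurableM; [exact: cmeasurable_chi|exact: cintegrable_cmeasurable Iv].
  - exact: cintegrable_normc.
  - by move=> z; rewrite Normc.normcM normc_chi mul1r.
have E : (fun z => chi k z * (bracket D n p q z - c)) =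
    (fun z => (chi (- k) z)^* * bracket D n p q z + (- c) * chi k z).
  apply/funext => z; rewrite chiN mulrBr mulNr (mulrC c); congr (_ * _ - _).
  by apply: complexP; rewrite !ReImE ?opprK.
have Ik : cintegrable haar (chi k : torus -> R[i]).
  by apply: eq_cintegrable (Ichi _ I1) => z; rewrite chi0 mulr1.
rewrite E cintegralD; last 2 first.
- apply: eq_cintegrable (Ichi _ Ib) => z; rewrite chiN; congr (_ * _).
  by apply: complexP; rewrite !ReImE ?opprK.
- exact: cintegrableZ.
rewrite cintegralZ// cintegral_chi -ip_circ//; last exact: cmeasurable_chi.
by rewrite pq oppr_eq0 mulNr mulrC subrr.
Qed.

Lemma circ_chi0 n p : circ D n p (chi 0) = p.
Proof. by apply/funext => x; rewrite /circ chi0 mulr1. Qed.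

(* For k <= n the map iota_k factors through iota_n, because D is an integer matrix. *)
Lemma iota_factor (k : nat) n u : cmeasurable u ->
  exists2 v, cmeasurable v & forall x, u (iota_n D (n - k%:Z) x) = v (iota_n D n x).
Proof.
move=> mu_; have uQ : Q \in unitmx by rewrite unitmx_tr.
pose v (z : torus) := u (torus_pi (mxpow Q k%:Z *m repr z)).
have intQ l : exists l', mxpow Q k%:Z *m zvec l = zvec l' :> Rd.
  elim: {v} k => [|j [l' E]]; first by exists l; rewrite /mxpow /= mul1mx.
  exists (D^T *m l'); rewrite (_ : mxpow Q j.+1%:Z = Q *m mxpow Q j%:Z)// -mulmxA E.
  by rewrite /zvec map_mxM map_trmx.
have vE x : v (torus_pi x) = u (torus_pi (mxpow Q k%:Z *m x)).
  have /torus_piP[l E] : torus_pi (repr (torus_pi x)) = torus_pi x by rewrite /torus_pi reprK.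
  have [l' El'] := intQ l; rewrite /v E mulmxDr El'; congr u.
  by apply/torus_piP; exists l'.
exists v.
  apply: cmeasurable_torusP; rewrite (_ : _ \o _ = (u \o @torus_pi R d) \o mulmx (mxpow Q k%:Z)).
    by apply: cmeasurable_comp; [exact: cmeasurable_comp_pi|exact: measurable_mulmx].
  by apply/funext => x; rewrite /= vE.
by move=> x; rewrite !iota_nE// vE mulmxA -mxpowD// opprB addrC.
Qed.

(** The factor [w] at the lower level is also a function of [iota_n]. The integrand is thus a
    function of [iota_n] times a product whose fibre sums at level [n] vanish. *)
Lemma ip_circ_zero (k : nat) n p q u w : L2 leb p -> L2 leb q -> cmeasurable u -> cmeasurable w ->
  L2 leb (circ D n p u) -> L2 leb (circ D (n - k%:Z) q w) ->
  {ae haar, forall z, bracket D n p q z = 0} ->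
  ip leb (circ D n p u) (circ D (n - k%:Z) q w) = 0.
Proof.
move=> Lp Lq mu_ mw Lpu Lqw pq0; have [v mv vE] := iota_factor k n mw.
have muv : cmeasurable (fun z => (u z)^* * v z) by apply: cmeasurableM => //; exact: cmeasurable_conj.
have E : (fun x => (circ D n p u x)^* * circ D (n - k%:Z) q w x) =
    (fun x => ((u (iota_n D n x))^* * v (iota_n D n x)) * ((p x)^* * q x)).
  by apply/funext => x; rewrite /circ vE; apply: complexP; rewrite !ReImE; ring.
have := cintegrable_ip Lpu Lqw; rewrite E => Iu.
have [Ih Eh] := cintegral_fiber_sumM uD (cintegrable_ip Lp Lq) muv Iu.
rewrite /ip E Eh -[RHS](ip0r haar (fun=> 0)) /ip; apply: ae_eq_cintegral.
- exact: cintegrable_cmeasurable Ih.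
- by rewrite (_ : (fun z => _) = (fun=> 0)); [exact: cmeasurable_cst|apply/funext => z; rewrite mulr0].
- by apply: filterS pq0 => z; rewrite bracketE => ->; rewrite !mulr0.
Qed.

(** * Abstract systems of generators, each with its level *)

Section orthonormal_system.
Variables (B : choiceType) (lev : B -> int) (p : B -> Rd -> R[i]).
Hypothesis Lp : forall b, L2 leb (p b).
Hypothesis pE : forall b b', {ae haar, forall z, bracket D (lev b) (p b) (p b') z = (b == b')%:R}.
Local Notation C b u := (circ D (lev b) (p b) u).

Let p1 b : {ae haar, forall z, bracket D (lev b) (p b) (p b) z = 1}.
Proof. by apply: filterS (pE b b) => z; rewrite eqxx. Qed.

Let LC b u : L2 haar u -> L2 leb (C b u).
Proof. by move=> Lu; exact: (L2_circ uD (Lp b) (p1 b)). Qed.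

(** For equal indices the bracket of [p b] with [p b o w] is [w]. For distinct ones the comparison
    is made at the larger of the two levels, and conjugate symmetry provides the other order. *)
Lemma ip_system b b' u w : L2 haar u -> L2 haar w ->
  ip leb (C b u) (C b' w) = (b == b')%:R * ip haar u w.
Proof.
move=> Lu Lw; have [<-|bb'] := eqVneq b b'.
  have LCw := LC b Lw.
  rewrite mul1r ip_circ//; last 2 first; [by case: Lu|exact: LC|].
  apply: ae_eq_cintegral.
  - apply: cmeasurableM; first by apply: cmeasurable_conj; case: Lu.
    by case: (bracket_L2 uD (Lp b) (p1 b) LCw).
  - by apply: cmeasurableM; [apply: cmeasurable_conj; case: Lu|case: Lw].
  have I1 := cintegrable_ip (Lp b) (Lp b).
  have := ae_fiber_summable uD (lev b) I1; apply: filterS2 (p1 b) => z pz zoo.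
  congr (_ * _); rewrite bracketE.
  rewrite (_ : (fun x => _) = (fun x => w (iota_n D (lev b) x) * ((p b x)^* * p b x))); last first.
    by apply/funext => x; rewrite /circ; ring.
  by rewrite fiber_sumM// -bracketE pz mulr1.
rewrite mul0r.
have key a a' v v' : a != a' -> (lev a' <= lev a) -> L2 haar v -> L2 haar v' -> ip leb (C a v) (C a' v') = 0.
  move=> aa' le Lv Lv'; have [k E] : exists k : nat, lev a' = lev a - k%:Z.
    by exists `|lev a - lev a'|%N; rewrite gez0_abs ?subr_ge0// opprB addrCA subrr addr0.
  have := LC a' Lv'; rewrite E => LC'; apply: ip_circ_zero => //; try exact: LC; [by case: Lv|by case: Lv'|].
  by apply: filterS (pE a a') => z; rewrite (negbTE aa').
have [le|/ltW le] := leP (lev b') (lev b); first exact: key.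
by rewrite (ipC (LC b' Lw) (LC b Lu)) key ?rmorph0// eq_sym.
Qed.

Lemma ip_system_chi b b' k l : ip leb (C b (chi k)) (C b' (chi l)) = ((b, k) == (b', l))%:R.
Proof.
by rewrite ip_system ?ip_chi; [rewrite -natrM mulnb xpair_eqE|exact: L2_chi|exact: L2_chi].
Qed.

Local Notation P b f := (C b (bracket D (lev b) (p b) f)).

Lemma L2_proj b f : L2 leb f -> L2 leb (P b f).
Proof. by move=> Lf; apply: LC; apply: bracket_L2. Qed.

Lemma ip_proj b u f : L2 haar u -> L2 leb f -> ip leb (C b u) (P b f) = ip leb (C b u) f.
Proof.
move=> Lu Lf; rewrite ip_system//; last exact: bracket_L2.
by rewrite eqxx mul1r ip_circ//; [case: Lu|exact: LC].
Qed.

(** The residual [h] is orthogonal to the range of every generator in [s], hence to the difference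
    of the two approximants; Pythagoras concludes. *)
Lemma system_best_approximation (s : seq B) (t : seq (B * Zd)) (c : B * Zd -> R[i]) f :
  uniq s -> (forall a, a \in t -> a.1 \in s) -> L2 leb f ->
  nr leb (fun x => f x - \sum_(b <- s) P b f x) <=
  nr leb (fun x => f x - \sum_(a <- t) c a * C a.1 (chi a.2) x).
Proof.
move=> us ts Lf; set h := fun x => f x - \sum_(b <- s) P b f x.
pose e x := \sum_(a <- t) c a * C a.1 (chi a.2) x.
pose g x := \sum_(b <- s) P b f x.
have Lg : L2 leb g by apply: L2_fsum => b; exact: L2_proj.
have Lh : L2 leb h by exact: L2B.
have Le : L2 leb e by apply: L2_lincomb => a; apply: LC; exact: L2_chi.
have orth b u : b \in s -> L2 haar u -> ip leb (C b u) h = 0.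
  move=> bs Lu; rewrite ipBr//; last exact: LC.
  have -> : ip leb (C b u) g = ip leb (C b u) (P b f).
    rewrite (_ : g = (fun x => \sum_(b' <- s) 1 * P b' f x)); last first.
      by apply/funext => x; apply: eq_bigr => b' _; rewrite mul1r.
    rewrite ip_sumr; [|exact: LC|by move=> b'; exact: L2_proj].
    rewrite (bigD1_seq b)//= big1 ?addr0 ?mul1r// => b' b'b.
    by rewrite mul1r ip_system//; [rewrite eq_sym (negbTE b'b) mul0r|exact: bracket_L2].
  by rewrite ip_proj// subrr.
have hg : ip leb h (fun x => g x - e x) = 0.
  rewrite ipBr//.
  have -> : ip leb h e = 0.
    apply: orthogonal_sum => //; first by move=> a; apply: LC; exact: L2_chi.
    by move=> a /ts a1; apply: orth => //; exact: L2_chi.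
  rewrite subr0 (_ : g = (fun x => \sum_(b <- s) 1 * P b f x)); last first.
    by apply/funext => x; apply: eq_bigr => b _; rewrite mul1r.
  apply: orthogonal_sum => //; first by move=> b; exact: L2_proj.
  by move=> b bs; apply: orth => //; exact: bracket_L2.
have Lge : L2 leb (fun x => g x - e x) by exact: L2B.
rewrite -(@ler_pXn2r _ 2)// ?nnegrE ?nr_ge0//.
rewrite (_ : (fun x => f x - \sum_(a <- t) _) = (fun x => h x + (g x - e x))).
  by rewrite (pythagoras Lh Lge hg) lerDl sqr_ge0.
by apply/funext => x; rewrite /h -/(g x) addrA subrK.
Qed.

(** The isometry attached to [b] transports an approximation of the bracket by characters on the
    torus. *)
Lemma proj_chi_approximation b f (eps : R) : L2 leb f -> 0 < eps ->
  exists (s : seq Zd) (c : Zd -> R[i]),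
    nr leb (fun x => P b f x - \sum_(k <- s) c k * C b (chi k) x) < eps.
Proof.
move=> Lf e0; have Lb := bracket_L2 uD (Lp b) (p1 b) Lf.
have [s [c sc]] := torus_characters_dense Lb e0; exists s, c.
rewrite (_ : (fun x => _) = C b (fun z => bracket D (lev b) (p b) f z - \sum_(k <- s) c k * chi k z)).
  rewrite nr_circ//; apply: L2B => //; apply: L2_lincomb => k; exact: L2_chi.
apply/funext => x; rewrite /circ mulrBr; congr (_ - _); rewrite mulr_sumr.
by apply: eq_bigr => k _; rewrite mulrCA.
Qed.

Lemma system_sum_approximation (s : seq B) f (eps : R) : L2 leb f -> 0 < eps ->
  exists l : seq (R[i] * (B * Zd)),
    nr leb (fun x => \sum_(b <- s) P b f x - \sum_(a <- l) a.1 * C a.2.1 (chi a.2.2) x) < eps.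
Proof.
move=> Lf; elim: s eps => [|b s IH] eps e0.
  by exists [::]; under eq_fun do rewrite !big_nil subr0; rewrite nr_cst0.
have e2 : 0 < eps / 2 by rewrite divr_gt0.
have [l hl] := IH _ e2; have [t [c tc]] := proj_chi_approximation b Lf e2.
exists ([seq (c k, (b, k)) | k <- t] ++ l).
rewrite (_ : (fun x => _) = (fun x => (P b f x - \sum_(k <- t) c k * C b (chi k) x) +
   (\sum_(b <- s) P b f x - \sum_(a <- l) a.1 * C a.2.1 (chi a.2.2) x))); last first.
  by apply/funext => x; rewrite big_cons big_cat big_map /=; ring.
have LCc a : L2 leb (C a.1 (chi a.2)) by apply: LC; exact: L2_chi.
rewrite (le_lt_trans (nrD _ _))//; last by rewrite [ltRHS]splitr ltrD.
  apply: L2B; first exact: L2_proj.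
  by apply: L2_lincomb => k; exact: (LCc (b, k)).
apply: L2B; first by apply: L2_fsum => b'; exact: L2_proj.
by apply: (@L2_lincomb _ _ _ _ _ l (fun a => a.1) (fun a => C a.2.1 (chi a.2.2))) => a; exact: LCc.
Qed.

End orthonormal_system.
End bracket_systems.

(** * Wavelets and the bracket relations *)

Section wavelet_systems.
Context {R : realType} {d : nat} (D : 'M[int]_d).
Local Notation Rd := 'cV[R]_d.
Local Notation Zd := 'cV[int]_d.
Local Notation leb := (lebesgue_cV R d).
Local Notation fn := (Rd -> R[i]).
Local Notation haar := (@haar R d).
Local Notation nr := (nr leb).
Hypothesis uD : @DR R d D \in unitmx.

Lemma is_fourier_sum (I : Type) (s : seq I) (c : I -> R[i]) (e h : I -> fn) :
  (forall a, L2 leb (e a)) -> (forall a, is_fourier (e a) (h a)) ->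
  is_fourier (fun x => \sum_(a <- s) c a * e a x) (fun x => \sum_(a <- s) c a * h a x).
Proof.
move=> Le eh; elim: s => [|a s IH].
  have := is_fourierZ 0 (L2_cst0 leb) (fourierP (L2_cst0 leb)).
  congr is_fourier; by apply/funext => x; rewrite mul0r big_nil.
have := is_fourier_lin (c a) (Le a) (L2_lincomb s c Le) (eh a) IH.
by congr is_fourier; apply/funext => x; rewrite big_cons.
Qed.

(** The residual on the Fourier side is a transform of the residual itself, so approximating [f] and
    approximating its transform are the same problem. *)
Lemma nr_fourier_sum (I : Type) (s : seq I) (c : I -> R[i]) (e h : I -> fn) f :
  (forall a, L2 leb (e a)) -> (forall a, is_fourier (e a) (h a)) -> L2 leb f ->
  nr (fun x => fourier f x - \sum_(a <- s) c a * h a x) = nr (fun x => f x - \sum_(a <- s) c a * e a x).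
Proof.
move=> Le eh Lf; have LS := L2_lincomb s c Le.
have := is_fourier_nr _ (is_fourier_lin (-1) LS Lf (is_fourier_sum s c Le eh) (fourierP Lf)).
rewrite (_ : (fun x => -1 * \sum_(a <- s) c a * e a x + f x) = (fun x => f x - \sum_(a <- s) c a * e a x)).
  rewrite (_ : (fun x => -1 * \sum_(a <- s) c a * h a x + fourier f x) = (fun x => fourier f x - \sum_(a <- s) c a * h a x)).
    by apply; exact: L2B.
  by apply/funext => x; ring.
by apply/funext => x; ring.
Qed.

Lemma translate0 (f : fn) : translate 0 f = f.
Proof. by apply/funext => x; rewrite /translate map_mx0 subr0. Qed.

(** Orthonormal translates force the bracket of the transform with itself at level 0 to be 1 almost
    everywhere, so its essential supremum is at most 1. Both membership claims, for wavelets and for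
    scaling functions, reduce to this. *)
Lemma Y0_fourier f : L2 leb f -> (forall k, inner (translate k f) f = (k == 0)%:R) ->
  Y D 0 (fourier f).
Proof.
move=> Lf on; have LF := is_fourier_L2 (fourierP Lf).
have w k := wavelet_fourier uD 0 k Lf.
have p1 : {ae haar, forall z, bracket D 0 (fourier f) (fourier f) z = 1}.
  apply: chi_circ_orthogonal => //.
    by move=> k; exact: is_fourier_L2 (w k).2.
  move=> k; rewrite mulr1 -on; exact: (is_fourier_ip (w k).1 Lf (w k).2 (fourierP Lf)).
split; first by case: LF.
rewrite /Ynorm; have : (ess_sup haar (bracket_sq D 0 (fourier f)) <= 1)%E.
  by apply/ess_supP; apply: filterS (bracket_sq1 uD LF p1) => z ->.
by case: (ess_sup _ _) => [r| |] // _; rewrite ?poweRNyr ?poweR_EFin ?ltry.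
Qed.

Variables (M : nat) (psi : 'I_M -> fn).
Hypothesis Lpsi : forall i, L2 leb (psi i).
Local Notation p := (fun a : 'I_M * int => hdilz D a.2 (fourier (psi a.1))).
Local Notation e := (fun a : 'I_M * int * Zd => dilz D a.1.2 (translate a.2 (psi a.1.1))).
Local Notation C a u := (circ D a.2 (p a) u).

Let Le a : L2 leb (e a). Proof. by case: (wavelet_fourier uD a.1.2 a.2 (Lpsi a.1.1)). Qed.

Let eF a : is_fourier (e a) (C a.1 (chi a.2)).
Proof. by case: (wavelet_fourier uD a.1.2 a.2 (Lpsi a.1.1)). Qed.

Let Lp_ a : L2 leb (p a).
Proof. by have := is_fourier_L2 (eF (a, 0)); rewrite /= circ_chi0. Qed.

(** All translates of the first wavelet against the untranslated second one exhaust the Fourier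
    coefficients of the bracket, whatever the two levels. *)
Lemma brackets_of_orthonormal : (forall a b, inner (e a) (e b) = (a == b)%:R) ->
  forall a b, {ae haar, forall z, bracket D a.2 (p a) (p b) z = (a == b)%:R}.
Proof.
move=> on a b; apply: chi_circ_orthogonal => // k; first exact: is_fourier_L2 (eF (a, k)).
have := is_fourier_ip (Le (a, k)) (Le (b, 0)) (eF (a, k)) (eF (b, 0)).
rewrite [RHS]on /= circ_chi0 => ->.
by rewrite xpair_eqE mulrC -natrM mulnb.
Qed.

(** An approximation of [f] by finitely many wavelets involves finitely many pairs (generator,
    level); the projections over any finite set containing these pairs approximate at least as
    well. *)
Lemma wavelet_expansion :
  (forall a b : 'I_M * int, {ae haar, forall z, bracket D a.2 (p a) (p b) z = (a == b)%:R}) ->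
  (forall f, Lp 2%:E f -> forall eps : R, 0 < eps -> exists (s : seq ('I_M * int * Zd)) (c : _ -> R[i]),
    (L2dist f (fun x => (\sum_(a <- s) c a * e a x)%R) < eps%:E)%E) ->
  forall f, Lp 2%:E f -> L2_sum (fun a => C a (bracket D a.2 (p a) (fourier f))) (fourier f).
Proof.
move=> pE dens f Lpf; have Lf := (Lp2P f).1 Lpf; have LF := is_fourier_L2 (fourierP Lf).
have LP a : L2 leb (C a (bracket D a.2 (p a) (fourier f))).
  exact: (L2_proj uD (lev := snd) Lp_ pE).
split=> [a|eps e0]; first exact/Lp2P.
have [s [c sc]] := dens f Lpf _ e0.
have LS : L2 leb (fun x => \sum_(a <- s) c a * e a x) by exact: L2_lincomb.
rewrite L2distE// lte_fin -(nr_fourier_sum s c Le eF Lf) in sc.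
exists [fset a.1 | a in s]%fset => A sA.
rewrite L2distE//; last exact: L2_fsum.
rewrite lte_fin; apply: le_lt_trans sc.
apply: (system_best_approximation uD (lev := snd) Lp_ pE) => //.
by move=> a sa; apply: (fsubsetP sA); apply: in_imfset.
Qed.

Lemma orthonormal_of_brackets :
  (forall a b : 'I_M * int, {ae haar, forall z, bracket D a.2 (p a) (p b) z = (a == b)%:R}) ->
  forall a b, inner (e a) (e b) = (a == b)%:R.
Proof.
move=> pE a b; rewrite [LHS](_ : _ = ip leb (e a) (e b))//.
rewrite -(is_fourier_ip (Le a) (Le b) (eF a) (eF b)).
rewrite (ip_system_chi uD (lev := snd) Lp_ pE a.1 b.1 a.2 b.2).
by rewrite -!surjective_pairing.
Qed.

(** Half of the error goes to a finite sum of projections, half to the approximation of these by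
    finitely many wavelets. *)
Lemma dense_of_expansion :
  (forall a b : 'I_M * int, {ae haar, forall z, bracket D a.2 (p a) (p b) z = (a == b)%:R}) ->
  (forall f, Lp 2%:E f -> L2_sum (fun a => C a (bracket D a.2 (p a) (fourier f))) (fourier f)) ->
  forall f, Lp 2%:E f -> forall eps : R, 0 < eps -> exists (s : seq ('I_M * int * Zd)) (c : _ -> R[i]),
    (L2dist f (fun x => (\sum_(a <- s) c a * e a x)%R) < eps%:E)%E.
Proof.
move=> pE ex f Lpf eps e0; have Lf := (Lp2P f).1 Lpf; have LF := is_fourier_L2 (fourierP Lf).
have LP a : L2 leb (C a (bracket D a.2 (p a) (fourier f))).
  exact: (L2_proj uD (lev := snd) Lp_ pE).
have LC a : L2 leb (C a.1 (chi a.2)) by exact: is_fourier_L2 (eF a).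
have e2 : 0 < eps / 2 by rewrite divr_gt0.
have [_ /(_ _ e2)[A /(_ A (fsubset_refl A))]] := ex f Lpf.
have LA : L2 leb (fun x => \sum_(a <- A) C a (bracket D a.2 (p a) (fourier f)) x) by exact: L2_fsum.
rewrite L2distE// lte_fin => hA.
have [l hl] := system_sum_approximation uD (lev := snd) Lp_ pE A LF e2.
pose s := undup (map snd l); pose c a := \sum_(b <- l | b.2 == a) b.1.
exists s, c; rewrite L2distE//; last exact: L2_lincomb.
rewrite lte_fin -(nr_fourier_sum s c Le eF Lf).
have LS : L2 leb (fun x => \sum_(a <- s) c a * C a.1 (chi a.2) x) by exact: L2_lincomb.
apply: le_lt_trans (nr_sub_le LF LS LA) _; rewrite [ltRHS]splitr ltrD//.
move: hl; congr (nr _ < _); apply/funext => x; congr (_ - _).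
exact: regroup_sum.
Qed.

End wavelet_systems.

Theorem proposition5p5 (R : realType) (d : nat) (hd : (0 < d)%N)
    (D : 'M[int]_d) (hD : dilation_matrix R D)
    (M : nat) (psi : 'I_M -> 'cV[R]_d -> R[i])
    (hpsi : forall i, Lp 2%:E (psi i)) :
  (multiwavelet D psi <->
    (forall (i j : 'I_M) (k n : int),
       {ae @haar R d, forall zeta,
          bracket D n (hdilz D n (fourier (psi i)))
                      (hdilz D k (fourier (psi j))) zeta
          = (i == j)%:R * (k == n)%:R}) /\
    (forall f : 'cV[R]_d -> R[i], Lp 2%:E f ->
       L2_sum
         (fun a : 'I_M * int =>
            circ D a.2 (hdilz D a.2 (fourier (psi a.1)))
              (bracket D a.2 (hdilz D a.2 (fourier (psi a.1))) (fourier f)))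
         (fourier f))) /\
  (multiwavelet D psi -> forall i, Y D 0 (fourier (psi i))) /\
  (forall (r : nat) (phi : 'I_r -> 'cV[R]_d -> R[i]),
     scaling_functions D phi -> forall i, Y D 0 (fourier (phi i))).
Proof.
have uD := dilation_matrix_unit hD; have Lpsi i : L2 (lebesgue_cV R d) (psi i) by exact/Lp2P.
(* The two Kronecker deltas together express equality of the pairs (generator, level). *)
have deltaE (a b : 'I_M * int) : (a.1 == b.1)%:R * (b.2 == a.2)%:R = (a == b)%:R :> R[i].
  by rewrite -natrM mulnb (eq_sym b.2) -xpair_eqE -!surjective_pairing.
split; last split.
- split=> [[_ on dens]|[br ex]].
    have pE := brackets_of_orthonormal uD Lpsi on.
    split; last exact: (wavelet_expansion uD Lpsi pE dens).
    move=> i j k n; apply: filterS (pE (i, n) (j, k)) => z /= ->.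
    by rewrite -(deltaE (i, n) (j, k)).
  have pE (a b : 'I_M * int) : {ae @haar R d, forall z,
      bracket D a.2 (hdilz D a.2 (fourier (psi a.1))) (hdilz D b.2 (fourier (psi b.1))) z = (a == b)%:R}.
    by rewrite -deltaE; exact: br.
  split; last exact: (dense_of_expansion uD Lpsi pE ex).
    by move=> a; apply/Lp2P; case: (wavelet_fourier uD a.1.2 a.2 (Lpsi a.1.1)).
  exact: (orthonormal_of_brackets uD Lpsi pE).
(* At level 0 the dilation is the identity, so the wavelets of index [(i, 0, k)] are the plain
   translates of [psi i]. *)
- move=> [_ on _] i; apply: Y0_fourier => // k.
  have := on (i, 0, k) (i, 0, 0); rewrite /= /dilz /= translate0 => ->.
  by rewrite xpair_eqE eqxx.
- move=> r phi [V hV [phiV on _]] i.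
  have Lphi : L2 (lebesgue_cV R d) (phi i).
    apply/Lp2P; have [VL _ _ _] := gmra_closed hV 0.
    by apply: VL; have := phiV (i, 0); rewrite /= translate0.
  apply: Y0_fourier => // k; have := on (i, k) (i, 0); rewrite /= translate0 => ->.
  by rewrite xpair_eqE eqxx.
Qed.
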